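(* Let $H \in \mathcal{H}_2^{n_i \times n_i}$ and let $\Sigma_{\mathrm{pH}}$ be the set of port-Hamiltonian models $(\hat J, \hat R, \hat B)$ such that $\hat J, \hat R \in \mathbb{R}^{r \times r}$, $\hat J^{\mathrm{T}} = -\hat J$, $\hat R = \hat R^{\mathrm{T}} \succcurlyeq 0$, $\hat J - \hat R$ has all of its eigenvalues in $\mathbb{C}_-$, and $\hat B \in \mathbb{R}^{r \times n_i}$. Let $(\hat J, \hat R, \hat B)$ be $\mathcal{H}_2$-optimal for $H$ in $\Sigma_{\mathrm{pH}}$. Suppose that $\hat R \succ 0$ and that the transfer function $\hat H$ of $(\hat J, \hat R, \hat B)$ has $r$ distinct poles and is represented as $\hat H(s) = \sum_{i=1}^{r} \frac{c_i b_i^*}{s - \lambda_i}$. Furthermore, let $\hat T$ be an eigenvector matrix of $\hat J - \hat R$ and denote $\hat T e_i = t_i$, $\hat T^{-*} e_i = s_i$, $\hat B^{\mathrm{T}} t_i = c_i$, and $\hat B^{\mathrm{T}} s_i = b_i$. Then, in addition to $$c_i^* \bigl( H(-\overline{\lambda_i}) - H(-\overline{\lambda_j}) \bigr) b_j = c_i^* \bigl( \hat H(-\overline{\lambda_i}) - \hat H(-\overline{\lambda_j}) \bigr) b_j, \qquad c_i^* H'(-\overline{\lambda_i}) b_i = c_i^* \hat H'(-\overline{\lambda_i}) b_i$$ for $i, j = 1, 2, \dots, r$, $\hat H$ also satisfies $$\sum_{i=1}^{r} \Bigl( H(-\overline{\lambda_i}) \, b_i t_i^* + H(-\overline{\lambda_i})^*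 \, c_i s_i^* \Bigr) = \sum_{i=1}^{r} \Bigl( \hat H(-\overline{\lambda_i}) \, b_i t_i^* + \hat H(-\overline{\lambda_i})^* \, c_i s_i^* \Bigr).$$
   Context: $n_i, r$ are positive integers; $\boldsymbol{\imath}$ is the imaginary unit; $\mathbb{C}_+$, $\mathbb{C}_-$ are the open right and left half-planes; $(\cdot)^*$ is the conjugate transpose; $e_i$ is the $i$th canonical basis vector; $\succcurlyeq 0$ and $\succ 0$ denote positive semidefinite and positive definite. A port-Hamiltonian model $(\hat J, \hat R, \hat B)$ is the system $\dot{\hat x}(t) = (\hat J - \hat R) \hat x(t) + \hat B u(t)$, $\hat y(t) = \hat B^{\mathrm{T}} \hat x(t)$, with transfer function $\hat H(s) = \hat B^{\mathrm{T}} (s \hat I - \hat J + \hat R)^{-1} \hat B$. An eigenvector matrix of $\hat J - \hat R$ is an invertible $\hat T \in \mathbb{C}^{r \times r}$ with $\hat T^{-1} (\hat J - \hat R) \hat T = \operatorname{diag}(\lambda_1, \dots, \lambda_r)$. $\mathcal{H}_2^{n_i \times n_i}$ is the Hardy space of $\mathbb{C}^{n_i \times n_i}$-valued functions analytic on $\mathbb{C}_+$ with finite $\mathcal{H}_2$ norm, where $\|F\|_{\mathcal{H}_2}^2 = \frac{1}{2\pi} \int_{-\infty}^{\infty} \|F(\boldsymbol{\imath}\omega)\|_F^2 \, d\omega$ (boundary values on the imaginary axis). A model is $\mathcal{H}_2$-optimal for $H$ in a set of models if its transfer function $\hat H$ minimizes $\|H - \hat H\|_{\mathcal{H}_2}$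 over that set.
   Formalization: H is additionally assumed conjugate-symmetric (H at the conjugate of s is the entrywise conjugate of H(s) on the right half-plane); without it the claim fails, e.g. n_i = r = 1, H(s) = 1/(s+1) + i/(s+2), whose optimal model is 1/(s+1). *)

(* Defs.v *)
From HB Require Import structures.
From mathcomp Require Import all_boot all_order all_algebra.
From mathcomp Require Import sesquilinear spectral.
From mathcomp Require Import all_classical all_reals all_analysis.
From mathcomp Require Import complex.

Set Implicit Arguments.
Unset Strict Implicit.
Unset Printing Implicit Defensive.

Import Order.TTheory GRing.Theory Num.Theory.
Import numFieldNormedType.Exports.

Local Open Scope classical_set_scope.
Local Open Scope ring_scope.
Local Open Scope sesquilinear_scope.

(* [numFieldNormedType.Exports] does not reach the concrete type [R[i]]; with
   this instance, [derivable F z 1] and [derive1 F z] for [F] defined on [R[i]] are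
   complex differentiability and the complex derivative. *)
HB.instance Definition _ (R : realType) := NormedModule.copy R[i] R[i]^o.

Definition frobenius (R : realType) (m n : nat) (M : 'M[R[i]]_(m, n)) : R :=
  Num.sqrt (\sum_i \sum_j ComplexField.Normc.normc (M i j) ^+ 2).

Definition complexify (R : realType) (m n : nat) (M : 'M[R]_(m, n)) :
  'M[R[i]]_(m, n) := map_mx (real_complex R) M.

Definition psdmx (R : realType) (n : nat) (M : 'M[R]_n) : Prop :=
  forall x : 'cV[R]_n, 0 <= (x^T *m M *m x) 0 0.

Definition pdmx (R : realType) (n : nat) (M : 'M[R]_n) : Prop :=
  forall x : 'cV[R]_n, x != 0 -> 0 < (x^T *m M *m x) 0 0.

Section Hardy.
Variables (R : realType) (n : nat).
Implicit Types F : R[i] -> 'M[R[i]]_n.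

Definition has_boundary_value F (w : R) : Prop :=
  cvg (F (x +i* w)%C @[x --> 0^'+]).

(* Meaningful at the [w] such that [has_boundary_value F w]. *)
Definition boundary_value F (w : R) : 'M[R[i]]_n :=
  lim (F (x +i* w)%C @[x --> 0^'+]).

Definition H2norm F : \bar R :=
  ((((2 * pi)^-1)%:E *
    \int[lebesgue_measure]_w (frobenius (boundary_value F w) ^+ 2)%:E)
   `^ (2^-1 : R))%E.

(* The L^2 bound that is uniform over the vertical lines of the right half-plane
   is the usual Hardy space condition: finiteness of the boundary integral alone
   would admit functions such as exp(s) / (s + 1), which are not in H_2.
   The boundary values, in terms of which the norm is defined, exist almost
   everywhere by Fatou's theorem; here this is part of the definition. *)
Definition hardyH2 F : Prop :=
  [/\ forall z : R[i], 0 < complex.Re z -> derivable F z 1,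
      exists K : R, forall x : R, 0 < x ->
        (\int[lebesgue_measure]_w (frobenius (F (x +i* w)%C) ^+ 2)%:E
           <= K%:E)%E,
      {ae lebesgue_measure, forall w : R, has_boundary_value F w} &
      (H2norm F < +oo)%E].

(* F is the Laplace transform of a real impulse response. Models with real
   matrices only see the real part (F(z) + conj F(conj z)) / 2 of F: adding
   i G to F, with G real, changes all the squared distances to F by the same
   constant. Interpolation of F itself by an optimal model hence needs F real. *)
Definition conj_symmetric F : Prop :=
  forall z : R[i], 0 < complex.Re z -> F z^* = (F z) ^ Num.conj.

(* For a rational F, the poles are the points near which F is unbounded. *)
Definition pole F (z : R[i]) : Prop :=
  frobenius (F s) @[s --> z^'] --> +oo.

End Hardy.

Section PortHamiltonian.
Variables (R : realType) (n r : nat).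

Record pH_model := PHModel {
  pH_J : 'M[R]_r;
  pH_R : 'M[R]_r;
  pH_B : 'M[R]_(r, n) }.

Implicit Types M : pH_model.

Definition pH_A M : 'M[R[i]]_r := complexify (pH_J M - pH_R M).

Definition transfer M (s : R[i]) : 'M[R[i]]_n :=
  (complexify (pH_B M))^T
    *m invmx (s%:M - complexify (pH_J M) + complexify (pH_R M))
    *m complexify (pH_B M).

Definition Sigma_pH : set pH_model :=
  [set M | [/\ (pH_J M)^T = - pH_J M,
               pH_R M = (pH_R M)^T,
               psdmx (pH_R M) &
               forall z : R[i], eigenvalue (pH_A M) z -> complex.Re z < 0]].

Definition H2_optimal (H : R[i] -> 'M[R[i]]_n) (S : set pH_model) M : Prop :=
  S M /\ forall M', S M' ->
    (H2norm (fun z => H z - transfer M z)%R <=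
      H2norm (fun z => H z - transfer M' z)%R)%E.

Definition eigenvector_matrix (A T : 'M[R[i]]_r) (lambda : 'I_r -> R[i]) :
  Prop :=
  T \in unitmx /\ invmx T *m A *m T = diag_mx (\row_i lambda i).

End PortHamiltonian.

(* Main.v *)
(* Let E = H - \hat H, regarded on the imaginary axis. Perturbing the optimal model
   inside the constraint set changes \hat H to first order by a direction D, and
   optimality gives Re <E, D> = 0. As R is positive definite, J - R may be moved in
   any real direction X, where D = B^T (s - A)^{-1} X (s - A)^{-1} B with A = J - R;
   B may be moved in any real direction W. By complex linearity X may be replaced by
   t_i s_j^*, for which D(s) = c_i b_j^* / ((s - lambda_i) (s - lambda_j)), and the
   Cauchy formula turns <E, D> into a divided difference of c_i^* E b_j between
   -conj lambda_i and -conj lambda_j, or a derivative if i = j. For the directions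
   W the Cauchy formula, applied to the modal expansion of (s - A)^{-1}, gives the
   last condition.

   The Cauchy formula holds for the boundary values of an H_2 function because it
   holds on the lines Re s = x > 0 (Goursat's theorem on large rectangles, the L^2
   bound controlling the other three sides) and passes to the limit x -> 0: almost
   everywhere convergence with bounded L^2 norms implies weak convergence. *)

Require Import Defs.
From HB Require Import structures.
From mathcomp Require Import all_boot all_order all_algebra.
From mathcomp Require Import sesquilinear spectral.
From mathcomp Require Import all_classical all_reals all_analysis.
From mathcomp Require Import complex.
From mathcomp Require Import measurable_realfun.
From mathcomp Require Import ring lra.

Set Implicit Arguments.
Unset Strict Implicit.
Unset Printing Implicit Defensive.

Import Order.TTheory GRing.Theory Num.Theory.
Import numFieldNormedType.Exports.

Local Open Scope classical_set_scope.
Local Open Scope ring_scope.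
Local Open Scope sesquilinear_scope.

Local Notation Re := complex.Re.
Local Notation Im := complex.Im.
Local Notation normc := ComplexField.Normc.normc.
Local Notation "a +i b" := (Complex a b) (at level 50) : ring_scope.

(** * Complex integrals over the real line *)

(** Stationarity only constrains the real part of a pairing, along real directions, whereas the
    conclusions are identities between complex numbers. The missing half comes from the reality of
    the data. The error is conjugate symmetric, so the pairing also commutes with conjugation of
    eigenvector directions, and the two facts together force it to vanish. For the directions of B,
    the imaginary part disappears because both sums are real combinations of entries of functions of
    the real matrix A. The second obstacle is that an H_2 bound controls f in mean square on
    vertical lines only. Nothing pointwise is known on the horizontal sides of a rectangle; there f
    is replaced, through an integration by parts against the kernel, by its primitive, which grows
    sublinearly with the height. Differentiation under the integral is avoided as well: the
    perturbed transfer function differs from its linearisation by at most a^2 times one fixed square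
    integrable function of the frequency, so minimality becomes 2 a P <= a^2 Q for all small a of
    both signs. *)

Section ComplexModulus.
Variable R : realType.
Implicit Types z w : R[i].

Lemma normc_ge0 z : 0 <= normc z.
Proof. by case: z => a b; exact: sqrtr_ge0. Qed.

Lemma normc_sqr z : normc z ^+ 2 = Re z ^+ 2 + Im z ^+ 2.
Proof. by case: z => a b /=; rewrite sqr_sqrtr ?addr_ge0 ?sqr_ge0. Qed.

Lemma Re_le_normc z : `|Re z| <= normc z.
Proof.
rewrite -(ler_pXn2r (ltn0Sn 1)) ?nnegrE ?normc_ge0 // real_normK ?num_real //.
by rewrite normc_sqr lerDl sqr_ge0.
Qed.

Lemma Im_le_normc z : `|Im z| <= normc z.
Proof.
rewrite -(ler_pXn2r (ltn0Sn 1)) ?nnegrE ?normc_ge0 // real_normK ?num_real //.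
by rewrite normc_sqr lerDr sqr_ge0.
Qed.

Lemma normc_le_Re_Im z : normc z <= `|Re z| + `|Im z|.
Proof.
rewrite -(ler_pXn2r (ltn0Sn 1)) ?nnegrE ?normc_ge0 ?addr_ge0 // normc_sqr.
rewrite sqrrD !real_normK ?num_real // lerD2r lerDl.
by rewrite mulrn_wge0 // mulr_ge0.
Qed.

Lemma normcD z w : normc (z + w) <= normc z + normc w.
Proof. exact: complex.le_normcD. Qed.

Lemma normcM z w : normc (z * w) = normc z * normc w.
Proof. exact: ComplexField.Normc.normcM. Qed.

Lemma normcN z : normc (- z) = normc z.
Proof. exact: complex.normcN. Qed.

Lemma normcV z : normc z^-1 = (normc z)^-1.
Proof. exact: ComplexField.Normc.normcV. Qed.

Lemma normc_conj z : normc z^* = normc z.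
Proof. by case: z => a b; rewrite /= sqrrN. Qed.

Lemma normcB_le z w : normc (z - w) <= normc z + normc w.
Proof. by rewrite -(normcN w) normcD. Qed.

Lemma normc_distrC z w : normc (z - w) = normc (w - z).
Proof. by rewrite -normcN opprB. Qed.

Lemma normc_lerB z w : normc z - normc w <= normc (z - w).
Proof. by rewrite lerBlDr -{1}(subrK w z) normcD. Qed.

Lemma normc_sum (I : Type) (s : seq I) (P : pred I) (f : I -> R[i]) :
  normc (\sum_(i <- s | P i) f i) <= \sum_(i <- s | P i) normc (f i).
Proof.
elim/big_ind2 : _ => [|x y z w|//]; first by rewrite ComplexField.Normc.normc0.
by move=> hx hz; apply: (le_trans (normcD _ _)); exact: lerD.
Qed.

Lemma normc_eq0 z : (normc z == 0) = (z == 0).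
Proof.
apply/eqP/eqP => [|->]; last exact: ComplexField.Normc.normc0.
exact: ComplexField.Normc.eq0_normc.
Qed.

Lemma normc_gt0 z : (0 < normc z) = (z != 0).
Proof. by rewrite lt_def normc_ge0 andbT normc_eq0. Qed.

Lemma normcR (x : R) : normc (x +i 0) = `|x|.
Proof. by rewrite /= expr0n addr0 sqrtr_sqr. Qed.

Lemma normcI (x : R) : normc (0 +i x) = `|x|.
Proof. by rewrite /= expr0n add0r sqrtr_sqr. Qed.

End ComplexModulus.

Section PathIntegral.
Variable R : realType.
Notation mu := (@lebesgue_measure R).
Implicit Types (D : set (measurableTypeR R)) (f g : R -> R[i]) (a b c : R).

(** Made of the finite parts of two real integrals, so the value is meaningful only when
    [cintegrable] holds. *)
Definition cint D f : R[i] :=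
  (\int[mu]_(x in D) Re (f x)) +i (\int[mu]_(x in D) Im (f x)).

Definition cintegrable D f : Prop :=
  mu.-integrable D (EFin \o (fun x => Re (f x))) /\
  mu.-integrable D (EFin \o (fun x => Im (f x))).

Lemma eq_cint D f g : (forall x, D x -> f x = g x) -> cint D f = cint D g.
Proof.
by move=> fg; congr (_ +i _); apply: eq_Rintegral => x /[!inE] Dx; rewrite fg.
Qed.

Lemma eq_cintegrable D f g : measurable D -> (forall x, D x -> f x = g x) ->
  cintegrable D f -> cintegrable D g.
Proof.
move=> mD fg [fr fi]; split.
- by apply: eq_integrable fr => // x /[!inE] Dx /=; rewrite fg.
- by apply: eq_integrable fi => // x /[!inE] Dx /=; rewrite fg.
Qed.

Lemma cintegrableD D f g : measurable D -> cintegrable D f -> cintegrable D g ->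
  cintegrable D (fun x => f x + g x).
Proof.
move=> mD [fr fi] [gr gi]; split.
- rewrite (_ : _ \o _ = ((EFin \o (fun x => Re (f x))) \+
    (EFin \o (fun x => Re (g x))))%E); first exact: integrableD.
  by apply/funext => x /=; case: (f x) (g x) => ? ? [].
- rewrite (_ : _ \o _ = ((EFin \o (fun x => Im (f x))) \+
    (EFin \o (fun x => Im (g x))))%E); first exact: integrableD.
  by apply/funext => x /=; case: (f x) (g x) => ? ? [].
Qed.

Lemma cintD D f g : measurable D -> cintegrable D f -> cintegrable D g ->
  cint D (fun x => f x + g x) = cint D f + cint D g.
Proof.
move=> mD [fr fi] [gr gi]; rewrite /cint.
rewrite -[RHS]/((_ + _) +i (_ + _)) -!RintegralD //.
by congr (_ +i _); apply: eq_Rintegral => x _; case: (f x) (g x) => ? ? [].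
Qed.

Lemma integrable_scale D (u : R -> R) (p : R) : measurable D ->
  mu.-integrable D (EFin \o u) ->
  mu.-integrable D (EFin \o (fun x => p * u x)).
Proof.
move=> mD hu; have := @integrableZl _ _ _ mu D mD p _ hu.
by apply: eq_integrable => // x _ /=; rewrite EFinM.
Qed.

Lemma integrable_lin D (u v : R -> R) (p q : R) : measurable D ->
  mu.-integrable D (EFin \o u) -> mu.-integrable D (EFin \o v) ->
  mu.-integrable D (EFin \o (fun x => p * u x + q * v x)).
Proof.
move=> mD hu hv; rewrite (_ : _ \o _ =
  ((fun x => p%:E * (EFin \o u) x) \+ (fun x => q%:E * (EFin \o v) x))%E) //.
by apply: integrableD => //; exact: integrableZl.
Qed.

Lemma Rintegral_lin D (u v : R -> R) (p q : R) : measurable D ->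
  mu.-integrable D (EFin \o u) -> mu.-integrable D (EFin \o v) ->
  \int[mu]_(x in D) (p * u x + q * v x) =
  p * \int[mu]_(x in D) u x + q * \int[mu]_(x in D) v x.
Proof.
move=> mD hu hv; rewrite RintegralD //.
- by rewrite !RintegralZl.
- exact: integrable_scale.
- exact: integrable_scale.
Qed.

Lemma cintegrableZ D f (k : R[i]) : measurable D -> cintegrable D f ->
  cintegrable D (fun x => k * f x).
Proof.
move=> mD [fr fi]; case: k => p q; split.
- have /= := integrable_lin p (- q) mD fr fi.
  by apply: eq_integrable => // x _ /=; case: (f x) => ? ? /=; rewrite mulNr.
- have /= := integrable_lin q p mD fr fi.
  by apply: eq_integrable => // x _ /=; case: (f x) => ? ? /=; rewrite addrC.
Qed.

Lemma cintZ D f (k : R[i]) : measurable D -> cintegrable D f ->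
  cint D (fun x => k * f x) = k * cint D f.
Proof.
move=> mD [fr fi]; case: k => p q; rewrite /cint -[RHS]/((_ - _) +i (_ + _)).
congr (_ +i _).
- rewrite -mulNr -Rintegral_lin //.
  by apply: eq_Rintegral => x _; case: (f x) => ? ? /=; rewrite mulNr.
- rewrite addrC -Rintegral_lin //.
  by apply: eq_Rintegral => x _; case: (f x) => ? ? /=; rewrite addrC.
Qed.

Lemma cintegrableN D f : measurable D -> cintegrable D f ->
  cintegrable D (fun x => - f x).
Proof.
move=> mD /(cintegrableZ (-1) mD); apply: eq_cintegrable => // x _.
by rewrite mulN1r.
Qed.

Lemma cintN D f : measurable D -> cintegrable D f ->
  cint D (fun x => - f x) = - cint D f.
Proof.
move=> mD fi; rewrite -mulN1r -cintZ //; apply: eq_cint => x _.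
by rewrite mulN1r.
Qed.

Lemma cintegrableB D f g : measurable D -> cintegrable D f -> cintegrable D g ->
  cintegrable D (fun x => f x - g x).
Proof. by move=> mD fi gi; apply: cintegrableD => //; exact: cintegrableN. Qed.

Lemma cintB D f g : measurable D -> cintegrable D f -> cintegrable D g ->
  cint D (fun x => f x - g x) = cint D f - cint D g.
Proof.
by move=> mD fi gi; rewrite cintD //; [rewrite cintN|exact: cintegrableN].
Qed.

Lemma cintegrable_sum D (I : eqType) (s : seq I) (F : I -> R -> R[i]) :
  measurable D -> (forall i, i \in s -> cintegrable D (F i)) ->
  cintegrable D (fun x => \sum_(i <- s) F i x).
Proof.
move=> mD; elim: s => [|i s ih] hF.
  apply: (@eq_cintegrable _ (fun=> 0)) => // [x _|]; first by rewrite big_nil.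
  by split; exact: integrable0.
have := cintegrableD mD (hF i (mem_head _ _))
  (ih (fun j hj => hF j (mem_behead (s := i :: s) hj))).
by apply: eq_cintegrable => // x _; rewrite big_cons.
Qed.

Lemma cint_sum D (I : eqType) (s : seq I) (F : I -> R -> R[i]) :
  measurable D -> (forall i, i \in s -> cintegrable D (F i)) ->
  cint D (fun x => \sum_(i <- s) F i x) = \sum_(i <- s) cint D (F i).
Proof.
move=> mD; elim: s => [|i s ih] hF.
  rewrite big_nil /cint.
  under eq_Rintegral do rewrite big_nil.
  under [X in _ +i X]eq_Rintegral do rewrite big_nil.
  by rewrite /Rintegral !integral0.
have hs j (js : j \in s) := hF j (mem_behead (s := i :: s) js).
rewrite big_cons -ih // -cintD //.
- by apply: eq_cint => x _; rewrite big_cons.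
- by apply: hF; exact: mem_head.
- exact: cintegrable_sum.
Qed.

Lemma cintegrable_normc D f : measurable D -> cintegrable D f ->
  mu.-integrable D (EFin \o (fun x => normc (f x))).
Proof.
move=> mD [fr fi]; have mr := measurable_int _ fr; have mi := measurable_int _ fi.
have ig : mu.-integrable D (EFin \o (fun x => `|Re (f x)| + `|Im (f x)|)).
  have := integrableD mD (integrable_abse fr) (integrable_abse fi).
  by apply: eq_integrable => // x _ /=; rewrite EFinD.
apply: (le_integrable mD _ _ ig); last first.
  move=> x Dx /=; rewrite lee_fin (ger0_norm (normc_ge0 _)).
  by apply: (le_trans (normc_le_Re_Im _)); exact: ler_norm.
apply/measurable_EFinP.
rewrite (_ : (fun _ => _) =
  (fun x => Num.sqrt (Re (f x) ^+ 2 + Im (f x) ^+ 2))); last first.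
  by apply/funext => x; case: (f x).
have ms := continuous_measurable_fun (@sqrt_continuous R).
apply: (measurableT_comp ms (g := fun x => Re (f x) ^+ 2 + Im (f x) ^+ 2)).
by apply: measurable_funD; apply: measurable_funX; exact/measurable_EFinP.
Qed.

(** The two components are bounded separately; this costs the factor 2 that reappears in later
    constants. *)
Lemma normc_cint_le D f : measurable D -> cintegrable D f ->
  normc (cint D f) <= 2 * \int[mu]_(x in D) normc (f x).
Proof.
move=> mD fi; have fn := cintegrable_normc mD fi; case: (fi) => fr fm.
apply: (le_trans (normc_le_Re_Im _)) => /=; rewrite mulrDl mul1r; apply: lerD.
- apply: (le_trans (le_normr_Rintegral mD fr)); apply: le_Rintegral => //.
  + exact: integrable_abse fr.
  + by move=> x _; exact: Re_le_normc.
- apply: (le_trans (le_normr_Rintegral mD fm)); apply: le_Rintegral => //.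
  + exact: integrable_abse fm.
  + by move=> x _; exact: Im_le_normc.
Qed.

Lemma cintegrable_le D f (g : R -> R) : measurable D ->
  measurable_fun D (fun x => Re (f x)) -> measurable_fun D (fun x => Im (f x)) ->
  mu.-integrable D (EFin \o g) -> (forall x, D x -> normc (f x) <= g x) ->
  cintegrable D f.
Proof.
move=> mD mr mi ig fg; split; apply: (le_integrable mD _ _ ig).
- exact/measurable_EFinP.
- move=> x Dx /=; rewrite lee_fin (le_trans (Re_le_normc _)) //.
  by rewrite (le_trans (fg _ Dx)) // ler_norm.
- exact/measurable_EFinP.
- move=> x Dx /=; rewrite lee_fin (le_trans (Im_le_normc _)) //.
  by rewrite (le_trans (fg _ Dx)) // ler_norm.
Qed.

(** The norm of [R[i]] takes its values in [R[i]]; stating continuity with [normc] keeps the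
    estimates in the real field. *)
Definition ccont f a : Prop :=
  forall e : R, 0 < e -> exists2 d : R, 0 < d &
    forall x, `|x - a| < d -> normc (f x - f a) < e.

Lemma ccont_Re f a : ccont f a -> {for a, continuous (fun x => Re (f x))}.
Proof.
move=> fa; apply/cvgrPdist_lt => e e0; have [d d0 h] := fa e e0.
near=> x; apply: (le_lt_trans _ (h x _)).
  rewrite normc_distrC; apply: le_trans (Re_le_normc _).
  by case: (f a) (f x) => ? ? [].
near: x; apply/nbhs_ballP; exists d => //= y; rewrite /ball /= distrC.
by [].
Unshelve. all: by end_near. Qed.

Lemma ccont_Im f a : ccont f a -> {for a, continuous (fun x => Im (f x))}.
Proof.
move=> fa; apply/cvgrPdist_lt => e e0; have [d d0 h] := fa e e0.
near=> x; apply: (le_lt_trans _ (h x _)).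
  rewrite normc_distrC; apply: le_trans (Im_le_normc _).
  by case: (f a) (f x) => ? ? [].
near: x; apply/nbhs_ballP; exists d => //= y; rewrite /ball /= distrC.
by [].
Unshelve. all: by end_near. Qed.

Lemma ccont_within a b f : (forall x, a <= x <= b -> ccont f x) ->
  {within `[a, b], continuous (fun x => Re (f x))} /\
  {within `[a, b], continuous (fun x => Im (f x))}.
Proof.
move=> h; split; apply: continuous_in_subspaceT => x; rewrite inE /= in_itv /= => hx.
- by apply: ccont_Re; exact: h.
- by apply: ccont_Im; exact: h.
Qed.

Lemma ccont_integrable a b f : (forall x, a <= x <= b -> ccont f x) ->
  cintegrable `[a, b] f.
Proof.
move=> /ccont_within[hr hi]; split;
  by apply: continuous_compact_integrable => //; exact: segment_compact.
Qed.

Lemma ccont_measurable f : (forall x, ccont f x) ->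
  measurable_fun setT (fun x => Re (f x)) /\ measurable_fun setT (fun x => Im (f x)).
Proof.
move=> h; split; apply: continuous_measurable_fun => x.
- exact: ccont_Re.
- exact: ccont_Im.
Qed.

Lemma cint_split a c b f : a <= c <= b -> cintegrable `[a, b] f ->
  cint `[a, b] f = cint `[a, c] f + cint `[c, b] f.
Proof.
move=> /andP[ac cb] [fr fi]; rewrite /cint -[RHS]/((_ + _) +i (_ + _)).
have key (u : R -> R) : mu.-integrable `[a, b] (EFin \o u) ->
    \int[mu]_(x in `[a, b]) u x =
    \int[mu]_(x in `[a, c]) u x + \int[mu]_(x in `[c, b]) u x.
  (* The point [c], common to both segments, is negligible and is dropped from the right one. *)
  move=> iu; rewrite -(Rintegral_itv_obnd_cbnd (r := c)).
    by rewrite -(Rintegral_itvB iu (x := c)) ?bnd_simp // addrC subrK.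
  by apply: integrableS iu => //; apply: subset_itvr; rewrite bnd_simp.
by congr (_ +i _); exact: key.
Qed.
End PathIntegral.

(** * Goursat's theorem on rectangles *)

Section Bisection.
Variable R : realType.

Lemma nested_intervals (u v : nat -> R) :
  (forall n, u n <= u n.+1) -> (forall n, v n.+1 <= v n) ->
  (forall n, u n <= v n) -> exists x, forall n, u n <= x <= v n.
Proof.
move=> hu hv huv.
have mu m n : (m <= n)%N -> u m <= u n.
  by move=> /(homo_leq (@lexx _ R) (@le_trans _ R)); apply.
have mv m n : (m <= n)%N -> v n <= v m.
  by move=> /(homo_leq (r := fun x y => y <= x) (@lexx _ R)
    (fun y x z (xy : y <= x) (yz : z <= y) => le_trans yz xy)); apply.
have uv m n : u n <= v m.
  case: (leqP n m) => [/mu h|/ltnW/mv h]; first exact: le_trans h (huv m).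
  exact: le_trans (huv n) h.
have su : has_sup (range u).
  split; first by exists (u 0%N), 0%N.
  by exists (v 0%N) => _ [n _ <-].
exists (sup (range u)) => n; apply/andP; split.
- by apply: ub_le_sup; [case: su|exists n].
- by apply: ge_sup; [case: su|move=> _ [m _ <-]].
Qed.

Lemma half_pow_small (p e : R) : 0 < e -> exists N, forall n, (N <= n)%N ->
  p / 2 ^+ n < e.
Proof.
move=> e0; exists (Num.truncn (`|p| / e)).+1 => n hn.
rewrite ltr_pdivrMr ?exprn_gt0 // mulrC -ltr_pdivrMr //.
apply: (@le_lt_trans _ _ (`|p| / e)); first by rewrite ler_pM2r ?invr_gt0 // ler_norm.
apply: (@lt_trans _ _ n%:R).
  apply: lt_le_trans (truncnS_gt _) _; first by rewrite ler_nat.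
by rewrite -natrX ltr_nat ltn_expl.
Qed.

(* Quadrisection: some quarter carries a quarter of [J], and the nested quarters
   shrink to a point where the local estimate contradicts [J a b c d > 0]. *)
Lemma rect_subadditive_le0 (J : R -> R -> R -> R -> R) (a b c d : R) :
  a <= b -> c <= d ->
  (forall a' m b' c' d', a <= a' -> a' <= m -> m <= b' -> b' <= b ->
     c <= c' -> c' <= d' -> d' <= d ->
     J a' b' c' d' <= J a' m c' d' + J m b' c' d') ->
  (forall a' b' c' m d', a <= a' -> a' <= b' -> b' <= b ->
     c <= c' -> c' <= m -> m <= d' -> d' <= d ->
     J a' b' c' d' <= J a' b' c' m + J a' b' m d') ->
  (forall x y, a <= x <= b -> c <= y <= d -> forall e : R, 0 < e ->
     exists2 dl : R, 0 < dl & forall a' b' c' d',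
       a <= a' <= x -> x <= b' <= b -> c <= c' <= y -> y <= d' <= d ->
       b' - a' < dl -> d' - c' < dl ->
       J a' b' c' d' <= e * (b' - a' + (d' - c')) ^+ 2) ->
  J a b c d <= 0.
Proof.
move=> ab cd Jh Jv Jloc; rewrite leNgt; apply/negP => J0.
pose p := b - a; pose q := d - c.
have p0 : 0 <= p by rewrite subr_ge0.
have q0 : 0 <= q by rewrite subr_ge0.
pose pn n := p / 2 ^+ n; pose qn n := q / 2 ^+ n.
have pn0 n : 0 <= pn n by rewrite divr_ge0 // exprn_ge0.
have qn0 n : 0 <= qn n by rewrite divr_ge0 // exprn_ge0.
have pnS n : pn n = pn n.+1 + pn n.+1.
  rewrite /pn exprS; field; exact: expf_neq0.
have qnS n : qn n = qn n.+1 + qn n.+1.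
  rewrite /qn exprS; field; exact: expf_neq0.
pose Jn n (z : R * R) := J z.1 (z.1 + pn n) z.2 (z.2 + qn n).
pose ok n (z : R * R) := [/\ a <= z.1, z.1 + pn n <= b, c <= z.2 & z.2 + qn n <= d].
pose nxt n (z z' : R * R) := [/\ z.1 <= z'.1 /\ z'.1 + pn n.+1 <= z.1 + pn n,
  z.2 <= z'.2 /\ z'.2 + qn n.+1 <= z.2 + qn n & Jn n z <= 4 * Jn n.+1 z'].
(* The hypothesis [ok n z] sits under the existential so that choice yields a total function, which
   can be iterated without carrying proofs. *)
have step n z : exists z', ok n z -> nxt n z z'.
  have [hz|] := pselect (ok n z); last by exists z.
  case: hz => h1 h2 h3 h4.
  have := pn0 n.+1; have := qn0 n.+1 => Q0 P0.
  have e1 := pnS n; have e2 := qnS n.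
  set P := pn n.+1 in P0 e1; set Q := qn n.+1 in Q0 e2.
  have s1 : Jn n z <= J z.1 (z.1 + P) z.2 (z.2 + qn n) +
                      J (z.1 + P) (z.1 + P + P) z.2 (z.2 + qn n).
    by rewrite /Jn e1 addrA; apply: Jh; lra.
  have s2 : J z.1 (z.1 + P) z.2 (z.2 + qn n) <=
      J z.1 (z.1 + P) z.2 (z.2 + Q) + J z.1 (z.1 + P) (z.2 + Q) (z.2 + Q + Q).
    by rewrite e2 addrA; apply: Jv; lra.
  have s3 : J (z.1 + P) (z.1 + P + P) z.2 (z.2 + qn n) <=
      J (z.1 + P) (z.1 + P + P) z.2 (z.2 + Q) +
      J (z.1 + P) (z.1 + P + P) (z.2 + Q) (z.2 + Q + Q).
    by rewrite e2 addrA; apply: Jv; lra.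
  have [k1|k1] := leP (Jn n z) (4 * J z.1 (z.1 + P) z.2 (z.2 + Q)).
    by exists z => _; split; [split; rewrite -/P; lra|split; rewrite -/Q; lra|exact: k1].
  have [k2|k2] := leP (Jn n z) (4 * J z.1 (z.1 + P) (z.2 + Q) (z.2 + Q + Q)).
    by exists (z.1, z.2 + Q) => _; split; [split; rewrite -?/P /=; lra|split; rewrite -?/Q /=; lra|exact: k2].
  have [k3|k3] := leP (Jn n z) (4 * J (z.1 + P) (z.1 + P + P) z.2 (z.2 + Q)).
    by exists (z.1 + P, z.2) => _; split; [split; rewrite -?/P /=; lra|split; rewrite -?/Q /=; lra|exact: k3].
  have [k4|k4] := leP (Jn n z)
      (4 * J (z.1 + P) (z.1 + P + P) (z.2 + Q) (z.2 + Q + Q)).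
    by exists (z.1 + P, z.2 + Q) => _; split; [split; rewrite -?/P /=; lra|split; rewrite -?/Q /=; lra|exact: k4].
  (* Otherwise each quarter carries less than a quarter of [Jn n z], against subadditivity. *)
  by exfalso; lra.
pose nextc n z := sval (cid (step n z)).
pose s := fix s n := if n is m.+1 then nextc m (s m) else (a, c).
have ok_s n : ok n (s n).
  elim: n => [|n ih].
    by rewrite /ok /pn /qn /= expr0 !divr1 /p /q; split; lra.
  rewrite /= /nextc; case: cid => z' /= /(_ ih)[[? ?] [? ?] _].
  by case: ih => *; split; lra.
have nxt_s n : nxt n (s n) (s n.+1).
  by rewrite /= /nextc; case: cid => z' /= /(_ (ok_s n)).
have [X hX] := @nested_intervals (fun n => (s n).1) (fun n => (s n).1 + pn n)
  (fun n => let: And3 h _ _ := nxt_s n in proj1 h)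
  (fun n => let: And3 h _ _ := nxt_s n in proj2 h)
  (fun n => ler_wpDr (pn0 n) (lexx _)).
have [Y hY] := @nested_intervals (fun n => (s n).2) (fun n => (s n).2 + qn n)
  (fun n => let: And3 _ h _ := nxt_s n in proj1 h)
  (fun n => let: And3 _ h _ := nxt_s n in proj2 h)
  (fun n => ler_wpDr (qn0 n) (lexx _)).
have Js n : J a b c d <= 4 ^+ n * Jn n (s n).
  elim: n => [|n ih].
    by rewrite expr0 mul1r /Jn /pn /qn /= expr0 !divr1 /p /q ![_ + (_ - _)]addrC !subrK.
  apply: (le_trans ih); rewrite exprSr -mulrA ler_pM2l ?exprn_gt0 //.
  by case: (nxt_s n).
(* After [n] bisections the factor [4 ^+ n] exactly offsets the squared size and leaves
   [e * (p + q) ^+ 2], which this choice keeps below [J a b c d]; the 1 covers a degenerate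
   rectangle. *)
pose e := J a b c d / 2 / ((p + q) ^+ 2 + 1).
have D0 : 0 < (p + q) ^+ 2 + 1 by rewrite ltr_wpDl // sqr_ge0.
have e0 : 0 < e by rewrite divr_gt0 // divr_gt0.
have [hX1 hX2] : a <= X <= b /\ c <= Y <= d.
  by have := hX 0%N; have := hY 0%N; rewrite /= /pn /qn expr0 !divr1 /p /q; lra.
have [dl dl0 hdl] := Jloc X Y hX1 hX2 e e0.
have [N1 hN1] := half_pow_small p dl0.
have [N2 hN2] := half_pow_small q dl0.
pose n := maxn N1 N2.
have := Js n; apply/negP; rewrite -ltNge.
have [w1 w2 w3 w4] := ok_s n.
have /andP[x1 x2] := hX n; have /andP[y1 y2] := hY n.
have : Jn n (s n) <= e * (pn n + qn n) ^+ 2.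
  have := hdl (s n).1 ((s n).1 + pn n) (s n).2 ((s n).2 + qn n).
  rewrite ![_ + _ - _]addrC ![- _ + (_ + _)]addKr.
  apply; rewrite ?w1 ?w2 ?w3 ?w4 ?x1 ?x2 ?y1 ?y2 //.
  - by apply: hN1; rewrite leq_maxl.
  - by apply: hN2; rewrite leq_maxr.
rewrite -(ler_pM2l (exprn_gt0 n (ltr0Sn R 3))) => /le_lt_trans; apply.
have -> : 4 ^+ n * (e * (pn n + qn n) ^+ 2) = e * (p + q) ^+ 2.
  rewrite /pn /qn -mulrDl exprMn exprVn -exprM mulnC exprM.
  rewrite (_ : 2 ^+ 2 = 4 :> R); last by rewrite -natrX.
  by field; exact: expf_neq0.
rewrite /e mulrAC ltr_pdivrMr //; have := sqr_ge0 (p + q).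
set t := (p + q) ^+ 2 => t0; have : 0 <= J a b c d * t by rewrite mulr_ge0 // ltW.
lra.
Qed.
End Bisection.

Section Goursat.
Variable R : realType.
Notation mu := (@lebesgue_measure R).
Implicit Types (f : R[i] -> R[i]) (z l : R[i]) (a b c d x y : R).

(** Free of quotients, so [h = 0] needs no exclusion. It concerns the single point [z] and says
    nothing about continuity of the derivative. *)
Definition cderiv f z l : Prop :=
  forall e : R, 0 < e -> exists2 dl : R, 0 < dl & forall h : R[i],
    normc h < dl -> normc (f (z + h) - f z - l * h) <= e * normc h.

Definition holo_at f z : Prop := exists l, cderiv f z l.

Definition ccontinuous_at f z : Prop :=
  forall e : R, 0 < e -> exists2 dl : R, 0 < dl & forall h : R[i],
    normc h < dl -> normc (f (z + h) - f z) < e.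

Lemma holo_at_continuous f z : holo_at f z -> ccontinuous_at f z.
Proof.
move=> [l hl] e e0; have [dl dl0 hd] := hl 1 ltr01.
have n0 : 0 < normc l + 2 by rewrite ltr_wpDl ?normc_ge0.
exists (Num.min dl (e / (normc l + 2))); first by rewrite lt_min dl0 divr_gt0.
move=> h; rewrite lt_min => /andP[h1]; rewrite ltr_pdivlMr // => h2.
rewrite -(subrK (l * h) (f (z + h) - f z)).
apply: (le_lt_trans (normcD _ _)); rewrite normcM.
have := hd _ h1; rewrite mul1r; have := normc_ge0 h; have := normc_ge0 l.
set A := normc (_ - l * h); set H := normc h in h2 *; set L := normc l in h2 n0 *.
move=> L0 H0 AH; have := le_lt_trans _ h2; nra.
Qed.

Lemma ccont_vertical f x y : ccontinuous_at f (x +i y) ->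
  ccont (fun w => f (x +i w)) y.
Proof.
move=> hf e e0; have [dl dl0 h] := hf e e0; exists dl => // w hw.
have := h (0 +i (w - y)); rewrite normcI => /(_ hw).
by rewrite (_ : (x +i y) + _ = x +i w) //= /GRing.add /= addr0 addrC subrK.
Qed.

Lemma ccont_horizontal f x y : ccontinuous_at f (x +i y) ->
  ccont (fun u => f (u +i y)) x.
Proof.
move=> hf e e0; have [dl dl0 h] := hf e e0; exists dl => // w hw.
have := h ((w - x) +i 0); rewrite normcR => /(_ hw).
by rewrite (_ : (x +i y) + _ = w +i y) //= /GRing.add /= addr0 addrC subrK.
Qed.

Lemma ccontB (f g : R -> R[i]) x : ccont f x -> ccont g x ->
  ccont (fun u => f u - g u) x.
Proof.
move=> hf hg e e0; have e20 : 0 < e / 2 by rewrite divr_gt0.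
have [d1 d10 h1] := hf _ e20; have [d2 d20 h2] := hg _ e20.
exists (Num.min d1 d2); first by rewrite lt_min d10.
move=> u; rewrite lt_min => /andP[/h1 k1 /h2 k2].
rewrite (_ : _ - _ = (f u - f x) - (g u - g x)); last by ring.
apply: (le_lt_trans (normcB_le _ _)); lra.
Qed.

Lemma ccontM (f g : R -> R[i]) x : ccont f x -> ccont g x ->
  ccont (fun u => f u * g u) x.
Proof.
move=> hf hg e e0.
set M := normc (f x) + normc (g x) + 1.
have M0 : 0 < M by rewrite ltr_wpDl ?addr_ge0 ?normc_ge0.
pose e' := Num.min 1 (e / (2 * M)).
have e'0 : 0 < e' by rewrite lt_min ltr01 divr_gt0 ?mulr_gt0.
have [d1 d10 h1] := hf _ e'0; have [d2 d20 h2] := hg _ e'0.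
exists (Num.min d1 d2); first by rewrite lt_min d10.
move=> u; rewrite lt_min => /andP[/h1 k1 /h2 k2].
rewrite (_ : _ - _ = (f u - f x) * (g u - g x) + f x * (g u - g x)
  + (f u - f x) * g x); last by ring.
apply: (le_lt_trans (normcD _ _)).
apply: (@le_lt_trans _ _ (e' * e' + normc (f x) * e' + e' * normc (g x))).
  apply: lerD; last by rewrite normcM ler_wpM2r ?normc_ge0 // ltW.
  apply: (le_trans (normcD _ _)); apply: lerD; rewrite normcM.
    by apply: ler_pM; rewrite ?normc_ge0 ?ltW.
  by rewrite ler_wpM2l ?normc_ge0 // ltW.
have e1 : e' <= 1 by rewrite ge_min lexx.
have : e' * (2 * M) <= e.
  by rewrite -ler_pdivlMr ?mulr_gt0 // ge_min lexx orbT.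
have := normc_ge0 (f x); have := normc_ge0 (g x); rewrite /M; nra.
Qed.

Lemma ccont_cst (k : R[i]) x : ccont (fun=> k) x.
Proof.
by move=> e e0; exists 1 => // u _; rewrite subrr ComplexField.Normc.normc0.
Qed.

Lemma fine_measure_segment a b : a <= b -> fine (mu `[a, b]) = b - a.
Proof.
move=> ab; rewrite lebesgue_measure_itv /= lte_fin.
case: ltP => //= ba; apply/esym/eqP; rewrite subr_eq0; apply/eqP.
by apply: le_anti; rewrite ab ba.
Qed.

Lemma cint_cst a b (k : R[i]) : a <= b ->
  cint `[a, b] (fun=> k) = k * ((b - a) +i 0).
Proof.
move=> ab; case: k => p q; rewrite /cint /= !Rintegral_cst //.
by rewrite !fine_measure_segment // /GRing.mul /= !mulr0 subr0 add0r.
Qed.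

Lemma normc_cint_bound a b (g : R -> R[i]) (M : R) : a <= b ->
  (forall x, a <= x <= b -> ccont g x) ->
  (forall x, a <= x <= b -> normc (g x) <= M) ->
  normc (cint `[a, b] g) <= 2 * (M * (b - a)).
Proof.
move=> ab cg gM; have ig := ccont_integrable cg.
apply: (le_trans (normc_cint_le _ ig)) => //; rewrite ler_pM2l //.
have ic : mu.-integrable `[a, b] (EFin \o (fun=> M)).
  by apply: continuous_compact_integrable;
    [exact: segment_compact|move=> x; exact: cvg_cst].
apply: (@le_trans _ _ (\int[mu]_(x in `[a, b]) M)).
  by apply: le_Rintegral => //; exact: cintegrable_normc ig.
by rewrite Rintegral_cst // fine_measure_segment.
Qed.

(* The boundary integral, with opposite sides paired so that affine
   integrands visibly contribute nothing. *)
Definition rint f a b c d : R[i] :=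
  cint `[a, b] (fun u => f (u +i c) - f (u +i d))
  + 'i%C * cint `[c, d] (fun w => f (b +i w) - f (a +i w)).

Definition rect_cont f a b c d : Prop :=
  forall x y, a <= x <= b -> c <= y <= d -> ccontinuous_at f (x +i y).

Lemma rect_cont_sub f a b c d a' b' c' d' :
  a <= a' -> b' <= b -> c <= c' -> d' <= d ->
  rect_cont f a b c d -> rect_cont f a' b' c' d'.
Proof.
move=> aa bb cc dd h x y /andP[x1 x2] /andP[y1 y2]; apply: h; apply/andP; split.
- exact: le_trans x1.
- exact: le_trans bb.
- exact: le_trans y1.
- exact: le_trans dd.
Qed.

Lemma rint_horizontal_ccont f a b c d : c <= d -> rect_cont f a b c d ->
  forall x, a <= x <= b -> ccont (fun u => f (u +i c) - f (u +i d)) x.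
Proof.
by move=> cd h x hx; apply: ccontB; apply: ccont_horizontal; apply: h;
  rewrite // lexx ?cd.
Qed.

Lemma rint_vertical_ccont f a b c d : a <= b -> rect_cont f a b c d ->
  forall y, c <= y <= d -> ccont (fun w => f (b +i w) - f (a +i w)) y.
Proof.
by move=> ab h y hy; apply: ccontB; apply: ccont_vertical; apply: h;
  rewrite // lexx ?ab.
Qed.

Lemma rint_splith f a m b c d : a <= m -> m <= b -> c <= d ->
  rect_cont f a b c d -> rint f a b c d = rint f a m c d + rint f m b c d.
Proof.
move=> am mb cd h; rewrite /rint.
rewrite (@cint_split _ a m b); last 2 first.
- by rewrite am mb.
- exact/ccont_integrable/rint_horizontal_ccont.
have h1 := rect_cont_sub (lexx a) mb (lexx c) (lexx d) h.
have h2 := rect_cont_sub am (lexx b) (lexx c) (lexx d) h.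
have i1 := ccont_integrable (rint_vertical_ccont am h1).
have i2 := ccont_integrable (rint_vertical_ccont mb h2).
rewrite [X in _ + 'i%C * X](@eq_cint _ _ _ (fun w => (f (m +i w) - f (a +i w)) +
  (f (b +i w) - f (m +i w)))); last by move=> w _ /=; ring.
by rewrite [X in _ + 'i%C * X]cintD //; ring.
Qed.

Lemma rint_splitv f a b c m d : a <= b -> c <= m -> m <= d ->
  rect_cont f a b c d -> rint f a b c d = rint f a b c m + rint f a b m d.
Proof.
move=> ab cm md h; rewrite /rint.
rewrite [X in _ + _ * X](@cint_split _ c m d); last 2 first.
- by rewrite cm md.
- exact/ccont_integrable/rint_vertical_ccont.
have h1 := rect_cont_sub (lexx a) (lexx b) (lexx c) md h.
have h2 := rect_cont_sub (lexx a) (lexx b) cm (lexx d) h.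
have i1 := ccont_integrable (rint_horizontal_ccont cm h1).
have i2 := ccont_integrable (rint_horizontal_ccont md h2).
rewrite [X in X + _](@eq_cint _ _ _ (fun u => (f (u +i c) - f (u +i m)) +
  (f (u +i m) - f (u +i d)))); last by move=> w _ /=; ring.
by rewrite [X in X + _]cintD //; ring.
Qed.

(** One factor 2 comes from pairing opposite sides, the other from [normc_cint_le]. *)
Lemma normc_rint_bound f a b c d (M : R) : a <= b -> c <= d ->
  rect_cont f a b c d ->
  (forall x y, a <= x <= b -> c <= y <= d -> normc (f (x +i y)) <= M) ->
  normc (rint f a b c d) <= 4 * M * (b - a + (d - c)).
Proof.
move=> ab cd h hM.
have k (z w : R[i]) : normc z <= M -> normc w <= M -> normc (z - w) <= 2 * M.
  by move=> ? ?; apply: (le_trans (normcB_le _ _)); lra.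
have b1 : normc (cint `[a, b] (fun u => f (u +i c) - f (u +i d))) <=
    2 * ((2 * M) * (b - a)).
  apply: normc_cint_bound => //; first exact: rint_horizontal_ccont.
  by move=> x hx; apply: k; apply: hM; rewrite // lexx ?cd.
have b2 : normc (cint `[c, d] (fun w => f (b +i w) - f (a +i w))) <=
    2 * ((2 * M) * (d - c)).
  apply: normc_cint_bound => //; first exact: rint_vertical_ccont.
  by move=> x hx; apply: k; apply: hM; rewrite // lexx ?ab.
apply: (le_trans (normcD _ _)); rewrite normcM normcI normr1 mul1r; lra.
Qed.

Lemma ccontinuous_atD f (g : R[i] -> R[i]) z : ccontinuous_at f z ->
  ccontinuous_at g z -> ccontinuous_at (fun w => f w + g w) z.
Proof.
move=> hf hg e e0; have e20 : 0 < e / 2 by rewrite divr_gt0.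
have [d1 d10 h1] := hf _ e20; have [d2 d20 h2] := hg _ e20.
exists (Num.min d1 d2); first by rewrite lt_min d10.
move=> u; rewrite lt_min => /andP[/h1 k1 /h2 k2].
rewrite (_ : _ - _ = (f (z + u) - f z) + (g (z + u) - g z)); last by ring.
apply: (le_lt_trans (normcD _ _)); lra.
Qed.

Lemma ccontinuous_at_affine (k l z : R[i]) : ccontinuous_at (fun w => k + l * w) z.
Proof.
apply: holo_at_continuous; exists l => e e0; exists 1 => // h _.
rewrite (_ : _ - _ = 0); last by ring.
by rewrite ComplexField.Normc.normc0 mulr_ge0 ?normc_ge0 // ltW.
Qed.

(** Constants cancel between opposite sides. The slope leaves l i (c - d) (b - a) from the
    horizontal pair and i l (b - a) (d - c) from the vertical one, which cancel each other. This is
    what allows the tangent map to be subtracted in Goursat's argument. *)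
Lemma rint_add_affine f (k l : R[i]) a b c d : a <= b -> c <= d ->
  rect_cont f a b c d ->
  rint (fun z => f z + (k + l * z)) a b c d = rint f a b c d.
Proof.
move=> ab cd h; rewrite /rint.
have i1 := ccont_integrable (rint_horizontal_ccont cd h).
have i2 := ccont_integrable (rint_vertical_ccont ab h).
rewrite [X in X + _](@eq_cint _ _ _ (fun u => (f (u +i c) - f (u +i d)) +
  l * (0 +i (c - d)))); last first.
  move=> u _; rewrite (_ : 0 +i (c - d) = (u +i c) - (u +i d)); first by ring.
  by rewrite /GRing.add /= subrr.
rewrite [X in _ + 'i%C * X](@eq_cint _ _ _ (fun w => (f (b +i w) - f (a +i w)) +
  l * ((b - a) +i 0))); last first.
  move=> u _; rewrite (_ : (b - a) +i 0 = (b +i u) - (a +i u)); first by ring.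
  by rewrite /GRing.add /= subrr.
have ic (p q : R) (z : R[i]) : cintegrable `[p, q] (fun=> z).
  by apply: ccont_integrable => x _; exact: ccont_cst.
rewrite [X in X + _ = _]cintD // [X in _ + 'i%C * X = _]cintD //.
rewrite !cint_cst //.
have -> : 0 +i (c - d) = - ('i%C * ((d - c) +i 0)).
  by rewrite /GRing.mul /GRing.opp /= !mul0r mulr0 mul1r subrr oppr0 add0r opprB.
ring.
Qed.

(** The modulus of the boundary integral is subadditive under cuts. Near a point of
    differentiability it is quadratically small: subtracting the tangent map leaves an integrand of
    size e times the diameter, on a boundary whose length is of the order of the diameter. *)
Theorem Goursat f a b c d : a <= b -> c <= d ->
  (forall x y, a <= x <= b -> c <= y <= d -> holo_at f (x +i y)) ->
  rint f a b c d = 0.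
Proof.
move=> ab cd hf.
have hc : rect_cont f a b c d.
  by move=> x y hx hy; apply: holo_at_continuous; exact: hf.
apply/eqP; rewrite -normc_eq0 eq_le normc_ge0 andbT.
apply: (rect_subadditive_le0 (J := fun a b c d => normc (rint f a b c d)) ab cd).
- move=> a' m b' c' d' h1 h2 h3 h4 h5 h6 h7.
  rewrite (rint_splith h2 h3 h6); first exact: normcD.
  exact: rect_cont_sub hc.
- move=> a' b' c' m d' h1 h2 h3 h4 h5 h6 h7.
  rewrite (rint_splitv h2 h5 h6); first exact: normcD.
  exact: rect_cont_sub hc.
move=> x y hx hy e e0; have [l hl] := hf x y hx hy.
(* The quarter compensates the 4 of [normc_rint_bound]. Halving [dl] below keeps the sum of the two
   sides, which bounds the increment, under [dl]. *)
have e40 : 0 < e / 4 by rewrite divr_gt0.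
have [dl dl0 hdl] := hl _ e40; exists (dl / 2); first by rewrite divr_gt0.
move=> a' b' c' d' /andP[a1 a2] /andP[b1 b2] /andP[c1 c2] /andP[d1 d2] sx sy.
have ab' : a' <= b' by lra.
have cd' : c' <= d' by lra.
set k := f (x +i y) - l * (x +i y).
pose g z := f z + (- k + (- l) * z).
have hc' : rect_cont f a' b' c' d' by apply: rect_cont_sub hc.
have hg : rect_cont g a' b' c' d'.
  move=> u v hu hv; apply: ccontinuous_atD; first exact: hc'.
  exact: ccontinuous_at_affine.
rewrite -(rint_add_affine (- k) (- l) ab' cd' hc').
set s := b' - a' + (d' - c').
apply: (@le_trans _ _ (4 * (e / 4 * s) * s)); last first.
  by rewrite le_eqVlt; apply/orP; left; apply/eqP; field.
apply: normc_rint_bound => // u v /andP[u1 u2] /andP[v1 v2].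
pose h := (u - x) +i (v - y).
have hs : normc h <= s.
  apply: (le_trans (normc_le_Re_Im _)); rewrite /= /s; apply: lerD.
  - by rewrite ler_norml; apply/andP; split; lra.
  - by rewrite ler_norml; apply/andP; split; lra.
have hd : normc h < dl by apply: (le_lt_trans hs); rewrite /s; lra.
have eh : u +i v = (x +i y) + h.
  by rewrite /h /GRing.add /= [x + _]addrC [y + _]addrC !subrK.
rewrite eh (_ : _ + _ = f ((x +i y) + h) - f (x +i y) - l * h); last first.
  by rewrite /k; ring.
apply: (le_trans (hdl _ hd)); rewrite ler_pM2l //.
Qed.
End Goursat.

(** * Derivative rules, removable singularities and primitives *)

Section ComplexDerivative.
Variable R : realType.
Implicit Types (f g : R[i] -> R[i]) (z l : R[i]) (a b c d x y : R).

Lemma cderivM f g z l k : cderiv f z l -> cderiv g z k ->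
  cderiv (fun w => f w * g w) z (l * g z + f z * k).
Proof.
move=> hf hg e e0.
set M := normc (f z) + normc (g z) + normc l + normc k + 1.
have M0 : 0 < M by rewrite ltr_wpDl ?addr_ge0 ?normc_ge0.
pose e' := Num.min 1 (e / (8 * M)).
have e'0 : 0 < e' by rewrite lt_min ltr01 divr_gt0 ?mulr_gt0.
have [d1 d10 h1] := hf _ e'0; have [d2 d20 h2] := hg _ e'0.
have [d3 d30 h3] := holo_at_continuous (ex_intro _ k hg) e'0.
exists (Num.min d1 (Num.min d2 d3)); first by rewrite !lt_min d10 d20.
move=> h; rewrite !lt_min => /and3P[/h1 k1 /h2 k2 /h3 k3].
rewrite (_ : _ - _ - _ = (f (z + h) - f z - l * h) * g z
   + (f (z + h) - f z - l * h) * (g (z + h) - g z)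
   + l * h * (g (z + h) - g z) + f z * (g (z + h) - g z - k * h)); last by ring.
have n1 := normc_ge0 (f z); have n2 := normc_ge0 (g z).
have n3 := normc_ge0 l; have n4 := normc_ge0 k; have n5 := normc_ge0 h.
have e1 : e' <= 1 by rewrite ge_min lexx.
have e2 : e' * (8 * M) <= e.
  by rewrite -ler_pdivlMr ?mulr_gt0 // ge_min lexx orbT.
apply: (@le_trans _ _ (e' * normc h * normc (g z) + e' * normc h * 1
  + normc l * normc h * e' + normc (f z) * (e' * normc h))).
  apply: (le_trans (normcD _ _)); apply: lerD; last first.
    by rewrite normcM ler_wpM2l.
  apply: (le_trans (normcD _ _)); apply: lerD; last first.
    by rewrite !normcM ler_wpM2l ?mulr_ge0 // ltW.
  apply: (le_trans (normcD _ _)); apply: lerD; rewrite normcM.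
    by rewrite ler_wpM2r.
  by apply: ler_pM; rewrite ?normc_ge0 ?(le_trans (ltW k3)).
have -> : e' * normc h * normc (g z) + e' * normc h * 1
  + normc l * normc h * e' + normc (f z) * (e' * normc h) =
  (e' * (normc (g z) + 1 + normc l + normc (f z))) * normc h by ring.
rewrite ler_wpM2r //; apply: le_trans e2; rewrite ler_pM2l // /M; lra.
Qed.

Lemma cderivD f g z l k : cderiv f z l -> cderiv g z k ->
  cderiv (fun w => f w + g w) z (l + k).
Proof.
move=> hf hg e e0; have e20 : 0 < e / 2 by rewrite divr_gt0.
have [d1 d10 h1] := hf _ e20; have [d2 d20 h2] := hg _ e20.
exists (Num.min d1 d2); first by rewrite lt_min d10.
move=> h; rewrite lt_min => /andP[/h1 k1 /h2 k2].
rewrite (_ : _ - _ - _ = (f (z + h) - f z - l * h) + (g (z + h) - g z - k * h)).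
  apply: (le_trans (normcD _ _)); lra.
by ring.
Qed.

Lemma cderiv_cst k z : cderiv (fun=> k) z 0.
Proof.
move=> e e0; exists 1 => // h _; rewrite subrr mul0r subrr.
by rewrite ComplexField.Normc.normc0 mulr_ge0 ?normc_ge0 // ltW.
Qed.

Lemma cderiv_invB p z : z != p ->
  cderiv (fun w => (w - p)^-1) z (- (z - p)^-1 ^+ 2).
Proof.
rewrite -subr_eq0 => zp e e0; set a := z - p in zp *.
have na : 0 < normc a by rewrite normc_gt0.
exists (Num.min (normc a / 2) (e * normc a ^+ 3 / 2)).
  by rewrite lt_min !divr_gt0 ?mulr_gt0 ?exprn_gt0.
move=> h; rewrite lt_min => /andP[h1 h2].
have nah : normc a / 2 <= normc (a + h).
  have := normc_lerB a (- h); rewrite normcN opprK; lra.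
have ah0 : a + h != 0.
  by rewrite -normc_gt0; apply: lt_le_trans nah; rewrite divr_gt0.
rewrite (_ : z + h - p = a + h); last by rewrite /a; ring.
rewrite (_ : _ - _ - _ = h ^+ 2 / (a ^+ 2 * (a + h))); last first.
  by field; rewrite ah0.
rewrite normcM normcV !normcM.
rewrite ler_pdivrMr ?mulr_gt0 ?normc_gt0 //.
set H := normc h in h1 h2 *; set A := normc a in na h1 h2 nah *.
set B := normc (a + h) in nah *.
have H0 : 0 <= H by exact: normc_ge0.
have : H <= e * (A * A * B).
  apply: (le_trans (ltW h2)); rewrite (_ : e * A ^+ 3 / 2 = e * (A * A * (A / 2))).
    by rewrite ler_pM2l // ler_pM2l ?mulr_gt0.
  by field.
by move=> k; rewrite [e * H]mulrC -[leRHS]mulrA; exact: ler_wpM2l.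
Qed.

(** Four cuts isolate a small square around [p]. The other pieces vanish by [Goursat], and the
    square contributes at most a multiple of its side since [f] is bounded near [p] by
    continuity. *)
Lemma rint_removable f p a b c d : a < Re p < b -> c < Im p < d ->
  rect_cont f a b c d ->
  (forall x y, a <= x <= b -> c <= y <= d -> x +i y != p -> holo_at f (x +i y)) ->
  rint f a b c d = 0.
Proof.
case: p => p q /= /andP[ap pb] /andP[cq qd] hc hh.
have hp : ccontinuous_at f (p +i q) by apply: hc; rewrite !ltW.
have [dl dl0 hdl] := hp 1 ltr01.
have [M M0 hM] : exists2 M, 0 < M & M = normc (f (p +i q)) + 1.
  by exists (normc (f (p +i q)) + 1); rewrite // ltr_wpDl ?normc_ge0.
apply/eqP; rewrite -normc_eq0 eq_le normc_ge0 andbT leNgt; apply/negP => r0.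
set r := normc _ in r0.
(* [dl / 4] keeps the square inside the disc where |f| <= M; [r / (32 * M)] makes the bound 16 M e
   of its boundary integral at most r / 2; the remaining constraints keep the square inside the
   rectangle. *)
have [e e0 [e1 e2 e3 e4 [e5 e6]]] : exists2 e, 0 < e &
    [/\ e <= dl / 4, e <= r / (32 * M), e <= p - a, e <= b - p &
    e <= q - c /\ e <= d - q].
  exists (Num.min (dl / 4) (Num.min (r / (32 * M))
    (Num.min (Num.min (p - a) (b - p)) (Num.min (q - c) (d - q))))).
    by rewrite !lt_min !divr_gt0 ?mulr_gt0 //= !subr_gt0 ap pb cq qd.
  by split; [..|split]; rewrite !ge_min lexx ?orbT.
have gz a' b' c' d' : a <= a' -> a' <= b' -> b' <= b -> c <= c' -> c' <= d' ->
    d' <= d -> [|| b' < p, p < a', d' < q | q < c'] -> rint f a' b' c' d' = 0.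
  move=> h1 h2 h3 h4 h5 h6 out; apply: Goursat => // x y /andP[x1 x2] /andP[y1 y2].
  apply: hh; [lra|lra|].
  apply/eqP => -[xp yq]; move: out; rewrite -xp -yq.
  by case/or4P; rewrite ltNge ?x1 ?x2 ?y1 ?y2.
have sub a' b' c' d' : a <= a' -> b' <= b -> c <= c' -> d' <= d ->
    rect_cont f a' b' c' d' by move=> *; apply: rect_cont_sub hc.
have : r <= 4 * M * (4 * e).
  rewrite /r (@rint_splith _ f a (p - e) b c d); try (by lra); last exact: hc.
  rewrite (gz a (p - e)); try lra.
  rewrite add0r (@rint_splith _ f (p - e) (p + e) b c d); try (by lra);
    last by apply: sub; lra.
  rewrite (gz (p + e) b); try lra.
  rewrite addr0 (@rint_splitv _ f (p - e) (p + e) c (q - e) d); try (by lra);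
    last by apply: sub; lra.
  rewrite (gz _ _ c); try lra.
  rewrite add0r (@rint_splitv _ f (p - e) (p + e) (q - e) (q + e) d); try (by lra);
    last by apply: sub; lra.
  rewrite (gz _ _ _ d); try lra.
  rewrite addr0 (_ : 4 * e = p + e - (p - e) + (q + e - (q - e))); last by ring.
  apply: normc_rint_bound; [lra|lra|by apply: sub; lra|].
  move=> x y /andP[x1 x2] /andP[y1 y2].
  pose h := (x - p) +i (y - q).
  have -> : x +i y = (p +i q) + h.
    by rewrite /h /GRing.add /= [p + _]addrC [q + _]addrC !subrK.
  have hs : normc h < dl.
    apply: (le_lt_trans (normc_le_Re_Im _)) => /=.
    have : `|x - p| <= e by rewrite ler_norml; apply/andP; split; lra.
    have : `|y - q| <= e by rewrite ler_norml; apply/andP; split; lra.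
    lra.
  rewrite -(subrK (f (p +i q)) (f _)) addrC; apply: (le_trans (normcD _ _)).
  by rewrite hM lerD2l ltW // hdl.
have : e * (32 * M) <= r by rewrite -ler_pdivlMr ?mulr_gt0.
lra.
Qed.

Definition rderiv (G : R -> R[i]) x l : Prop :=
  forall e : R, 0 < e -> exists2 dl : R, 0 < dl & forall h : R,
    `|h| < dl -> normc (G (x + h) - G x - l * (h +i 0)) <= e * `|h|.

Lemma rderiv_ccont (G : R -> R[i]) x l : rderiv G x l -> ccont G x.
Proof.
move=> hG e e0; have [dl dl0 hd] := hG 1 ltr01.
have n0 : 0 < normc l + 2 by rewrite ltr_wpDl ?normc_ge0.
exists (Num.min dl (e / (normc l + 2))); first by rewrite lt_min dl0 divr_gt0.
move=> v; rewrite lt_min => /andP[h1]; rewrite ltr_pdivlMr // => h2.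
have := hd _ h1; rewrite mul1r [x + _]addrC subrK => h3.
rewrite -(subrK (l * ((v - x) +i 0)) (G v - G x)).
apply: (le_lt_trans (normcD _ _)); rewrite normcM normcR.
have := normr_ge0 (v - x); have := normc_ge0 l; nra.
Qed.

Lemma cderiv_horizontal f x y l : cderiv f (x +i y) l ->
  rderiv (fun u => f (u +i y)) x l.
Proof.
move=> hf e e0; have [dl dl0 hd] := hf e e0; exists dl => // h hh.
have := hd (h +i 0); rewrite normcR => /(_ hh).
by rewrite (_ : (x +i y) + _ = (x + h) +i y) // /GRing.add /= addr0.
Qed.

(** A function of a real variable is extended to the plane by an affine term in the imaginary
    direction. The extension is complex differentiable at 0 with the same derivative, so [cderivM]
    yields the product rule. *)
Lemma rderivM (F G : R -> R[i]) x l k : rderiv F x l -> rderiv G x k ->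
  rderiv (fun u => F u * G u) x (l * G x + F x * k).
Proof.
have ext (K : R -> R[i]) m : rderiv K x m ->
    cderiv (fun w => K (x + Re w) + m * (0 +i Im w)) 0 m.
  move=> hK e e0; have [dl dl0 hd] := hK e e0; exists dl => // h hh.
  have hR := Re_le_normc h.
  rewrite add0r (_ : Re 0 = 0) // (_ : Im 0 = 0) // addr0.
  rewrite (_ : 0 +i 0 = 0) // mulr0 addr0.
  rewrite (_ : _ - _ - _ = K (x + Re h) - K x - m * (Re h +i 0)); last first.
    rewrite (_ : m * h = m * (0 +i Im h) + m * (Re h +i 0)); first by ring.
    by rewrite -mulrDr; congr (_ * _); case: (h) => ? ?;
       rewrite /GRing.add /= add0r addr0.
  apply: (le_trans (hd _ (le_lt_trans hR hh))).
  by rewrite ler_pM2l.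
move=> /ext hF /ext hG e e0; have [dl dl0 hd] := cderivM hF hG e0.
exists dl => // h hh; have := hd (h +i 0); rewrite normcR => /(_ hh).
have r0 : Re (0 : R[i]) = 0 by []; have i0 : Im (0 : R[i]) = 0 by [].
have c0 : 0 +i 0 = 0 :> R[i] by [].
by rewrite add0r r0 i0 /= c0 !mulr0 !addr0.
Qed.

Let ReBM (p q l : R[i]) (h : R) :
  Re (p - q - l * (h +i 0)) = Re p - Re q - Re l * h.
Proof. by case: p q l => ? ? [? ?] [? ?] /=; ring. Qed.

Lemma rderiv_Re (G : R -> R[i]) x l : rderiv G x l ->
  is_derive x 1 (fun u => Re (G u)) (Re l).
Proof.
move=> hG.
have cv : (fun h => h^-1 *: (Re (G (h *: (1 : R) + x)) - Re (G x))) @ 0^' --> Re l.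
  apply/cvgrPdist_le => e e0; have [dl dl0 hd] := hG e e0.
  near=> h.
  have h0 : h != 0 by near: h; exact: nbhs_dnbhs_neq.
  have hh : `|h| < dl.
    by near: h; apply: dnbhs0_lt.
  have := hd _ hh; rewrite -[e * _]divr1 => /(le_trans (Re_le_normc _)).
  rewrite divr1 -ler_pdivrMr ?normr_gt0 // -normfV -normrM => k.
  rewrite distrC (le_trans _ k) // le_eqVlt; apply/orP; left; apply/eqP.
  congr (`|_|); rewrite [h *: _]mulr1 [h + x]addrC /GRing.scale /= ReBM.
  by field.
by apply: DeriveDef; [exact: cvgP cv|exact: cvg_lim cv].
Unshelve. all: by end_near. Qed.

Lemma rderiv_Im (G : R -> R[i]) x l : rderiv G x l ->
  is_derive x 1 (fun u => Im (G u)) (Im l).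
Proof.
(* Multiplication by -i turns the imaginary part into a real part. *)
move=> hG; have hI : rderiv (fun u => - 'i%C * G u) x (- 'i%C * l).
  move=> e e0; have [dl dl0 hd] := hG e e0; exists dl => // h /hd.
  rewrite (_ : - 'i%C * _ - _ - _ = - 'i%C * (G (x + h) - G x - l * (h +i 0))).
    by rewrite normcM normcN normcI normr1 mul1r.
  by ring.
have := rderiv_Re hI; rewrite (_ : Re (- 'i%C * l) = Im l); last first.
  by case: l {hG hI} => ? ? /=; ring.
congr is_derive; apply/funext => u; case: (G u) => ? ? /=; ring.
Qed.

Lemma Rintegral_FTC (U u : R -> R) a b : a < b ->
  {within `[a, b], continuous u} ->
  (forall x, a <= x <= b -> is_derive x 1 U (u x)) ->
  \int[lebesgue_measure]_(x in `[a, b]) u x = U b - U a.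
Proof.
move=> ab cu hU; rewrite /Rintegral (@continuous_FTC2 R u U a b) //.
- have cU x : a <= x <= b -> {for x, continuous U}.
    by move=> /hU[dU _]; apply: differentiable_continuous; exact/derivable1_diffP.
  split.
  + by move=> x; rewrite in_itv /= => /andP[? ?]; case: (hU x) => //; rewrite !ltW.
  + by apply: cvg_at_right_filter; apply: cU; rewrite lexx ltW.
  + by apply: cvg_at_left_filter; apply: cU; rewrite lexx ltW.
- move=> x; rewrite in_itv /= => /andP[? ?]; rewrite derive1E.
  by apply: derive_val; apply: hU; rewrite !ltW.
Qed.

Lemma cint_FTC (G g : R -> R[i]) a b : a < b ->
  (forall x, a <= x <= b -> rderiv G x (g x)) ->
  (forall x, a <= x <= b -> ccont g x) ->
  cint `[a, b] g = G b - G a.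
Proof.
move=> ab hG hg; have [cr ci] := ccont_within hg.
rewrite /cint (Rintegral_FTC ab cr (fun x hx => rderiv_Re (hG x hx))).
rewrite (Rintegral_FTC ab ci (fun x hx => rderiv_Im (hG x hx))).
by case: (G b) (G a) => ? ? [].
Qed.

(** The inequality [a < x] is strict because the derivative is two-sided: small negative increments
    must stay to the right of [a], where [g] is continuous. *)
Lemma rderiv_primitive (g : R -> R[i]) a x : a < x ->
  (forall u, a <= u -> ccont g u) ->
  rderiv (fun u => cint `[a, u] g) x (g x).
Proof.
move=> ax hg e e0; have e20 : 0 < e / 2 by rewrite divr_gt0.
have [dl dl0 hd] := hg x (ltW ax) _ e20.
exists (Num.min dl (x - a)); first by rewrite lt_min dl0 subr_gt0.
have ig p q : a <= p -> cintegrable `[p, q] g.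
  move=> ap; apply: ccont_integrable => u /andP[pu _]; apply: hg.
  exact: le_trans pu.
have ic p q (k : R[i]) : cintegrable `[p, q] (fun=> k).
  by apply: ccont_integrable => ? _; exact: ccont_cst.
have bnd p q : a <= p -> p <= q -> x - dl < p -> q < x + dl ->
    normc (cint `[p, q] g - g x * ((q - p) +i 0)) <= e * (q - p).
  move=> ap pq pd qd; rewrite -cint_cst // -cintB //; last exact: ig.
  apply: le_trans (normc_cint_bound (M := e / 2) pq _ _) _.
  - move=> u /andP[pu _]; apply: ccontB; last exact: ccont_cst.
    by apply: hg; exact: le_trans pu.
  - move=> u /andP[pu uq]; apply/ltW/hd; rewrite ltr_norml; apply/andP; split; lra.
  - lra.
move=> h; rewrite lt_min => /andP[h1 h2].
have [h0|h0] := lerP 0 h.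
- rewrite ger0_norm // in h1 h2 *.
  rewrite (@cint_split _ a x (x + h)); last 2 first.
  + by rewrite ltW //= lerDl.
  + exact: ig.
  rewrite [_ + cint _ _]addrC addrK.
  have := bnd x (x + h); rewrite [x + h - x]addrC addKr.
  by apply; lra.
- rewrite ltr0_norm // in h1 h2 *.
  rewrite (@cint_split _ a (x + h) x); last 2 first.
  + by apply/andP; split; lra.
  + exact: ig.
  rewrite opprD addNKr -normcN opprB opprK addrC.
  have := bnd (x + h) x; rewrite (_ : x - (x + h) = - h); last by ring.
  rewrite (_ : g x * (h +i 0) = - (g x * ((- h) +i 0))); last first.
    by rewrite -mulrN /GRing.opp /= oppr0 opprK.
  by apply; lra.
Qed.
End ComplexDerivative.

(** * Cauchy's formula on vertical lines and on the imaginary axis *)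

Section HalfPlaneKernel.
Variable R : realType.
Notation mu := (@lebesgue_measure R).
Implicit Types (A Y m : R).

Lemma kernel_continuous A m (w : R) : A != 0 -> ccont (fun w => (A +i (w - m))^-1) w.
Proof.
move=> A0; have h : holo_at (fun z : R[i] => (z - (0 +i m))^-1) (A +i w).
  eexists; apply: cderiv_invB; apply/eqP => -[A0']; by rewrite A0' eqxx in A0.
have := ccont_vertical (holo_at_continuous h) => hc.
move=> e e0; have [d d0 hd] := hc e e0; exists d => // v hv.
by have := hd v hv; rewrite /GRing.add /= !subr0.
Qed.

(** The real part has primitive atan((w - m) / A). The imaginary part has primitive - ln(A^2 + (w -
    m)^2) / 2, which is even about [m] and cancels on the symmetric window. As [Y] grows the value
    tends to pi or - pi with the sign of [A]: this is the origin of the 2 pi in Cauchy's formula. *)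
Lemma cint_kernel A m Y : A != 0 -> 0 < Y ->
  cint `[m - Y, m + Y] (fun w => (A +i (w - m))^-1) = (2 * atan (Y / A)) +i 0.
Proof.
move=> A0 Y0; have ab : m - Y < m + Y by lra.
have A20 : 0 < A ^+ 2 by rewrite exprn_even_gt0.
have den (w : R) : 0 < A ^+ 2 + w ^+ 2 by rewrite ltr_wpDr // sqr_ge0.
have den0 w := lt0r_neq0 (den w).
have hc x : m - Y <= x <= m + Y -> ccont (fun w => (A +i (w - m))^-1) x.
  by move=> _; exact: kernel_continuous.
have [cr ci] := ccont_within hc.
have D1 x : m - Y <= x <= m + Y ->
    is_derive x 1 (fun w => atan ((w - m) / A)) (Re (A +i (x - m))^-1).
  move=> _; have h1 : is_derive x 1 (fun w => (w - m) / A) (A^-1).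
    have h := is_deriveZ A^-1 (is_deriveB (is_derive_id x 1) (is_derive_cst m x 1)).
    rewrite (_ : (fun w => _) = A^-1 \*: (id - cst m)).
      by apply: is_derive_eq h _; rewrite /GRing.scale /= subr0 mulr1.
    by apply/funext => w; rewrite /GRing.scale /= mulrC.
  have h2 := @is_derive1_comp R atan (fun w => (w - m) / A) x _ _
    (is_derive1_atan _) h1.
  apply: is_derive_eq h2 _ => /=.
  have := den0 (x - m).
  have -> : 1 + ((x - m) / A) ^+ 2 = (A ^+ 2 + (x - m) ^+ 2) / A ^+ 2 by field.
  by set D := A ^+ 2 + _ => dn; field; rewrite A0 dn.
have D2 x : m - Y <= x <= m + Y ->
    is_derive x 1 (fun w => - (ln (A ^+ 2 + (w - m) ^+ 2) / 2))
      (Im (A +i (x - m))^-1).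
  move=> _; have h1 : is_derive x 1 (fun w => A ^+ 2 + (w - m) ^+ 2) (2 * (x - m)).
    by apply: is_derive_eq; rewrite /GRing.scale /= ?expr1; ring.
  have h2 := @is_derive1_comp R (@ln R) (fun w => A ^+ 2 + (w - m) ^+ 2) x _ _
    (is_derive1_ln (den (x - m))) h1.
  have h3 := is_deriveN (is_deriveZ (2^-1) h2).
  rewrite (_ : (fun w => _) = - (2^-1 \*: (@ln R \o (fun w => A ^+ 2 + (w - m) ^+ 2)))).
    by apply: is_derive_eq h3 _; rewrite /GRing.scale /=; field; exact: den0.
  by apply/funext => w; rewrite /GRing.opp /= /GRing.scale /= mulrC.
rewrite /cint (Rintegral_FTC ab cr D1) (Rintegral_FTC ab ci D2).
rewrite (_ : m + Y - m = Y); last by ring.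
rewrite (_ : m - Y - m = - Y); last by ring.
rewrite sqrrN subrr; congr (_ +i _).
by rewrite mulNr atanN opprK mulr2n mulrDl mul1r.
Qed.

Lemma normc_sqr_kernel A (w : R) : A != 0 ->
  normc (A +i w)^-1 ^+ 2 = A^-1 * Re (A +i w)^-1.
Proof.
move=> A0; have den : A ^+ 2 + w ^+ 2 != 0.
  by apply: lt0r_neq0; rewrite ltr_wpDr ?sqr_ge0 // exprn_even_gt0.
by rewrite normc_sqr /=; field; rewrite A0 den.
Qed.

Lemma cvg_atan_scaled A : 0 < A -> forall e : R, 0 < e ->
  exists2 Y0, 0 < Y0 & forall Y, Y0 <= Y -> `|2 * atan (Y / A) - pi| <= e.
Proof.
move=> A0 e e0; have := @cvgy_atan R; move/cvgrPdist_lt => /(_ (e / 2)).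
rewrite divr_gt0 // => /(_ isT) [M [_ hM]].
exists (A * (`|M| + 1)); first by rewrite mulr_gt0 // ltr_wpDl.
move=> Y hY; have : M < Y / A.
  rewrite ltr_pdivlMr //; apply: lt_le_trans hY; rewrite mulrC ltr_pM2l //.
  by apply: (le_lt_trans (ler_norm _)); rewrite ltrDl.
move=> /hM; rewrite distrC => h.
rewrite (_ : _ - _ = 2 * (atan (Y / A) - pi / 2)); last by field.
rewrite normrM ger0_norm // ; lra.
Qed.

(** By [normc_sqr_kernel] the integrand is the real part of the kernel divided by [A], which
    [cint_kernel] integrates; |atan| < pi / 2 gives a bound independent of the window. *)
Lemma kernel_sqr_bound A m Y : A != 0 -> 0 < Y ->
  \int[mu]_(w in `[m - Y, m + Y]) (normc (A +i (w - m))^-1 ^+ 2) <= pi / `|A|.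
Proof.
move=> A0 Y0.
have [ir _] : cintegrable `[m - Y, m + Y] (fun w => (A +i (w - m))^-1).
  by apply: ccont_integrable => w _; exact: kernel_continuous.
rewrite (@eq_Rintegral _ _ _ mu _
  (fun w => A^-1 * Re (A +i (w - m))^-1)); last first.
  by move=> w _; exact: normc_sqr_kernel.
rewrite RintegralZl //.
have := cint_kernel m A0 Y0; rewrite /cint => -[-> _].
have [A1|A1] := ltrP 0 A.
  rewrite gtr0_norm // [leRHS]mulrC ler_pM2l ?invr_gt0 //.
  have := atan_ltpi2 (Y / A); lra.
have {}A1 : A < 0 by rewrite lt_neqAle A0.
rewrite ltr0_norm //; have [B B0 ->] : exists2 B, 0 < B & A = - B.
  by exists (- A); rewrite ?oppr_gt0 ?opprK.
rewrite opprK invrN mulrN atanN !mulrN mulNr opprK.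
rewrite [leRHS]mulrC ler_pM2l ?invr_gt0 //.
have := atan_ltpi2 (Y / B); lra.
Qed.

End HalfPlaneKernel.

(** * Mean-square estimates on vertical lines and decay of horizontal sides *)

Section CauchyOnLines.
Variable R : realType.
Notation mu := (@lebesgue_measure R).
Implicit Types (x y X Y c d u w e m : R).

Lemma ccont_normc (g : R -> R[i]) x : ccont g x ->
  {for x, continuous (fun w => normc (g w))}.
Proof.
move=> hg; apply/cvgrPdist_lt => e e0; have [d d0 h] := hg e e0.
near=> w; apply: (le_lt_trans _ (h w _)).
  rewrite ler_norml; apply/andP; split.
    by have := normc_lerB (g w) (g x); lra.
  by rewrite normc_distrC; exact: normc_lerB.
near: w; apply/nbhs_ballP; exists d => //= w; rewrite /ball /= distrC.
by [].
Unshelve. all: by end_near. Qed.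

Lemma ccont_normc_within (g : R -> R[i]) c d :
  (forall w, c <= w <= d -> ccont g w) ->
  {within `[c, d], continuous (fun w => normc (g w))}.
Proof.
move=> h; apply: continuous_in_subspaceT => w; rewrite inE /= in_itv /= => hw.
by apply: ccont_normc; exact: h.
Qed.

Lemma ccont_normc_bounded (g : R -> R[i]) c d : c <= d ->
  (forall w, c <= w <= d -> ccont g w) ->
  exists2 M, 0 <= M & forall w, c <= w <= d -> normc (g w) <= M.
Proof.
move=> cd h; have [w0 _ hw] := EVT_max cd (ccont_normc_within h).
exists (normc (g w0)); first exact: normc_ge0.
by move=> w hw0; apply: hw; rewrite in_itv.
Qed.

Lemma ccont_normc_integrable (g : R -> R[i]) c d :
  (forall w, c <= w <= d -> ccont g w) ->
  mu.-integrable `[c, d] (EFin \o (fun w => normc (g w) ^+ 2)).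
Proof.
move=> h; apply: continuous_compact_integrable; first exact: segment_compact.
have h' := ccont_normc_within h.
by move=> w; exact: (cvgM (h' w) (h' w)).
Qed.

Variables (f : R[i] -> R[i]) (K : R).
Hypothesis holo_f : forall z, 0 < Re z -> holo_at f z.
Hypothesis line_f : forall x, 0 < x ->
  (\int[mu]_w (normc (f (x +i w)) ^+ 2)%:E <= K%:E)%E.

Lemma line_ccont x w : 0 < x -> ccont (fun w => f (x +i w)) w.
Proof. by move=> x0; apply/ccont_vertical/holo_at_continuous/holo_f. Qed.

Lemma horizontal_ccont y u : 0 < u -> ccont (fun u => f (u +i y)) u.
Proof. by move=> x0; apply/ccont_horizontal/holo_at_continuous/holo_f. Qed.

Lemma line_sqr_le x c d : 0 < x ->
  \int[mu]_(w in `[c, d]) (normc (f (x +i w)) ^+ 2) <= K.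
Proof.
move=> x0; rewrite -lee_fin.
have ig := ccont_normc_integrable (c := c) (d := d) (fun w _ => line_ccont w x0).
rewrite /Rintegral fineK; last exact: integrable_fin_num.
apply: le_trans (line_f x0); apply: ge0_subset_integral => //.
- apply/measurable_EFinP; apply: continuous_measurable_fun => w.
  by have h := ccont_normc (line_ccont w x0); exact: (cvgM h h).
- by move=> w _; rewrite lee_fin sqr_ge0.
Qed.

Lemma line_bound_ge0 : 0 <= K.
Proof.
rewrite -lee_fin; apply: le_trans (line_f ltr01).
by apply: integral_ge0 => w _; rewrite lee_fin sqr_ge0.
Qed.

(** Cauchy-Schwarz in the additive form |a b| <= dl a^2 + b^2 / dl: the free weight [dl] replaces
    square roots and is tuned in each application. *)
Lemma line_pairing_bound (k : R -> R[i]) x c d Q dl : 0 < x ->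
  (forall w, c <= w <= d -> ccont k w) ->
  \int[mu]_(w in `[c, d]) (normc (k w) ^+ 2) <= Q -> 0 < dl ->
  normc (cint `[c, d] (fun w => f (x +i w) * k w)) <= 2 * (dl * K + Q / dl).
Proof.
move=> x0 hk kQ dl0.
have hfk w : c <= w <= d -> ccont (fun w => f (x +i w) * k w) w.
  by move=> hw; apply: ccontM; [exact: line_ccont|exact: hk].
have i1 := ccont_normc_integrable (c := c) (d := d) (fun w _ => line_ccont w x0).
have i2 := ccont_normc_integrable hk.
apply: (le_trans (normc_cint_le _ (ccont_integrable hfk))) => //.
rewrite ler_pM2l //.
have iD := integrable_lin dl dl^-1 (measurable_itv _) i1 i2.
apply: (@le_trans _ _ (\int[mu]_(w in `[c, d])
    (dl * normc (f (x +i w)) ^+ 2 + dl^-1 * normc (k w) ^+ 2))).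
  apply: le_Rintegral => //.
    by apply: cintegrable_normc => //; exact: ccont_integrable.
  move=> w _; rewrite normcM; set a := normc _; set b := normc _.
  have dl1 : dl * dl^-1 = 1 by rewrite mulfV // gt_eqF.
  have : 0 <= dl^-1 * (dl * a - b) ^+ 2.
    by rewrite mulr_ge0 ?sqr_ge0 // invr_ge0 ltW.
  rewrite (_ : _ * _ ^+ 2 = dl * a ^+ 2 + dl^-1 * b ^+ 2 - 2 * (a * b)).
    have : 0 <= a * b by rewrite mulr_ge0 // normc_ge0.
    lra.
  by field; rewrite gt_eqF.
rewrite Rintegral_lin // [Q / dl]mulrC.
apply: lerD; rewrite ler_pM2l ?invr_gt0 //.
exact: line_sqr_le.
Qed.

Lemma line_integral_bound x c d dl : 0 < x -> c <= d -> 0 < dl ->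
  normc (cint `[c, d] (fun w => f (x +i w))) <= 2 * (dl * K + (d - c) / dl).
Proof.
move=> x0 cd dl0.
rewrite (@eq_cint _ _ _ (fun w => f (x +i w) * 1)); last by move=> w _; rewrite mulr1.
apply: line_pairing_bound => //.
  by move=> w _; exact: ccont_cst.
under eq_Rintegral do rewrite ComplexField.Normc.normc1 expr1n.
by rewrite Rintegral_cst // fine_measure_segment // mul1r.
Qed.

(** [Goursat] between the heights [m] and [y] changes the horizontal primitive by two vertical
    integrals, and mean-square control bounds each of these by a constant plus an arbitrarily small
    multiple of the height. *)
Lemma primitive_growth a X m e : 0 < a -> a <= X -> 0 < e ->
  exists2 Y0, 0 < Y0 & forall y, Y0 <= `|y - m| -> forall u, a <= u <= X ->
    normc (cint `[a, u] (fun t => f (t +i y))) <= e * `|y - m|.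
Proof.
move=> a0 aX e0.
have pos u : a <= u -> 0 < u by exact: lt_le_trans.
have [M M0 hM] := @ccont_normc_bounded (fun t => f (t +i m)) a X aX
  (fun w hw => horizontal_ccont m (pos w (andP hw).1)).
(* With this weight each vertical integral is at most 2 dl K + (e / 4) (d - c). The two together use
   half of [e]; [Y0] is chosen so that the constants fit into the other half. *)
pose dl := 8 / e; have dl0 : 0 < dl by rewrite divr_gt0.
have K0 := line_bound_ge0.
have B0 : 0 <= 2 * (M * (X - a)) + 4 * (dl * K).
  by rewrite addr_ge0 // mulr_ge0 // mulr_ge0 ?subr_ge0 // ltW.
exists (2 * (2 * (M * (X - a)) + 4 * (dl * K)) / e + 1).
  by rewrite ltr_wpDl // divr_ge0 ?(ltW e0) // mulr_ge0.
move=> y hy u /andP[au uX].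
have hi t z : a <= t <= u -> ccont (fun t => f (t +i z)) t.
  by move=> /andP[/pos t0 _]; exact: horizontal_ccont.
have i1 z : cintegrable `[a, u] (fun t => f (t +i z)).
  by apply: ccont_integrable => t; exact: hi.
have V c d : c <= d ->
    normc (cint `[c, d] (fun w => f (u +i w) - f (a +i w))) <=
    4 * (dl * K) + e / 2 * (d - c).
  move=> cd; rewrite cintB //; try (by apply: ccont_integrable => w _;
    apply: line_ccont; rewrite ?pos).
  apply: (le_trans (normcB_le _ _)).
  have := line_integral_bound (pos _ au) cd dl0.
  have := line_integral_bound a0 cd dl0.
  have -> : (d - c) / dl = e / 8 * (d - c) by rewrite /dl; field; rewrite gt_eqF.
  lra.
have hm : normc (cint `[a, u] (fun t => f (t +i m))) <= 2 * (M * (X - a)).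
  apply: (@le_trans _ _ (2 * (M * (u - a)))).
    apply: normc_cint_bound => //; first by move=> t; exact: hi.
    by move=> t /andP[t1 t2]; apply: hM; rewrite t1 (le_trans t2).
  by rewrite ler_pM2l // ler_wpM2l // lerD2r.
have diff : normc (cint `[a, u] (fun t => f (t +i y)) -
    cint `[a, u] (fun t => f (t +i m))) <= 4 * (dl * K) + e / 2 * `|y - m|.
  have hG c d : c <= d -> rint f a u c d = 0.
    by move=> cd; apply: Goursat => // p q /andP[/pos p0 _] _; exact: holo_f.
  have [my|/ltW ym] := leP m y.
    have := hG _ _ my; rewrite /rint cintB // => /eqP.
    rewrite addrC addr_eq0 opprB => /eqP <-.
    rewrite normcM normcI normr1 mul1r ger0_norm ?subr_ge0 //; exact: V.
  have := hG _ _ ym; rewrite /rint cintB // => /eqP.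
  rewrite addr_eq0 => /eqP ->; rewrite normcN normcM normcI normr1 mul1r.
  by rewrite distrC ger0_norm ?subr_ge0 //; exact: V.
have {}hy : 2 * (2 * (M * (X - a)) + 4 * (dl * K)) <= e * `|y - m|.
  rewrite [leRHS]mulrC -ler_pdivrMr //.
  by apply: le_trans hy; rewrite lerDl.
rewrite -(subrK (cint `[a, u] (fun t => f (t +i m))) (cint _ _)).
apply: (le_trans (normcD _ _)); lra.
Qed.

Lemma kernel_horizontal_le (p : R[i]) u y : y != Im p ->
  normc ((u +i y) - p)^-1 <= `|y - Im p|^-1.
Proof.
move=> yp; have h0 : 0 < `|y - Im p| by rewrite normr_gt0 subr_eq0.
have h : `|y - Im p| <= normc ((u +i y) - p).
  by apply: le_trans (Im_le_normc _); case: (p).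
by rewrite normcV lef_pV2 ?posrE // (lt_le_trans h0).
Qed.

(** No pointwise decay of [f] is available, hence an integration by parts: the primitive is o(|y|)
    by [primitive_growth], the kernel is O(1/|y|) and its derivative O(1/|y|^2). *)
Lemma horizontal_vanish (p : R[i]) x X e : 0 < x -> x < X -> 0 < e ->
  exists2 Y0, 0 < Y0 & forall y, Y0 <= `|y - Im p| ->
    normc (cint `[x, X] (fun u => f (u +i y) * ((u +i y) - p)^-1)) <= e.
Proof.
(* The primitive starts to the left of [x], so that it is differentiable at [x] too. *)
move=> x0 xX e0; set m := Im p; pose a := x / 2.
have a0 : 0 < a by rewrite divr_gt0.
have ax : a < x by rewrite /a; lra.
(* Two boundary terms of size [e1] and a remaining integral of size [2 * (e1 * (X - x))] add up to
   [e]. *)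
pose e1 := e / (2 + 2 * (X - x)).
have e10 : 0 < e1 by rewrite divr_gt0 //; lra.
have aX : a <= X by lra.
have [Y1 Y10 hY] := primitive_growth m a0 aX e10.
exists (Num.max Y1 1) => [|y]; first by rewrite lt_max ltr01 orbT.
rewrite ge_max => /andP[hy1 y1].
have t0 : 0 < `|y - m| by exact: lt_le_trans y1.
have yp : y != m by rewrite -subr_eq0 -normr_gt0.
set t := `|y - m| in hy1 y1 t0.
have zp u : (u +i y) != p.
  by apply/eqP => E; rewrite /m -E /= eqxx in yp.
pose F u := cint `[a, u] (fun t => f (t +i y)).
pose k u : R[i] := ((u +i y) - p)^-1.
have hF u : x <= u <= X -> rderiv F u (f (u +i y)).
  move=> /andP[xu _]; apply: (rderiv_primitive (g := fun t => f (t +i y))).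
    exact: lt_le_trans xu.
  by move=> v av; apply: horizontal_ccont; exact: lt_le_trans av.
have hk u : rderiv k u (- k u ^+ 2).
  exact: (cderiv_horizontal (cderiv_invB (zp u))).
have ck u : ccont k u.
  by apply: (ccont_horizontal (f := fun z => (z - p)^-1));
    apply: holo_at_continuous; eexists; exact: cderiv_invB.
have cF u : x <= u <= X -> ccont F u by move=> /hF; exact: rderiv_ccont.
have cf u : x <= u <= X -> ccont (fun u => f (u +i y)) u.
  by move=> /andP[xu _]; apply: horizontal_ccont; exact: lt_le_trans xu.
have kt u : normc (k u) <= t^-1 by exact: kernel_horizontal_le.
have Ft u : x <= u <= X -> normc (F u) <= e1 * t.
  by move=> /andP[xu uX]; apply: hY => //; rewrite uX (le_trans (ltW ax)).
have xxX : x <= x <= X by rewrite lexx ltW.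
have XxX : x <= X <= X by rewrite lexx ltW.
have c1 u : x <= u <= X -> ccont (fun u => f (u +i y) * k u) u.
  by move=> hu; apply: ccontM; [exact: cf|exact: ck].
have c2 u : x <= u <= X -> ccont (fun u => F u * (- k u ^+ 2)) u.
  move=> hu; rewrite (_ : (fun u => _) = (fun u => (F u * (- 1)) * (k u * k u))).
    apply: ccontM; last by apply: ccontM; exact: ck.
    by apply: ccontM; [exact: cF|exact: ccont_cst].
  by apply/funext => v; ring.
have c3 u : x <= u <= X ->
    ccont (fun u => f (u +i y) * k u + F u * (- k u ^+ 2)) u.
  move=> hu; have h1 := c1 _ hu; have h2 := c2 _ hu.
  rewrite (_ : (fun u => _) = (fun u => f (u +i y) * k u - (-1) * (F u * (- k u ^+ 2)))).
    by apply: ccontB => //; apply: ccontM => //; exact: ccont_cst.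
  by apply/funext => v; ring.
have parts := cint_FTC xX (fun u hu => rderivM (hF u hu) (hk u)) c3.
rewrite cintD // in parts; [|exact: ccont_integrable|exact: ccont_integrable].
have -> : cint `[x, X] (fun u => f (u +i y) * k u) =
    F X * k X - F x * k x - cint `[x, X] (fun u => F u * (- k u ^+ 2)).
  by rewrite -parts addrK.
have Fk u : x <= u <= X -> normc (F u * k u) <= e1.
  move=> hu; rewrite normcM; apply: (@le_trans _ _ (e1 * t * t^-1)).
    by apply: ler_pM; rewrite ?normc_ge0 //; exact: Ft.
  by rewrite mulfK // gt_eqF.
have t1 : t^-1 <= 1 by rewrite invf_le1.
have B : normc (cint `[x, X] (fun u => F u * (- k u ^+ 2))) <= 2 * (e1 * (X - x)).
  apply: normc_cint_bound => //; first exact: ltW.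
  move=> u hu; rewrite mulrN normcN expr2 mulrA normcM -[leRHS]mulr1.
  apply: ler_pM; rewrite ?normc_ge0 //; first exact: Fk.
  exact: le_trans (kt u) t1.
apply: (@le_trans _ _ (e1 + e1 + 2 * (e1 * (X - x)))).
  apply: (le_trans (normcB_le _ _)); apply: lerD => //.
  by apply: (le_trans (normcB_le _ _)); apply: lerD; exact: Fk.
rewrite le_eqVlt /e1; apply/orP; left; apply/eqP; field.
by rewrite gt_eqF //; lra.
Qed.
End CauchyOnLines.

(** * Fatou's lemma and weak convergence in L^2 *)

Section SquareIntegrable.
Variable R : realType.
Notation mu := (@lebesgue_measure R).
Implicit Types (h k : R -> R) (f g : R -> R[i]) (C : R).

Lemma fatou_bound (phi : nat -> R -> R) (psi : R -> R) C :
  (forall n, measurable_fun setT (phi n)) -> measurable_fun setT psi ->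
  (forall n w, 0 <= phi n w) -> (forall w, 0 <= psi w) ->
  {ae mu, forall w, phi n w @[n --> \oo] --> psi w} ->
  (forall n, (\int[mu]_w (phi n w)%:E <= C%:E)%E) ->
  (\int[mu]_w (psi w)%:E <= C%:E)%E.
Proof.
move=> mphi mpsi phi0 psi0 cvg bnd.
have mE n : measurable_fun setT (EFin \o phi n) by exact/measurable_EFinP.
have := fatou mu (D := setT) measurableT (f := fun n w => (phi n w)%:E) mE
  (fun n w _ => phi0 n w) => F.
apply: (@le_trans _ _ (\int[mu]_w limn_einf (fun n => (phi n w)%:E))%E); last first.
  apply: (le_trans F); rewrite limn_einf_lim; apply: lime_le; first exact: is_cvg_einfs.
  apply: nearW => n; apply: le_trans (bnd n).
  by apply: ereal_inf_lbound; exists n => /=.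
apply: ae_ge0_le_integral => //.
- by move=> w _; rewrite lee_fin.
- exact/measurable_EFinP.
- move=> w _; rewrite limn_einf_lim; apply: lime_ge; first exact: is_cvg_einfs.
  by apply: nearW => n; apply: le_ereal_inf_tmp => _ [m _ <-]; rewrite lee_fin.
- apply: measurableT_comp; first exact: oppe_measurable.
  apply: measurable_fun_limn_esup => n.
  by apply: measurableT_comp; [exact: oppe_measurable|exact: mE].
move: cvg; apply: (@filterS _ _ (ae_filter_ringOfSetsType mu)) => w hw _.
have hE : (fun n => (phi n w)%:E) @ \oo --> (psi w)%:E.
  by apply: cvg_EFin => //; exact: nearW.
by have [-> _] := cvg_limn_einf_sup hE.
Qed.

Lemma sqr_integrable h C : measurable_fun setT h ->
  (\int[mu]_w (h w ^+ 2)%:E <= C%:E)%E ->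
  mu.-integrable setT (EFin \o (fun w => h w ^+ 2)).
Proof.
move=> mh hC; apply/integrableP; split.
  by apply/measurable_EFinP; exact: measurable_funX.
under eq_integral => w _ do rewrite /= ger0_norm ?sqr_ge0 //.
by apply: (le_lt_trans hC); rewrite ltry.
Qed.

Lemma prod_integrable h k : measurable_fun setT h -> measurable_fun setT k ->
  mu.-integrable setT (EFin \o (fun w => h w ^+ 2)) ->
  mu.-integrable setT (EFin \o (fun w => k w ^+ 2)) ->
  mu.-integrable setT (EFin \o (fun w => h w * k w)).
Proof.
move=> mh mk ih ik; have il := integrable_lin 1 1 measurableT ih ik.
apply: (le_integrable measurableT _ _ il).
  by apply/measurable_EFinP; exact: measurable_funM.
move=> w _ /=; rewrite lee_fin !mul1r [leRHS]ger0_norm ?addr_ge0 ?sqr_ge0 //.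
rewrite normrM -[h w ^+ 2]real_normK ?num_real // -[k w ^+ 2]real_normK ?num_real //.
have := sqr_ge0 (`|h w| - `|k w|); have := normr_ge0 (h w); have := normr_ge0 (k w).
nra.
Qed.

Lemma le_of_integral h C : mu.-integrable setT (EFin \o h) ->
  (\int[mu]_w (h w)%:E <= C%:E)%E -> \int[mu]_w h w <= C.
Proof.
move=> ih hC; rewrite -lee_fin /Rintegral fineK //; exact: integrable_fin_num.
Qed.

Lemma EFin_Rintegral h : mu.-integrable setT (EFin \o h) ->
  (\int[mu]_w (h w)%:E)%E = (\int[mu]_w h w)%:E.
Proof. by move=> ih; rewrite /Rintegral fineK //; exact: integrable_fin_num. Qed.

(* Fatou's lemma applied to d h_n^2 + k^2 / (4 d) - h_n k >= 0, for small d. *)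
Lemma weak_cvg0 (h : nat -> R -> R) k C : (forall n, measurable_fun setT (h n)) ->
  measurable_fun setT k -> (forall n w, 0 <= h n w) ->
  {ae mu, forall w, h n w @[n --> \oo] --> 0} ->
  (forall n, (\int[mu]_w (h n w ^+ 2)%:E <= C%:E)%E) ->
  mu.-integrable setT (EFin \o (fun w => k w ^+ 2)) ->
  forall e : R, 0 < e -> exists N, forall n, (N <= n)%N ->
    \int[mu]_w (h n w * k w) <= e.
Proof.
move=> mh mk h0 hcvg hC ik e e0; apply: contrapT => bad.
have {bad} sub N : exists n, (N <= n)%N /\ e < \int[mu]_w (h n w * k w).
  apply: contrapT => no; apply: bad; exists N => n Nn; rewrite leNgt; apply/negP => en.
  by apply: no; exists n.
have C0 : 0 <= C.
  rewrite -lee_fin; apply: le_trans (hC 0%N).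
  by apply: integral_ge0 => w _; rewrite lee_fin sqr_ge0.
(* The indices need not increase: [N <= s N] is enough for pointwise convergence to pass to them. *)
pose s N := sval (cid (sub N)).
have s1 N : (N <= s N)%N by rewrite /s; case: cid => n [].
have s2 N : e < \int[mu]_w (h (s N) w * k w) by rewrite /s; case: cid => n [].
have D0 : 0 < 2 * C + 1 by rewrite ltr_wpDl // mulr_ge0.
(* Fatou's lemma will yield e <= d C, which this choice contradicts. *)
pose d := e / (2 * C + 1); have d0 : 0 < d by rewrite divr_gt0.
pose phi n w := d * h (s n) w ^+ 2 + (4 * d)^-1 * k w ^+ 2 - h (s n) w * k w.
pose psi w := (4 * d)^-1 * k w ^+ 2.
pose Q := \int[mu]_w (k w ^+ 2).
have ih n := sqr_integrable (mh n) (hC n).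
have ihk n := prod_integrable (mh n) mk (ih n) ik.
have id4 : 0 <= (4 * d)^-1 by rewrite invr_ge0 mulr_ge0 // ltW.
have ilin n := integrable_lin d (4 * d)^-1 measurableT (ih n) ik.
have iphi n : mu.-integrable setT (EFin \o phi n).
  have := integrable_lin 1 (-1) measurableT (ilin (s n)) (ihk (s n)).
  by apply: eq_integrable => // w _ /=; rewrite /phi mul1r mulN1r.
have ipsi : mu.-integrable setT (EFin \o psi) by exact: integrable_scale.
have := @fatou_bound phi psi (d * C + (4 * d)^-1 * Q - e).
have phi_ge0 n w : 0 <= phi n w.
  have : 0 <= d^-1 * (d * h (s n) w - k w / 2) ^+ 2.
    by rewrite mulr_ge0 ?sqr_ge0 // invr_ge0 ltW.
  rewrite (_ : _ * _ ^+ 2 = phi n w) // /phi.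
  by field; rewrite gt_eqF.
have mphi n : measurable_fun setT (phi n).
  by apply/measurable_EFinP; exact: measurable_int (iphi n).
have mpsi : measurable_fun setT psi.
  by apply/measurable_EFinP; exact: measurable_int ipsi.
move=> /(_ mphi mpsi phi_ge0).
have psi_ge0 w : 0 <= psi w by rewrite mulr_ge0 ?sqr_ge0.
move=> /(_ psi_ge0).
have cphi : {ae mu, forall w, phi n w @[n --> \oo] --> psi w}.
  move: hcvg; apply: (@filterS _ _ (ae_filter_ringOfSetsType mu)) => w hw.
  have hs : h (s n) w @[n --> \oo] --> 0.
    apply/cvgrPdist_lt => r r0; move/cvgrPdist_lt : hw => /(_ r r0) [N _ hN].
    by exists N => // n /= Nn; apply: hN; exact: leq_trans (s1 n).
  rewrite (_ : psi w = d * (0 * 0) + psi w - 0 * k w); last by rewrite !mul0r mulr0 add0r subr0.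
  apply: cvgB; last by apply: cvgM => //; exact: cvg_cst.
  apply: cvgD; last exact: cvg_cst.
  by apply: cvgM; [exact: cvg_cst|exact: (cvgM hs hs)].
have bphi n : (\int[mu]_w (phi n w)%:E <= (d * C + (4 * d)^-1 * Q - e)%:E)%E.
  rewrite EFin_Rintegral // lee_fin.
  rewrite (@eq_Rintegral _ _ _ mu _ (fun w =>
    1 * (d * h (s n) w ^+ 2 + (4 * d)^-1 * k w ^+ 2) + (-1) * (h (s n) w * k w)));
    last by move=> w _; rewrite /phi mul1r mulN1r.
  rewrite Rintegral_lin // Rintegral_lin // mul1r mulN1r -/Q.
  apply: lerB; last exact/ltW/s2.
  by rewrite lerD2r ler_pM2l //; exact: le_of_integral.
move=> /(_ cphi bphi); rewrite EFin_Rintegral // lee_fin RintegralZl // -/Q => le1.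
have : e <= d * C by lra.
by apply/negP; rewrite -ltNge /d mulrAC ltr_pdivrMr //; nra.
Qed.

Definition cmeas f : Prop :=
  measurable_fun setT (fun w => Re (f w)) /\ measurable_fun setT (fun w => Im (f w)).

Lemma cmeasD f g : cmeas f -> cmeas g -> cmeas (fun w => f w + g w).
Proof.
move=> [fr fi] [gr gi]; split.
- rewrite (_ : (fun w => _) = (fun w => Re (f w) + Re (g w))).
    exact: measurable_funD.
  by apply/funext => w; case: (f w) (g w) => ? ? [].
- rewrite (_ : (fun w => _) = (fun w => Im (f w) + Im (g w))).
    exact: measurable_funD.
  by apply/funext => w; case: (f w) (g w) => ? ? [].
Qed.

Lemma cmeasM f g : cmeas f -> cmeas g -> cmeas (fun w => f w * g w).
Proof.
move=> [fr fi] [gr gi]; split.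
- rewrite (_ : (fun w => _) = (fun w => Re (f w) * Re (g w) - Im (f w) * Im (g w))).
    by apply: measurable_funB; exact: measurable_funM.
  by apply/funext => w; case: (f w) (g w) => ? ? [].
- rewrite (_ : (fun w => _) = (fun w => Re (f w) * Im (g w) + Im (f w) * Re (g w))).
    by apply: measurable_funD; exact: measurable_funM.
  by apply/funext => w; case: (f w) (g w) => ? ? [].
Qed.

Lemma cmeas_cst (z : R[i]) : cmeas (fun=> z).
Proof. by split; exact: measurable_cst. Qed.

Lemma cmeasN f : cmeas f -> cmeas (fun w => - f w).
Proof.
move=> hf; rewrite (_ : (fun w => _) = (fun w => (-1) * f w)).
  by apply: cmeasM => //; exact: cmeas_cst.
by apply/funext => w; rewrite mulN1r.
Qed.

Lemma cmeasB f g : cmeas f -> cmeas g -> cmeas (fun w => f w - g w).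
Proof. by move=> hf hg; apply: cmeasD => //; exact: cmeasN. Qed.

Lemma cmeas_conj f : cmeas f -> cmeas (fun w => (f w)^*).
Proof.
move=> [fr fi]; split.
- by rewrite (_ : (fun w => _) = (fun w => Re (f w))) //; apply/funext => w; case: (f w).
- rewrite (_ : (fun w => _) = (fun w => - Im (f w))); first exact: measurable_funN.
  by apply/funext => w; case: (f w).
Qed.

Lemma cmeas_ccont f : (forall w, ccont f w) -> cmeas f.
Proof. by move=> /ccont_measurable. Qed.

Lemma cmeas_normc f : cmeas f -> measurable_fun setT (fun w => normc (f w)).
Proof.
move=> [fr fi].
rewrite (_ : (fun _ => _) = (fun w => Num.sqrt (Re (f w) ^+ 2 + Im (f w) ^+ 2))).
  have ms := continuous_measurable_fun (@sqrt_continuous R).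
  apply: (measurableT_comp ms (g := fun w => Re (f w) ^+ 2 + Im (f w) ^+ 2)).
  by apply: measurable_funD; apply: measurable_funX.
by apply/funext => w; case: (f w).
Qed.

(** [C] bounds the squared norm, hence [D ^+ 2 * C] after multiplication by a factor of modulus at
    most [D], and [2 * C + 2 * D] for a sum. *)
Definition L2_bounded f C : Prop :=
  cmeas f /\ (\int[mu]_w (normc (f w) ^+ 2)%:E <= C%:E)%E.

Lemma L2_bounded_integrable f C : L2_bounded f C ->
  mu.-integrable setT (EFin \o (fun w => normc (f w) ^+ 2)).
Proof. by move=> [mf fC]; apply: sqr_integrable fC; exact: cmeas_normc. Qed.

Lemma L2_bounded_le f g C D : L2_bounded f C -> cmeas g -> 0 <= D ->
  (forall w, normc (g w) <= D * normc (f w)) -> L2_bounded g (D ^+ 2 * C).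
Proof.
move=> hf mg D0 gf; split => //.
have i := L2_bounded_integrable hf; case: hf => mf fC.
apply: (@le_trans _ _ (\int[mu]_w (D ^+ 2 * normc (f w) ^+ 2)%:E)%E).
  apply: ge0_le_integral => //.
  - by move=> w _; rewrite lee_fin sqr_ge0.
  - by apply/measurable_EFinP/measurable_funX; exact: cmeas_normc.
  - apply/measurable_EFinP/measurable_funM; first exact: measurable_cst.
    by apply/measurable_funX; exact: cmeas_normc.
  - move=> w _; rewrite lee_fin -exprMn ler_pXn2r ?nnegrE ?mulr_ge0 //;
    exact: normc_ge0.
rewrite EFin_Rintegral; last exact: integrable_scale.
rewrite lee_fin RintegralZl // ler_wpM2l ?sqr_ge0 //; exact: le_of_integral.
Qed.

Lemma L2_boundedD f g C D : L2_bounded f C -> L2_bounded g D ->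
  L2_bounded (fun w => f w + g w) (2 * C + 2 * D).
Proof.
move=> hf hg; have i1 := L2_bounded_integrable hf; have i2 := L2_bounded_integrable hg.
case: hf hg => mf fC [mg gD]; have mfg := cmeasD mf mg; split => //.
apply: (@le_trans _ _ (\int[mu]_w (2 * normc (f w) ^+ 2 + 2 * normc (g w) ^+ 2)%:E)%E).
  apply: ge0_le_integral => //.
  - by move=> w _; rewrite lee_fin sqr_ge0.
  - by apply/measurable_EFinP/measurable_funX; exact: cmeas_normc.
  - by apply/measurable_EFinP/measurable_funD; apply: measurable_funM;
      [exact: measurable_cst|apply/measurable_funX; exact: cmeas_normc
      |exact: measurable_cst|apply/measurable_funX; exact: cmeas_normc].
  - move=> w _; rewrite lee_fin.
    have := normcD (f w) (g w); have := normc_ge0 (f w + g w).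
    set a := normc (f w); set b := normc (g w); set c := normc _ => c0 cab.
    have : c ^+ 2 <= (a + b) ^+ 2 by rewrite ler_pXn2r ?nnegrE // (le_trans c0).
    have := sqr_ge0 (a - b); rewrite !expr2; nra.
rewrite EFin_Rintegral; last exact: integrable_lin.
rewrite lee_fin Rintegral_lin //; apply: lerD; rewrite ler_pM2l //; exact: le_of_integral.
Qed.

Lemma L2_prod_integrable f g C D : L2_bounded f C -> L2_bounded g D ->
  cintegrable setT (fun w => f w * g w).
Proof.
move=> hf hg; have i1 := L2_bounded_integrable hf; have i2 := L2_bounded_integrable hg.
case: hf hg => mf _ [mg _]; have [m1 m2] := cmeasM mf mg.
apply: (cintegrable_le measurableT m1 m2 (prod_integrable _ _ i1 i2)) => //.
- exact: cmeas_normc.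
- exact: cmeas_normc.
- by move=> w _; rewrite normcM.
Qed.

Lemma L2_limit (F : nat -> R -> R[i]) (G : R -> R[i]) C :
  (forall n, L2_bounded (F n) C) -> cmeas G ->
  {ae mu, forall w, normc (F n w - G w) @[n --> \oo] --> 0} -> L2_bounded G C.
Proof.
move=> hF mG cv; split => //; apply: (@fatou_bound (fun n w => normc (F n w) ^+ 2)).
- by move=> n; apply: measurable_funX; apply: cmeas_normc; case: (hF n).
- by apply: measurable_funX; exact: cmeas_normc.
- by move=> n w; rewrite sqr_ge0.
- by move=> w; rewrite sqr_ge0.
- move: cv; apply: (@filterS _ _ (ae_filter_ringOfSetsType mu)) => w hw.
  have hn : normc (F n w) @[n --> \oo] --> normc (G w).
    apply/cvgrPdist_lt => e e0; move/cvgrPdist_lt : hw => /(_ e e0) [N _ hN].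
    exists N => // n /hN /=; rewrite sub0r normrN (ger0_norm (normc_ge0 _)).
    apply: le_lt_trans; rewrite ler_norml; apply/andP; split.
      by have := normc_lerB (F n w) (G w); lra.
    by rewrite normc_distrC; exact: normc_lerB.
  exact: (cvgM hn hn).
- by move=> n; case: (hF n).
Qed.

(** [weak_cvg0] is applied to the moduli of [F n - G] and of [k], so even the integral of the
    product of the moduli tends to 0; the half of [e] pays for [normc_cint_le]. *)
Lemma cint_weak_cvg (F : nat -> R -> R[i]) (G k : R -> R[i]) C D :
  (forall n, L2_bounded (F n) C) -> cmeas G ->
  {ae mu, forall w, normc (F n w - G w) @[n --> \oo] --> 0} ->
  L2_bounded k D -> forall e : R, 0 < e -> exists N, forall n, (N <= n)%N ->
    normc (cint setT (fun w => F n w * k w) - cint setT (fun w => G w * k w)) <= e.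
Proof.
move=> hF mG cv hk e e0; have hG := L2_limit hF mG cv.
have C0 : 0 <= C.
  rewrite -lee_fin; case: hG => _; apply: le_trans.
  by apply: integral_ge0 => w _; rewrite lee_fin sqr_ge0.
have hB n : L2_bounded (fun w => F n w - G w) (4 * C).
  have hN : L2_bounded (fun w => - G w) C.
    have := L2_bounded_le hG (cmeasN mG) (@ler01 R).
    by rewrite expr1n mul1r; apply => w; rewrite normcN mul1r.
  have := L2_boundedD (hF n) hN; rewrite (_ : 2 * C + 2 * C = 4 * C) //; ring.
have e20 : 0 < e / 2 by rewrite divr_gt0.
have [N hN] := @weak_cvg0 (fun n w => normc (F n w - G w)) (fun w => normc (k w)) (4 * C)
  (fun n => cmeas_normc (hB n).1) (cmeas_normc hk.1) (fun n w => normc_ge0 _) cv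
  (fun n => (hB n).2) (L2_bounded_integrable hk) _ e20.
exists N => n /hN le1; rewrite -cintB //; last 2 first.
- exact: L2_prod_integrable (hF n) hk.
- exact: L2_prod_integrable hG hk.
rewrite (@eq_cint _ _ _ (fun w => (F n w - G w) * k w)); last by move=> w _; ring.
apply: (le_trans (normc_cint_le _ (L2_prod_integrable (hB n) hk))) => //.
under eq_Rintegral do rewrite normcM.
lra.
Qed.
End SquareIntegrable.

(** * Cauchy's formula: truncated, on a full line, on the axis *)

Section CauchyFormula.
Variable R : realType.
Notation mu := (@lebesgue_measure R).
Implicit Types (x y X Y c d u w e m : R) (p z : R[i]).

Lemma cderiv_local (f g : R[i] -> R[i]) z l (r : R) : 0 < r ->
  (forall h, normc h < r -> f (z + h) = g (z + h)) -> cderiv f z l -> cderiv g z l.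
Proof.
move=> r0 fg hf e e0; have [dl dl0 hd] := hf e e0.
exists (Num.min dl r); first by rewrite lt_min dl0.
move=> h; rewrite lt_min => /andP[h1 h2]; rewrite -fg //.
have := fg 0; rewrite addr0 ComplexField.Normc.normc0 => /(_ r0) <-.
exact: hd.
Qed.

Lemma difference_quotient_holo (f : R[i] -> R[i]) p l z : z != p -> holo_at f z ->
  holo_at (fun z => if z == p then l else (f z - f p) * (z - p)^-1) z.
Proof.
move=> zp [k hk].
have h1 := cderivM (cderivD hk (cderiv_cst (- f p) z)) (cderiv_invB zp).
eexists; apply: (cderiv_local (r := normc (z - p))) h1.
  by rewrite normc_gt0 subr_eq0.
move=> h hr; case: eqP => // E; move: hr; rewrite -E opprD addNKr.
by rewrite normcN ltxx.
Qed.

Lemma difference_quotient_continuous (f : R[i] -> R[i]) p l : cderiv f p l ->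
  ccontinuous_at (fun z => if z == p then l else (f z - f p) * (z - p)^-1) p.
Proof.
move=> hf e e0; have e20 : 0 < e / 2 by rewrite divr_gt0.
have [dl dl0 hd] := hf _ e20; exists dl => // h hh; rewrite eqxx.
case: eqP => [_|/eqP E]; first by rewrite subrr ComplexField.Normc.normc0.
have h0 : h != 0 by apply: contra E => /eqP ->; rewrite addr0.
rewrite (_ : p + h - p = h); last by ring.
rewrite (_ : _ - _ = (f (p + h) - f p - l * h) / h); last by field.
rewrite normcM normcV ltr_pdivrMr ?normc_gt0 //.
apply: (le_lt_trans (hd _ hh)); rewrite ltr_pM2r ?normc_gt0 //; lra.
Qed.

Lemma kernel_shift p x w : (x +i w) - p = (x - Re p) +i (w - Im p).
Proof. by case: p. Qed.

Section Line.
Variables (f : R[i] -> R[i]) (K : R).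
Hypothesis holo_f : forall z, 0 < Re z -> holo_at f z.
Hypothesis line_f : forall x, 0 < x ->
  (\int[mu]_w (normc (f (x +i w)) ^+ 2)%:E <= K%:E)%E.

Let K0 : 0 <= K := line_bound_ge0 line_f.

(** At distance [A] to the right of [p] the squared kernel has integral at most pi / A. Choosing
    [dl] first and then [A] makes both terms of [line_pairing_bound] at most e / 4, whatever the
    window. *)
Lemma far_line_bound p e : 0 < Re p -> 0 < e -> exists2 X, Re p < X &
  forall Y, 0 < Y -> normc (cint `[Im p - Y, Im p + Y]
    (fun w => f (X +i w) * ((X +i w) - p)^-1)) <= e.
Proof.
move=> p0 e0; have D0 : 0 < 4 * (K + 1) by rewrite mulr_gt0 // ltr_wpDl.
have [dl dl0 dlE] : exists2 dl, 0 < dl & dl = e / (4 * (K + 1)).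
  by exists (e / (4 * (K + 1))); rewrite // divr_gt0.
have [A A0 AE] : exists2 A, 0 < A & A = 4 * pi / (e * dl).
  exists (4 * pi / (e * dl)) => //.
  by apply: divr_gt0; apply: mulr_gt0 => //; exact: pi_gt0.
exists (Re p + A) => [|Y Y0]; first by rewrite ltrDl.
have eA : Re p + A - Re p = A by ring.
rewrite (@eq_cint _ _ _ (fun w => f ((Re p + A) +i w) * (A +i (w - Im p))^-1)); last first.
  by move=> w _; rewrite kernel_shift eA.
have An0 : A != 0 by rewrite gt_eqF.
have := @line_pairing_bound _ f K holo_f line_f (fun w => (A +i (w - Im p))^-1)
  (Re p + A) (Im p - Y) (Im p + Y) (pi / `|A|) dl.
move=> /(_ _ _ _ dl0) h; apply: le_trans (h _ _ _) _.
- by rewrite addr_gt0.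
- by move=> w _; exact: kernel_continuous.
- exact: kernel_sqr_bound.
rewrite gtr0_norm // (_ : pi / A / dl = e / 4); last first.
  have pn : pi != 0 :> R by rewrite gt_eqF ?pi_gt0.
  have [en dn] : e != 0 /\ dl != 0 by rewrite !gt_eqF.
  by rewrite AE; clear AE; move: (@pi R) pn => P pn; field; rewrite pn en dn.
have : dl * K <= e / 4.
  rewrite dlE mulrAC ler_pdivrMr //; nra.
lra.
Qed.

(* Cauchy's theorem for (f z - f p) / (z - p) on a rectangle around [p] whose
   right-hand and horizontal sides contribute little. *)
Lemma line_cauchy_truncated p x e : 0 < x -> x < Re p -> 0 < e ->
  exists2 Y0, 0 < Y0 & forall Y, Y0 <= Y ->
    normc (cint `[Im p - Y, Im p + Y] (fun w => f (x +i w) * (p - (x +i w))^-1)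
      - ((2 * pi) +i 0) * f p) <= e.
Proof.
move=> x0 xp e0; set m := Im p; have p0 : 0 < Re p by exact: lt_trans xp.
have [l hl] := holo_f p0.
have e20 : 0 < e / 2 by rewrite divr_gt0.
have [X pX hX] := far_line_bound p0 e20.
have xX : x < X by exact: lt_trans pX.
have e160 : 0 < e / 16 by rewrite divr_gt0.
have [Y1 Y10 hY1] := horizontal_vanish holo_f line_f p x0 xX e160.
set F := normc (f p); have F0 : 0 <= F by exact: normc_ge0.
(* The arctangent errors receive e / 8 in total and, through [Y4], the horizontal kernel integrals e
   / 16. With e / 8 for the horizontal sides of [f] and e / 2 for the far side, the sum stays below
   [e]. *)
pose e' := e / (16 * (F + 1)).
have e'0 : 0 < e' by rewrite divr_gt0 // mulr_gt0 // ltr_wpDl.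
have [AX0 Ax0] : 0 < X - Re p /\ 0 < Re p - x by rewrite !subr_gt0.
have [Y2 Y20 hY2] := cvg_atan_scaled AX0 e'0.
have [Y3 Y30 hY3] := cvg_atan_scaled Ax0 e'0.
pose Y4 := 64 * F * (X - x) / e + 1.
have Y40 : 0 < Y4.
  by rewrite ltr_wpDl // divr_ge0 ?(ltW e0) // mulr_ge0 ?mulr_ge0 // subr_ge0 ltW.
exists (Num.max (Num.max Y1 Y2) (Num.max Y3 Y4)).
  by rewrite !lt_max Y10.
move=> Y; rewrite !ge_max => /andP[/andP[q1 q2] /andP[q3 q4]].
have Y0 : 0 < Y by exact: lt_le_trans q1.
have mY : m - Y <= m + Y by lra.
pose k z : R[i] := (z - p)^-1.
pose g z := if z == p then l else (f z - f p) * k z.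
have pos z : x <= Re z -> 0 < Re z by exact: lt_le_trans.
have R0 : rint g x X (m - Y) (m + Y) = 0.
  apply: (@rint_removable _ g p).
  - by rewrite xp.
  - by rewrite /m; apply/andP; split; lra.
  - move=> u v /andP[xu _] _; have [->|zp] := eqVneq (u +i v) p.
      exact: difference_quotient_continuous.
    by apply/holo_at_continuous/difference_quotient_holo => //; exact/holo_f/pos.
  - move=> u v /andP[xu _] _ zp; apply: difference_quotient_holo => //.
    exact/holo_f/pos.
have gv a w : a != Re p -> g (a +i w) = f (a +i w) * k (a +i w) - f p * k (a +i w).
  move=> ap; rewrite /g; case: eqP => [E|_]; first by rewrite -E eqxx in ap.
  by rewrite mulrBl.
have gh u v : v != m -> g (u +i v) = f (u +i v) * k (u +i v) - f p * k (u +i v).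
  move=> ap; rewrite /g; case: eqP => [E|_]; first by rewrite /m -E eqxx in ap.
  by rewrite mulrBl.
have ck z : z != p -> ccontinuous_at k z.
  by move=> zp; apply: holo_at_continuous; eexists; exact: cderiv_invB.
have ckv a w : a != Re p -> ccont (fun w => k (a +i w)) w.
  by move=> ap; apply/ccont_vertical/ck; apply: contra ap => /eqP <-.
have ckh u v : v != m -> ccont (fun u => k (u +i v)) u.
  by move=> ap; apply/ccont_horizontal/ck; apply: contra ap => /eqP E; rewrite /m -E.
have iv a : 0 < a -> a != Re p ->
    cintegrable `[m - Y, m + Y] (fun w => f (a +i w) * k (a +i w)) /\
    cintegrable `[m - Y, m + Y] (fun w => f p * k (a +i w)).
  move=> a0 ap; split; apply: ccont_integrable => w _; apply: ccontM.
  - exact: line_ccont.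
  - exact: ckv.
  - exact: ccont_cst.
  - exact: ckv.
have ih v : v != m ->
    cintegrable `[x, X] (fun u => f (u +i v) * k (u +i v)) /\
    cintegrable `[x, X] (fun u => f p * k (u +i v)).
  move=> vm; split; apply: ccont_integrable => u /andP[xu _]; apply: ccontM.
  - by apply: horizontal_ccont => //; exact: lt_le_trans xu.
  - exact: ckh.
  - exact: ccont_cst.
  - exact: ckh.
have ik a : a != Re p -> cintegrable `[m - Y, m + Y] (fun w => k (a +i w)).
  by move=> ap; apply: ccont_integrable => w _; exact: ckv.
have ikh v : v != m -> cintegrable `[x, X] (fun u => k (u +i v)).
  by move=> ap; apply: ccont_integrable => w _; exact: ckh.
have Vx a : a != Re p -> 0 < a ->
    cint `[m - Y, m + Y] (fun w => g (a +i w)) =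
    cint `[m - Y, m + Y] (fun w => f (a +i w) * k (a +i w)) -
    f p * ((2 * atan (Y / (a - Re p))) +i 0).
  move=> ap a0; have [i1 i2] := iv a a0 ap.
  rewrite (eq_cint (fun w _ => gv a w ap)) cintB // cintZ //; last exact: ik.
  congr (_ - _ * _); rewrite -(@cint_kernel _ _ m) //; last by rewrite subr_eq0.
  by apply: eq_cint => w _; rewrite /k kernel_shift.
have Hv v : v != m -> cint `[x, X] (fun u => g (u +i v)) =
    cint `[x, X] (fun u => f (u +i v) * k (u +i v)) -
    f p * cint `[x, X] (fun u => k (u +i v)).
  move=> vm; have [i1 i2] := ih v vm.
  by rewrite (eq_cint (fun w _ => gh w v vm)) cintB // cintZ //; exact: ikh.
have [Xp xnp] : X != Re p /\ x != Re p by rewrite !neq_lt pX xp orbT.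
have [mm mp] : m - Y != m /\ m + Y != m.
  by rewrite !neq_lt; split; apply/orP; [left|right]; lra.
have ig_v a : 0 < a -> a != Re p -> cintegrable `[m - Y, m + Y] (fun w => g (a +i w)).
  move=> a0 ap; have [i1 i2] := iv a a0 ap.
  by apply: eq_cintegrable (cintegrableB _ i1 i2) => // w _; rewrite gv.
have ig_h v : v != m -> cintegrable `[x, X] (fun u => g (u +i v)).
  move=> vm; have [i1 i2] := ih v vm.
  by apply: eq_cintegrable (cintegrableB _ i1 i2) => // w _; rewrite gh.
have X0 : 0 < X by exact: lt_trans xX.
move: R0; rewrite /rint cintB ?cintB //; try exact: ig_v; try exact: ig_h.
rewrite !Vx // !Hv //.
set H1 := cint _ (fun u => f (u +i (m - Y)) * _).
set H2 := cint _ (fun u => f (u +i (m + Y)) * _).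
set k1 := cint _ (fun u => k (u +i (m - Y))).
set k2 := cint _ (fun u => k (u +i (m + Y))).
set V1 := cint _ (fun w => f (X +i w) * _).
set V2 := cint _ (fun w => f (x +i w) * k (x +i w)).
set s1 := 2 * atan _; set s2 := 2 * atan _ => E.
have hk v : `|v - m| = Y -> normc (cint `[x, X] (fun u => k (u +i v))) <= 2 * (Y^-1 * (X - x)).
  move=> hv; have vm : v != m by rewrite -subr_eq0 -normr_gt0 hv.
  apply: normc_cint_bound; first exact: ltW.
    by move=> u _; exact: ckh.
  by move=> u _; rewrite -hv; exact: kernel_horizontal_le.
have n1 : `|m - Y - m| = Y by rewrite addrAC subrr add0r normrN gtr0_norm.
have n2 : `|m + Y - m| = Y by rewrite addrAC subrr add0r gtr0_norm.
have b1 : normc H1 <= e / 16 by apply: hY1; rewrite n1.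
have b2 : normc H2 <= e / 16 by apply: hY1; rewrite n2.
have b3 : normc k1 <= 2 * (Y^-1 * (X - x)) by exact: hk.
have b4 : normc k2 <= 2 * (Y^-1 * (X - x)) by exact: hk.
have b5 : normc V1 <= e / 2 by exact: hX.
have b6 : `|s1 - pi| <= e' by exact: hY2.
have b7 : `|- s2 - pi| <= e'.
  have := hY3 _ q3; rewrite /s2 -[x - Re p]opprB invrN mulrN atanN mulrN opprK.
  by [].
have -> : cint `[m - Y, m + Y] (fun w => f (x +i w) * (p - (x +i w))^-1) = - V2.
  have [i1 _] := iv x x0 xnp; rewrite -cintN //; apply: eq_cint => w _.
  by rewrite /k -[p - _]opprB invrN mulrN.
(* The constant [f p] enters through both vertical sides: s1 tends to pi on the right and s2 to - pi
   on the left, and their difference is the 2 pi of the formula. The identity is the vanishing of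
   the boundary integral multiplied by i. *)
have -> : - V2 - ((2 * pi) +i 0) * f p =
    f p * (((s1 - pi) +i 0) + ((- s2 - pi) +i 0)) - V1
    + 'i%C * (H1 - f p * k1 - (H2 - f p * k2)).
  have c1 : (s1 - pi) +i 0 = (s1 +i 0) - (pi +i 0) :> R[i].
    by rewrite /GRing.opp /GRing.add /= oppr0 addr0.
  have c2 : (- s2 - pi) +i 0 = - (s2 +i 0) - (pi +i 0) :> R[i].
    by rewrite /GRing.opp /GRing.add /= oppr0 addr0.
  have c3 : (2 * pi) +i 0 = (pi +i 0) + (pi +i 0) :> R[i].
    by rewrite /GRing.add /= addr0 mulr2n mulrDl mul1r.
  rewrite c1 c2 c3.
  have ii : 'i%C * 'i%C = -1 :> R[i] by rewrite -expr2 sqr_i.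
  move/eqP: E; rewrite addr_eq0 => /eqP ->.
  by rewrite mulrN mulrA ii; ring.
apply: (le_trans (normcD _ _)); rewrite [normc ('i%C * _)]normcM normcI normr1 mul1r.
have t1 : normc (f p * (((s1 - pi) +i 0) + ((- s2 - pi) +i 0)) - V1) <=
    F * (e' + e') + e / 2.
  apply: (le_trans (normcB_le _ _)); apply: lerD => //.
  rewrite normcM ler_wpM2l //; apply: (le_trans (normcD _ _)).
  by rewrite !normcR; exact: lerD.
have t2 : normc (H1 - f p * k1 - (H2 - f p * k2)) <=
    e / 16 + F * (2 * (Y^-1 * (X - x))) + (e / 16 + F * (2 * (Y^-1 * (X - x)))).
  apply: (le_trans (normcB_le _ _)); apply: lerD;
    apply: (le_trans (normcB_le _ _)); apply: lerD => //; rewrite normcM ler_wpM2l //.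
have t3 : F * (e' + e') <= e / 8.
  have : e' * (16 * (F + 1)) = e.
    by rewrite /e' divfK // gt_eqF // mulr_gt0 // ltr_wpDl.
  lra.
have t4 : F * (Y^-1 * (X - x)) <= e / 64.
  rewrite mulrCA mulrC ler_pdivrMr //.
  have : 64 * F * (X - x) / e <= Y by apply: le_trans q4; rewrite lerDl.
  rewrite ler_pdivrMr //; lra.
lra.
Qed.

Lemma line_L2 x : 0 < x -> L2_bounded (fun w => f (x +i w)) K.
Proof.
move=> x0; split; last exact: line_f.
by apply: cmeas_ccont => w; exact: line_ccont.
Qed.

End Line.

(** The half-width is positive even for [n = 0], as [kernel_sqr_bound] requires. *)
Definition window m (n : nat) : set R := `[m - n.+1%:R, m + n.+1%:R].

Lemma window_cvg (g : R -> R[i]) m w :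
  normc (g w * ((\1_(window m n) w) +i 0) - g w) @[n --> \oo] --> 0.
Proof.
apply/cvgrPdist_lt => e e0; exists (Num.truncn `|w - m|) => // n /= hn.
have : `|w - m| <= n.+1%:R.
  apply/ltW; apply: lt_le_trans (truncnS_gt _) _; first by rewrite ler_nat ltnS.
rewrite ler_norml => /andP[h1 h2].
have -> : \1_(window m n) w = 1 :> R.
  by rewrite indicE mem_set //= /window /= in_itv /=; apply/andP; split; lra.
by rewrite mulr1 subrr ComplexField.Normc.normc0 subrr normr0.
Qed.

Lemma cmeas_indic (D : set (measurableTypeR R)) : measurable D ->
  cmeas (fun w => (\1_D w) +i 0).
Proof. by move=> mD; split; [exact: measurable_indic|exact: measurable_cst]. Qed.

Lemma cint_indic (D : set (measurableTypeR R)) (g : R -> R[i]) :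
  cint setT (fun w => g w * ((\1_D w) +i 0)) = cint D g.
Proof.
rewrite /cint [in RHS]Rintegral_mkcond [X in _ = _ +i X]Rintegral_mkcond.
congr (_ +i _); apply: eq_Rintegral => w _; rewrite patchE indicE.
- by case: (g w) => a b; case: (w \in D) => /=; rewrite ?mulr1 ?mulr0 ?subr0.
- by case: (g w) => a b; case: (w \in D) => /=; rewrite ?mulr1 ?mulr0 ?add0r.
Qed.

(** Truncations to windows satisfy the bound uniformly and converge pointwise, so [L2_limit] passes
    to the whole line. *)
Lemma kernel_L2 (A m : R) : A != 0 ->
  L2_bounded (fun w => (A +i (w - m))^-1) (pi / `|A|).
Proof.
move=> A0; pose k w := (A +i (w - m))^-1.
have mk : cmeas k by apply: cmeas_ccont => w; exact: kernel_continuous.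
apply: (@L2_limit _ (fun n w => k w * ((\1_(window m n) w) +i 0))) => //; last first.
  exact: (aeW mu (fun w => window_cvg k m w)).
move=> n; split.
  by apply: cmeasM => //; apply: cmeas_indic; exact: measurable_itv.
have -> : (\int[mu]_w (normc (k w * ((\1_(window m n) w) +i 0)) ^+ 2)%:E =
    \int[mu]_(w in window m n) (normc (k w) ^+ 2)%:E)%E.
  rewrite [RHS]integral_mkcond; apply: eq_integral => w _.
  rewrite patchE indicE normcM normcR; case: (w \in _).
    by rewrite normr1 mulr1.
  by rewrite normr0 mulr0 expr0n.
have i : mu.-integrable `[m - n.+1%:R, m + n.+1%:R]
    (EFin \o (fun w => normc (k w) ^+ 2)).
  by apply: ccont_normc_integrable => w _; exact: kernel_continuous.
have := kernel_sqr_bound m A0 (ltr0Sn R n).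
by rewrite -lee_fin /Rintegral fineK //; exact: integrable_fin_num.
Qed.

Section Boundary.
Variables (f : R[i] -> R[i]) (K : R).
Hypothesis holo_f : forall z, 0 < Re z -> holo_at f z.
Hypothesis line_f : forall x, 0 < x ->
  (\int[mu]_w (normc (f (x +i w)) ^+ 2)%:E <= K%:E)%E.

Lemma line_kernel_L2 p x : x < Re p ->
  L2_bounded (fun w => (p - (x +i w))^-1) (pi / (Re p - x)).
Proof.
move=> xp; have A0 : x - Re p != 0 by rewrite subr_eq0 lt_eqF.
have h := kernel_L2 (Im p) A0.
have mk : cmeas (fun w => (p - (x +i w))^-1).
  have := cmeasN h.1; congr cmeas; apply/funext => w.
  by rewrite -kernel_shift -[p - _]opprB invrN.
have := L2_bounded_le h mk (@ler01 R) _.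
rewrite expr1n mul1r distrC ger0_norm ?subr_ge0 ?(ltW xp) //; apply => w.
by rewrite mul1r -kernel_shift -[p - _]opprB invrN normcN.
Qed.

(** The truncated integrals tend to the full one by weak convergence of [f] times the window
    indicator, and to the value on the right by [line_cauchy_truncated]. *)
Lemma line_cauchy p x : 0 < x -> x < Re p ->
  cint setT (fun w => f (x +i w) * (p - (x +i w))^-1) = ((2 * pi) +i 0) * f p.
Proof.
move=> x0 xp; apply/eqP; rewrite -subr_eq0 -normc_eq0 eq_le normc_ge0 andbT.
apply/ler_addgt0Pr => e e0; rewrite add0r.
have e20 : 0 < e / 2 by rewrite divr_gt0.
have [Y0 _ hY] := line_cauchy_truncated holo_f line_f x0 xp e20.
have hL := line_L2 holo_f line_f x0.
pose F n w := f (x +i w) * ((\1_(window (Im p) n) w) +i 0).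
have hF n : L2_bounded (F n) K.
  have mF : cmeas (F n).
    by apply: cmeasM hL.1 _; apply: cmeas_indic; exact: measurable_itv.
  have := L2_bounded_le hL mF (@ler01 R); rewrite expr1n mul1r; apply => w.
  rewrite mul1r normcM normcR indicE; case: (w \in _).
    by rewrite normr1 mulr1.
  by rewrite normr0 mulr0 normc_ge0.
have [N hN] := cint_weak_cvg hF hL.1
  (aeW mu (fun w => window_cvg (fun w => f (x +i w)) (Im p) w))
  (line_kernel_L2 xp) e20.
pose n := maxn N (Num.truncn Y0).
have := hN n (leq_maxl _ _); have := hY n.+1%:R.
have -> : Y0 <= n.+1%:R.
  apply/ltW; apply: lt_le_trans (truncnS_gt _) _.
  by rewrite ler_nat ltnS leq_maxr.
move=> /(_ isT) h1.
rewrite (@eq_cint _ _ _ (fun w => f (x +i w) * (p - (x +i w))^-1 *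
  ((\1_(window (Im p) n) w) +i 0))); last by move=> w _; rewrite /F; ring.
rewrite cint_indic => h2.
set I := cint setT _ in h2 *; set J := cint _ _ in h1 h2.
rewrite (_ : _ - _ = (J - ((2 * pi) +i 0) * f p) - (J - I)); last by ring.
apply: (le_trans (normcB_le _ _)); lra.
Qed.

(** A sequence of lines is enough for Fatou's lemma. [b] stands for a measurable version of the
    boundary values, reached only almost everywhere. *)
Definition boundary_data (b : R -> R[i]) : Prop := cmeas b /\
  {ae mu, forall w, normc (f (n.+1%:R^-1 +i w) - b w) @[n --> \oo] --> 0}.

Variable b : R -> R[i].
Hypothesis hb : boundary_data b.

Lemma boundary_L2 : L2_bounded b K.
Proof.
case: hb => mb cv; apply: (L2_limit _ mb cv) => n; exact: line_L2.
Qed.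

(** In [line_cauchy] the function and the kernel both depend on the line. The ratio [rho] of the
    line kernel to the axis kernel is moved onto [f], so that weak convergence is tested against one
    fixed kernel. *)
Lemma boundary_cauchy p : 0 < Re p ->
  cint setT (fun w => b w * (p - (0 +i w))^-1) = ((2 * pi) +i 0) * f p.
Proof.
move=> p0; pose x n : R := n.+1%:R^-1.
have x0 n : 0 < x n by rewrite invr_gt0.
have [N0 hN0] : exists N, forall n, (N <= n)%N -> x n < Re p / 2.
  exists (Num.truncn (2 / Re p)) => n hn.
  rewrite /x -[ltRHS]invrK ltf_pV2 ?posrE ?invr_gt0 ?divr_gt0 // invf_div.
  by apply: lt_le_trans (truncnS_gt _) _; rewrite ler_nat ltnS.
(* The shift keeps the lines to the left of Re p / 2, where |rho| <= 2. *)
pose y n := x (n + N0)%N.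
have y0 n : 0 < y n by exact: x0.
have yp n : y n < Re p / 2 by apply: hN0; rewrite leq_addl.
have yp' n : y n < Re p by have := yp n; lra.
have k0 n w : p - (y n +i w) != 0.
  by rewrite subr_eq0; apply/eqP => E; have := yp' n; rewrite E ltxx.
have k00 w : p - (0 +i w) != 0.
  by rewrite subr_eq0; apply/eqP => E; move: p0; rewrite E ltxx.
pose rho n w := (p - (0 +i w)) / (p - (y n +i w)).
have rhoE n w : rho n w = 1 + (y n +i 0) / (p - (y n +i w)).
  rewrite /rho (_ : p - (0 +i w) = (p - (y n +i w)) + (y n +i 0)).
    by rewrite mulrDl mulfV.
  by case: (p) => a c; rewrite /GRing.opp /GRing.add /= subr0 addr0 subrK.
have knorm n w : Re p / 2 <= normc (p - (y n +i w)).
  apply: le_trans (Re_le_normc _); rewrite (_ : Re (p - _) = Re p - y n).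
    by apply: le_trans (ler_norm _); have := yp n; lra.
  by case: (p).
have rho2 n w : normc (rho n w) <= 2.
  rewrite rhoE; apply: (le_trans (normcD _ _)).
  rewrite ComplexField.Normc.normc1 normcM normcV normcR gtr0_norm //.
  rewrite (_ : 2 = 1 + 1 :> R) // lerD2l ler_pdivrMr ?normc_gt0 // mul1r.
  by apply: le_trans (knorm n w); exact/ltW/yp.
pose F n w := f (y n +i w) * rho n w.
have hF n : L2_bounded (F n) (2 ^+ 2 * K).
  apply: (L2_bounded_le (line_L2 holo_f line_f (y0 n))) => //.
    apply: cmeasM; first by case: (line_L2 holo_f line_f (y0 n)).
    have -> : rho n = (fun w => 1 + (y n +i 0) * (p - (y n +i w))^-1).
      by apply/funext => w; exact: rhoE.
    apply: cmeasD; first exact: cmeas_cst.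
    apply: cmeasM; first exact: cmeas_cst.
    by case: (line_kernel_L2 (yp' n)).
  by move=> w; rewrite normcM mulrC ler_wpM2r ?normc_ge0.
have [mb cv] := hb.
have cF : {ae mu, forall w, normc (F n w - b w) @[n --> \oo] --> 0}.
  move: cv; apply: (@filterS _ _ (ae_filter_ringOfSetsType mu)) => w hw.
  apply/cvgrPdist_lt => e e0.
  pose B := normc (b w); have B0 : 0 <= B by exact: normc_ge0.
  have D0 : 0 < 4 * (B + 1) / Re p by rewrite divr_gt0 // mulr_gt0 // ltr_wpDl.
  move/cvgrPdist_lt : hw => /(_ (e / 4)); rewrite divr_gt0 // => /(_ isT) [N1 _ hN1].
  exists (maxn N1 (Num.truncn (4 * (B + 1) / Re p / e))) => // n /=.
  rewrite geq_max => /andP[n1 n2].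
  have {}hN1 : normc (f (y n +i w) - b w) < e / 4.
    have := hN1 (n + N0)%N; rewrite /= sub0r normrN (ger0_norm (normc_ge0 _)).
    by apply; exact: leq_trans (leq_addr _ _).
  rewrite sub0r normrN (ger0_norm (normc_ge0 _)).
  rewrite /F (_ : _ - _ = rho n w * (f (y n +i w) - b w) + b w * (rho n w - 1)); last by ring.
  apply: (le_lt_trans (normcD _ _)).
  rewrite (normcM (rho n w)) (normcM (b w)) -/B.
  have r1 : normc (rho n w) * normc (f (y n +i w) - b w) <= 2 * (e / 4).
    by apply: ler_pM; rewrite ?normc_ge0 // ltW.
  have r2 : normc (rho n w - 1) <= y n * (2 / Re p).
    rewrite rhoE addrC addKr normcM normcV normcR gtr0_norm // ler_pM2l //.
    by rewrite -[leRHS]invrK invf_div lef_pV2 ?posrE ?divr_gt0 ?normc_gt0.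
  have r3 : y n * (4 * (B + 1) / Re p) < e.
    have : 4 * (B + 1) / Re p / e < (n + N0).+1%:R.
      apply: lt_le_trans (truncnS_gt _) _; rewrite ler_nat ltnS.
      exact: leq_trans (leq_addr _ _).
    rewrite ltr_pdivrMr // => h; rewrite /y /x mulrC ltr_pdivrMr // mulrC.
    by rewrite mulrC [ltRHS]mulrC.
  have r4 : B * normc (rho n w - 1) <= B * (y n * (2 / Re p)) by rewrite ler_wpM2l.
  have r5 : 2 * (B * (y n * (2 / Re p))) <= y n * (4 * (B + 1) / Re p).
    rewrite (_ : y n * (4 * (B + 1) / Re p) =
      2 * (B * (y n * (2 / Re p))) + y n * (4 / Re p)).
      by rewrite lerDl mulr_ge0 ?divr_ge0 // ltW.
    by field; rewrite gt_eqF.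
  apply: (le_lt_trans (lerD r1 r4)); move: r3 r5.
  move: (y n * (4 * (B + 1) / Re p)) (B * (y n * (2 / Re p))) => T1 T2; lra.
have kL : L2_bounded (fun w => (p - (0 +i w))^-1) (pi / (Re p - 0)).
  exact: line_kernel_L2.
apply/eqP; rewrite -subr_eq0 -normc_eq0 eq_le normc_ge0 andbT.
apply/ler_addgt0Pr => e e0; rewrite add0r.
have [N hN] := cint_weak_cvg hF mb cF kL e0.
have := hN N (leqnn N).
rewrite (@eq_cint _ _ _ (fun w => f (y N +i w) * (p - (y N +i w))^-1)); last first.
  by move=> w _; rewrite /F /rho; field; rewrite k0 k00.
by rewrite line_cauchy // normc_distrC.
Qed.

End Boundary.
End CauchyFormula.

(** * Hardy functions *)

Section Bridge.
Import HBNNSimple.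
Variable R : realType.
Notation mu := (@lebesgue_measure R).

Lemma normr_normc (z : R[i]) : `|z| = (normc z) +i 0.
Proof. by []. Qed.

Lemma ltr_complexR (x y : R) : ((x +i 0) < (y +i 0) :> R[i]) = (x < y).
Proof. by rewrite ltcE /= eqxx. Qed.

Lemma complex_gt0P (e : R[i]) : 0 < e -> exists2 r : R, 0 < r & e = r +i 0.
Proof.
by case: e => a b; rewrite ltcE /= => /andP[/eqP -> a0]; exists a.
Qed.

Lemma cvg_normcP (T : Type) (F : set_system T) (FF : Filter F) (f : T -> R[i]) l :
  (f x @[x --> F] --> l) <->
  (forall e : R, 0 < e -> \forall x \near F, normc (f x - l) < e).
Proof.
split.
- move=> /cvgrPdist_lt h e e0; have := h (e +i 0); rewrite ltr_complexR => /(_ e0).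
  by apply: filterS => x; rewrite normr_normc ltr_complexR normc_distrC.
- move=> h; apply/cvgrPdist_lt => e /complex_gt0P[r r0 ->].
  apply: filterS (h r r0) => x.
  by rewrite normr_normc ltr_complexR normc_distrC.
Qed.

Lemma cvg_mxP (T : Type) (F : set_system T) (FF : Filter F) (m n : nat)
    (f : T -> 'M[R[i]]_(m, n)) (L : 'M[R[i]]_(m, n)) :
  (f x @[x --> F] --> L) <->
  (forall e : R, 0 < e -> \forall x \near F, forall i j, normc (f x i j - L i j) < e).
Proof.
have ballE (z w : R[i]) (e : R) : ball z (e +i 0) w <-> normc (w - z) < e.
  by rewrite -ball_normE /= normr_normc ltr_complexR normc_distrC.
split.
- move=> /cvg_ballP h e e0; have := h (e +i 0); rewrite ltr_complexR => /(_ e0).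
  by apply: filterS => x [_ hx] i j; apply/ballE; exact: hx.
- move=> h; apply/cvg_ballP => e e0; have [r r0 E] := complex_gt0P e0.
  apply: filterS (h r r0) => x hx; split => // i j.
  by rewrite E; apply/ballE; exact: hx.
Qed.

Lemma dnbhs_complexP (P : R[i] -> Prop) :
  (\forall h \near (0 : R[i])^', P h) <->
  (exists2 d : R, 0 < d & forall h, normc h < d -> h != 0 -> P h).
Proof.
split.
- move=> /nbhs_ballP[e /= /complex_gt0P[d d0 ->] hd]; exists d => // h hh h0.
  apply: hd => //; rewrite -ball_normE /= sub0r normrN normr_normc.
  by rewrite ltr_complexR.
- move=> [d d0 hd]; apply/nbhs_ballP; exists (d +i 0); first by rewrite /= ltr_complexR.
  move=> h; rewrite -ball_normE /= sub0r normrN normr_normc ltr_complexR => hh h0.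
  exact: hd.
Qed.

(** Bridge between the normed-module derivative of matrix functions and the entrywise epsilon-delta
    calculus of the proof. *)
Lemma derivable_entryP (n : nat) (F : R[i] -> 'M[R[i]]_n) (z : R[i]) (L : 'M[R[i]]_n) :
  (h^-1 *: (F (h *: (1 : R[i]) + z) - F z) @[h --> 0^'] --> L) <->
  (forall i j, cderiv (fun w => F w i j) z (L i j)).
Proof.
have E (h : R[i]) i j : h != 0 ->
    normc ((h^-1 *: (F (h *: (1 : R[i]) + z) - F z)) i j - L i j) =
    normc (F (z + h) i j - F z i j - L i j * h) / normc h.
  move=> h0; rewrite !mxE -normcV -normcM; congr normc.
  by rewrite [h *: _]mulr1 [h + z]addrC; field.
split.
- move=> /cvg_mxP hc i j e e0.
  have /dnbhs_complexP[d d0 hd] := hc e e0; exists d => // h hh.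
  have [->|h0] := eqVneq h 0.
    by rewrite addr0 subrr mulr0 subrr ComplexField.Normc.normc0 mulr0.
  have := hd h hh h0 i j; rewrite E // ltr_pdivrMr ?normc_gt0 // => /ltW.
  by [].
- move=> hc; apply/cvg_mxP => e e0; apply/dnbhs_complexP.
  have e20 : 0 < e / 2 by rewrite divr_gt0.
  have hd (ij : 'I_n * 'I_n) : exists d : R, 0 < d /\ forall h, normc h < d ->
      normc (F (z + h) ij.1 ij.2 - F z ij.1 ij.2 - L ij.1 ij.2 * h) <= e / 2 * normc h.
    by have [d d0 hd] := hc ij.1 ij.2 _ e20; exists d.
  pose dl ij := sval (cid (hd ij)).
  have dl0 ij : 0 < dl ij by rewrite /dl; case: cid => ? [].
  have dlh ij : forall h, normc h < dl ij ->
      normc (F (z + h) ij.1 ij.2 - F z ij.1 ij.2 - L ij.1 ij.2 * h) <= e / 2 * normc h.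
    by rewrite /dl; case: cid => ? [].
  exists (\big[Num.min/1]_ij dl ij).
    by elim/big_ind : _ => // x y x0 y0; rewrite lt_min x0.
  move=> h hh h0 i j; rewrite E // ltr_pdivrMr ?normc_gt0 //.
  apply: (@le_lt_trans _ _ (e / 2 * normc h)).
    by apply: (dlh (i, j)); apply: lt_le_trans hh _; exact: bigmin_le_cond.
  rewrite ltr_pM2r ?normc_gt0 //; lra.
Qed.

Lemma derivable_cderiv (n : nat) (F : R[i] -> 'M[R[i]]_n) (z : R[i]) :
  derivable F z 1 -> forall i j, cderiv (fun w => F w i j) z (derive1 F z i j).
Proof. by move=> dF; apply/derivable_entryP; rewrite derive1E; exact: dF. Qed.

Lemma cderiv_derive1 (n : nat) (F : R[i] -> 'M[R[i]]_n) (z : R[i]) (L : 'M[R[i]]_n) :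
  (forall i j, cderiv (fun w => F w i j) z (L i j)) -> derive1 F z = L.
Proof.
move=> /derivable_entryP h; rewrite derive1E; apply: cvg_lim h.
exact: norm_hausdorff.
Qed.

Lemma frobenius_sqr (m n : nat) (M : 'M[R[i]]_(m, n)) :
  frobenius M ^+ 2 = \sum_i \sum_j normc (M i j) ^+ 2.
Proof.
by rewrite sqr_sqrtr // sumr_ge0 // => i _; rewrite sumr_ge0 // => j _; rewrite sqr_ge0.
Qed.

(* No measurability is required, since the integral of a nonnegative function
   is a supremum over the simple functions below it. *)
Lemma ge0_ae_le_integral (f g : R -> R) :
  (forall w, 0 <= f w) -> (forall w, 0 <= g w) ->
  {ae mu, forall w, f w <= g w} ->
  (\int[mu]_w (f w)%:E <= \int[mu]_w (g w)%:E)%E.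
Proof.
move=> f0 g0 [N [mN N0 sN]].
rewrite [leLHS]ge0_integralTE; last by move=> w; rewrite lee_fin.
apply: ge_ereal_sup => _ [h hf <-].
have mNC : measurable (~` N) by exact: measurableC.
(* Removing the null set [N] does not change the integral of the simple function, and off [N] that
   function lies below [g]. *)
rewrite -integralT_nnsfun (ge0_negligible_integral mN measurableT _ _ N0) //; last 2 first.
- by apply/measurable_EFinP; exact: (@measurable_funP _ _ _ _ setT h).
- by move=> w _; rewrite lee_fin; exact: fun_ge0.
rewrite setTD integral_nnsfun // ge0_integralTE; last by move=> w; rewrite lee_fin.
apply: ereal_sup_ubound; exists (proj_nnsfun h mNC); last by rewrite mrestrict.
move=> w; rewrite -mrestrict patchE.
case: ifPn; last by rewrite lee_fin.
rewrite inE => Nw; apply: (le_trans (hf w)); rewrite lee_fin.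
by apply: contrapT => ngf; apply: Nw; apply: sN.
Qed.

Section HardyBoundary.
Variables (n : nat) (H : R[i] -> 'M[R[i]]_n).
Hypothesis hH : hardyH2 H.

Lemma hardy_holo i j z : 0 < Re z -> holo_at (fun w => H w i j) z.
Proof. by case: hH => d _ _ _ /d /derivable_cderiv h; eexists; exact: h. Qed.

Lemma hardy_line : exists K : R, forall i j x, 0 < x ->
  (\int[mu]_w (normc (H (x +i w) i j) ^+ 2)%:E <= K%:E)%E.
Proof.
case: hH => _ [K hK] _ _; exists K => i j x x0; apply: le_trans (hK x x0).
apply: ge0_ae_le_integral => [w|w|]; rewrite ?sqr_ge0 //.
apply: aeW => w; rewrite frobenius_sqr (bigD1 i) //= (bigD1 j) //= -addrA lerDl.
by rewrite addr_ge0 // sumr_ge0 // => ? _; rewrite ?sqr_ge0 // sumr_ge0 // => ? _; rewrite sqr_ge0.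
Qed.

(** On a null set the limit may fail to exist and its value is arbitrary. Multiplying by the
    indicator of the complement of a measurable null set gives a function that is everywhere a limit
    of measurable ones. *)
Lemma hardy_boundary : exists b : 'I_n -> 'I_n -> R -> R[i],
  (forall i j, boundary_data (fun z => H z i j) (b i j)) /\
  {ae mu, forall w, has_boundary_value H w /\
     forall i j, boundary_value H w i j = b i j w}.
Proof.
case: (hH) => _ _ [N [mN N0 sN]] _.
have hN w : ~ N w -> has_boundary_value H w.
  by move=> Nw; apply: contrapT => k; apply: Nw; exact: sN.
have mNC : measurable (~` N) by exact: measurableC.
pose b i j w := boundary_value H w i j * ((\1_(~` N) w) +i 0).
have conv w i j : ~ N w ->
    H (m.+1%:R^-1 +i w) i j @[m --> \oo] --> boundary_value H w i j.
  move=> Nw; have hw := hN w Nw.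
  apply/cvg_normcP => e e0; have /cvg_mxP/(_ e e0) := hw.
  move=> [d /= d0 hd]; exists (Num.truncn d^-1) => // m /= hm; apply: hd => /=.
    rewrite sub0r normrN gtr0_norm ?invr_gt0 // -[ltRHS]invrK ltf_pV2 ?posrE ?invr_gt0 //.
    by apply: lt_le_trans (truncnS_gt _) _; rewrite ler_nat ltnS.
  by rewrite invr_gt0.
exists b; split; last first.
  exists N; split => // w /= hw; apply: contrapT => Nw; apply: hw.
  split; first exact: hN.
  by move=> i j; rewrite /b indicE mem_set // mulr1.
move=> i j; split; last first.
  exists N; split => // w /= hw; apply: contrapT => Nw; apply: hw.
  apply/cvgrPdist_lt => e e0; have /cvg_normcP/(_ e e0) := conv w i j Nw.
  apply: filterS => m; rewrite sub0r normrN (ger0_norm (normc_ge0 _)).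
  by rewrite /b indicE mem_set // mulr1.
pose F m w := H (m.+1%:R^-1 +i w) i j * ((\1_(~` N) w) +i 0).
have mF m : cmeas (F m).
  apply: cmeasM; last exact: cmeas_indic.
  apply: cmeas_ccont => w.
  apply: (line_ccont (f := fun z => H z i j)); last by rewrite invr_gt0.
  by move=> z; exact: hardy_holo.
have cF w e : 0 < e -> \forall m \near \oo, normc (F m w - b i j w) < e.
  move=> e0; have [Nw|Nw] := pselect (N w).
    near=> m; rewrite /F /b indicE (_ : w \in ~` N = false).
      by rewrite !mulr0 subrr ComplexField.Normc.normc0.
    by apply/negbTE/negP; rewrite inE.
  have /cvg_normcP/(_ e e0) := conv w i j Nw.
  apply: filterS => m.
  by rewrite /F /b indicE mem_set // !mulr1.
split.
- apply: (measurable_fun_cvg (h := fun m w => Re (F m w))) => [m|w _].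
    by case: (mF m).
  apply/cvgrPdist_lt => e e0; apply: filterS (cF w e e0) => m.
  apply: le_lt_trans; rewrite normc_distrC; apply: le_trans (Re_le_normc _).
  by case: (F m w) (b i j w) => ? ? [].
- apply: (measurable_fun_cvg (h := fun m w => Im (F m w))) => [m|w _].
    by case: (mF m).
  apply/cvgrPdist_lt => e e0; apply: filterS (cF w e e0) => m.
  apply: le_lt_trans; rewrite normc_distrC; apply: le_trans (Im_le_normc _).
  by case: (F m w) (b i j w) => ? ? [].
Unshelve. all: by end_near. Qed.

End HardyBoundary.

Lemma boundary_value_sub (n : nat) (F G : R[i] -> 'M[R[i]]_n) w :
  has_boundary_value F w ->
  (forall i j, ccontinuous_at (fun z => G z i j) (0 +i w)) ->
  boundary_value (fun z => F z - G z) w = boundary_value F w - G (0 +i w).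
Proof.
move=> hF cG; have hG : G (x +i w) @[x --> 0^'+] --> G (0 +i w).
  apply/cvg_mxP => e e0.
  have : forall i j, \forall x \near (0 : R)^'+, normc (G (x +i w) i j - G (0 +i w) i j) < e.
    move=> i j; have [d d0 hd] := cG i j e e0; exists d => //= x /=.
    rewrite sub0r normrN => hx x0; have := hd (x +i 0); rewrite normcR => /(_ hx).
    by rewrite (_ : (0 +i w) + _ = x +i w) // /GRing.add /= add0r addr0.
  by move=> h; apply: filter_forall => i; apply: filter_forall => j; exact: h.
have hF' : F (x +i w) @[x --> 0^'+] --> boundary_value F w by exact: hF.
apply: cvg_lim; first exact: norm_hausdorff.
apply/cvg_mxP => e e0; have e20 : 0 < e / 2 by rewrite divr_gt0.
move/cvg_mxP : hF' => /(_ _ e20) h1; move/cvg_mxP : hG => /(_ _ e20) h2.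
move: h1 h2; apply: filterS2 => x h1 h2 i j.
rewrite !mxE (_ : _ - _ = (F (x +i w) i j - boundary_value F w i j)
  - (G (x +i w) i j - G (0 +i w) i j)); last by ring.
apply: (le_lt_trans (normcB_le _ _)).
by have := h1 i j; have := h2 i j; lra.
Qed.

End Bridge.

(** * Perturbed port-Hamiltonian models *)

Section SumNorm.
Variable R : realType.

(** Chosen because it is submultiplicative, invariant under transposition and above every entry, so
    that no dimensional constants appear in these estimates. *)
Definition snorm m n (X : 'M[R[i]]_(m, n)) : R := \sum_i \sum_j normc (X i j).

Lemma snorm_ge0 m n (X : 'M[R[i]]_(m, n)) : 0 <= snorm X.
Proof. by rewrite sumr_ge0 // => i _; rewrite sumr_ge0 // => j _; exact: normc_ge0. Qed.

Lemma snorm_entry m n (X : 'M[R[i]]_(m, n)) i j : normc (X i j) <= snorm X.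
Proof.
rewrite /snorm (bigD1 i) //= (bigD1 j) //= -addrA lerDl addr_ge0 // sumr_ge0 // => k _.
  exact: normc_ge0.
by rewrite sumr_ge0 // => l _; exact: normc_ge0.
Qed.

Lemma snorm_eq0 m n (X : 'M[R[i]]_(m, n)) : snorm X <= 0 -> X = 0.
Proof.
move=> X0; apply/matrixP => i j; rewrite mxE; apply/eqP; rewrite -normc_eq0.
by rewrite eq_le normc_ge0 andbT; apply: le_trans (snorm_entry X i j) X0.
Qed.

Lemma snormD m n (X Y : 'M[R[i]]_(m, n)) : snorm (X + Y) <= snorm X + snorm Y.
Proof.
rewrite /snorm -big_split /=; apply: ler_sum => i _; rewrite -big_split /=.
by apply: ler_sum => j _; rewrite mxE; exact: normcD.
Qed.

Lemma snormZ m n (a : R[i]) (X : 'M[R[i]]_(m, n)) : snorm (a *: X) = normc a * snorm X.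
Proof.
rewrite /snorm mulr_sumr; apply: eq_bigr => i _; rewrite mulr_sumr.
by apply: eq_bigr => j _; rewrite mxE normcM.
Qed.

Lemma snormN m n (X : 'M[R[i]]_(m, n)) : snorm (- X) = snorm X.
Proof. by apply: eq_bigr => i _; apply: eq_bigr => j _; rewrite mxE normcN. Qed.

Lemma snormM m n p (X : 'M[R[i]]_(m, n)) (Y : 'M[R[i]]_(n, p)) :
  snorm (X *m Y) <= snorm X * snorm Y.
Proof.
rewrite [leRHS]mulr_suml; apply: ler_sum => i _.
apply: (@le_trans _ _ (\sum_j \sum_k normc (X i k) * normc (Y k j))).
  apply: ler_sum => j _; rewrite mxE; apply: (le_trans (normc_sum _ _ _)).
  by apply: ler_sum => k _; rewrite normcM.
rewrite exchange_big /= mulr_suml; apply: ler_sum => k _.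
rewrite -mulr_sumr ler_wpM2l ?normc_ge0 // /snorm (bigD1 k) //= lerDl.
by rewrite sumr_ge0 // => l _; rewrite sumr_ge0 // => j _; exact: normc_ge0.
Qed.

Lemma snorm_tr m n (X : 'M[R[i]]_(m, n)) : snorm X^T = snorm X.
Proof.
rewrite /snorm exchange_big; apply: eq_bigr => i _; apply: eq_bigr => j _.
by rewrite mxE.
Qed.

Lemma unitmx_row_inj n (P : 'M[R[i]]_n) :
  (forall v : 'rV_n, v *m P = 0 -> v = 0) -> P \in unitmx.
Proof.
move=> h; rewrite -row_free_unit -kermx_eq0; apply/eqP/row_matrixP => i.
by rewrite row0; apply: h; rewrite -row_mul mulmx_ker row0.
Qed.

(** If v (P + Q) = 0, then v = - v Q P^-1 has at most half its own norm, so v = 0. The norm bound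
    follows from the resolvent identity by absorbing the same factor 1/2, without a Neumann
    series. *)
Lemma perturbed_inverse n (P Q : 'M[R[i]]_n) : P \in unitmx ->
  snorm (invmx P) * snorm Q <= 1 / 2 ->
  [/\ P + Q \in unitmx, snorm (invmx (P + Q)) <= 2 * snorm (invmx P) &
      invmx (P + Q) = invmx P - invmx P *m Q *m invmx (P + Q)].
Proof.
move=> uP hPQ; have uPQ : P + Q \in unitmx.
  apply: unitmx_row_inj => v; rewrite mulmxDr => /eqP; rewrite addr_eq0 => /eqP vP.
  have : v = - (v *m Q *m invmx P) by rewrite -mulNmx -vP mulmxK.
  move=> E; apply: snorm_eq0; have := snormM (v *m Q) (invmx P).
  rewrite -snormN -E; have := snormM v Q; have := snorm_ge0 v.
  have := snorm_ge0 (invmx P); have := snorm_ge0 Q; nra.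
have E : invmx (P + Q) = invmx P - invmx P *m Q *m invmx (P + Q).
  apply/eqP; rewrite eq_sym subr_eq -mulmxA.
  rewrite -[X in _ == X + _]mul1mx -(mulVmx uP) -mulmxA -mulmxDr -mulmxDl.
  by rewrite mulmxV // mulmx1.
split => //; have := snorm_ge0 (invmx (P + Q)).
have : snorm (invmx (P + Q)) <=
    snorm (invmx P) + snorm (invmx P) * snorm Q * snorm (invmx (P + Q)).
  rewrite {1}E; apply: (le_trans (snormD _ _)); rewrite snormN lerD2l.
  apply: (le_trans (snormM _ _)); rewrite ler_wpM2r ?snorm_ge0 //; exact: snormM.
move: hPQ; set a := _ * snorm Q; set b := snorm (invmx (P + Q)); nra.
Qed.

End SumNorm.

(** * Resolvents and their modal form *)

Section Resolvent.
Variables (R : realType) (n r : nat).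
Implicit Types (M : @pH_model R n r) (z : R[i]).

Lemma unitmx_resolvent (A : 'M[R[i]]_r) z : ~~ eigenvalue A z -> z%:M - A \in unitmx.
Proof.
rewrite /eigenvalue /eigenspace negbK kermx_eq0 row_free_unit => h.
by rewrite -opprB -scaleN1r unitmxZ // unitfE oppr_eq0 oner_eq0.
Qed.

Lemma resolvent_not_eigenvalue (A : 'M[R[i]]_r) z : z%:M - A \in unitmx ->
  ~~ eigenvalue A z.
Proof.
move=> u; rewrite /eigenvalue /eigenspace negbK kermx_eq0 row_free_unit.
by rewrite -opprB -scaleN1r unitmxZ // unitfE oppr_eq0 oner_eq0.
Qed.

Definition resolvent (A : 'M[R[i]]_r) z := invmx (z%:M - A).

Lemma transferE M z : transfer M z =
  (complexify (pH_B M))^T *m resolvent (pH_A M) z *m complexify (pH_B M).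
Proof.
rewrite /transfer /resolvent /pH_A /complexify map_mxD map_mxN.
by rewrite opprD opprK addrA.
Qed.

(** Two applications of the resolvent identity give S' - S + h S S = h^2 S S S', a remainder that
    [perturbed_inverse] bounds uniformly for small [h]. *)
Lemma transfer_cderiv M z : z%:M - pH_A M \in unitmx -> forall i j,
  cderiv (fun w => transfer M w i j) z
    ((- ((complexify (pH_B M))^T *m (resolvent (pH_A M) z *m resolvent (pH_A M) z)
        *m complexify (pH_B M))) i j).
Proof.
move=> u i j e e0; set B := complexify _; set A := pH_A M in u *.
set S := resolvent A z.
pose b := snorm B; have b0 : 0 <= b by exact: snorm_ge0.
pose q := snorm S; have q0 : 0 <= q by exact: snorm_ge0.
pose c := snorm (1%:M : 'M[R[i]]_r); have c0 : 0 <= c by exact: snorm_ge0.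
have D1 : 0 < 2 * (q * c + 1) by rewrite mulr_gt0 // ltr_wpDl // mulr_ge0.
pose E := b * (q * q * (2 * q)) * b.
have E0 : 0 <= E by rewrite /E !mulr_ge0.
have D2 : 0 < E + 1 by rewrite ltr_wpDl.
exists (Num.min (2 * (q * c + 1))^-1 (e / (E + 1))).
  by rewrite lt_min invr_gt0 D1 divr_gt0.
move=> h; rewrite lt_min => /andP[h1 h2].
have shift : (z + h)%:M - A = (z%:M - A) + h *: 1%:M.
  by rewrite scalemx1 raddfD /= addrAC.
have hn := normc_ge0 h.
have [u' bnd id] : [/\ (z + h)%:M - A \in unitmx,
    snorm (resolvent A (z + h)) <= 2 * q &
    resolvent A (z + h) = S - h *: (S *m resolvent A (z + h))].
  have := @perturbed_inverse _ _ (z%:M - A) (h *: 1%:M) u.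
  rewrite -shift snormZ -/(resolvent A z) -/(resolvent A (z + h)) -/S -/q -/c.
  rewrite -scalemxAr mulmx1 -scalemxAl; apply.
  have : normc h * (2 * (q * c + 1)) <= 1.
    by rewrite -ler_pdivlMr // div1r ltW.
  have : 0 <= q * c by rewrite mulr_ge0.
  rewrite mulrCA; nra.
set S' := resolvent A (z + h) in bnd id *.
have id2 : S' - S + h *: (S *m S) = (h * h) *: (S *m S *m S').
  have d1 : S' - S = - (h *: (S *m S')) by rewrite {1}id addrAC subrr add0r.
  rewrite d1 addrC -scalerBr -mulmxBr -opprB d1 opprK -scalemxAr scalerA.
  by rewrite mulmxA.
have -> : transfer M (z + h) i j - transfer M z i j -
  (- (B^T *m (S *m S) *m B)) i j * h = ((h * h) *: (B^T *m (S *m S *m S') *m B)) i j.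
  rewrite !transferE -/A -/B -/S -/S'.
  rewrite scalemxAl scalemxAr -id2 mulmxDr mulmxBr mulmxDl mulmxBl.
  rewrite -scalemxAr -scalemxAl !mxE; ring.
apply: (le_trans (snorm_entry _ _ _)); rewrite snormZ normcM.
have : snorm (B^T *m (S *m S *m S') *m B) <= E.
  apply: (le_trans (snormM _ _)); rewrite ler_wpM2r //.
  apply: (le_trans (snormM _ _)); rewrite snorm_tr ler_wpM2l //.
  apply: (le_trans (snormM _ _)); apply: ler_pM; rewrite ?snorm_ge0 //.
  exact: snormM.
have : normc h * (E + 1) <= e by rewrite -ler_pdivlMr // ltW.
set N := snorm _ => k1 k2.
rewrite -mulrA [leRHS]mulrC ler_wpM2l //; apply: le_trans k1.
by rewrite ler_wpM2l //; lra.
Qed.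

Lemma stable_unit M z : Sigma_pH M -> 0 <= Re z -> z%:M - pH_A M \in unitmx.
Proof.
move=> [_ _ _ st] z0; apply: unitmx_resolvent; apply/negP => /st.
by rewrite ltNge z0.
Qed.

Section Spectral.
Variables (A T : 'M[R[i]]_r) (lambda : 'I_r -> R[i]).
Hypothesis eT : eigenvector_matrix A T lambda.

Lemma eigenvector_matrixE : A *m T = T *m diag_mx (\row_i lambda i).
Proof. by case: eT => u <-; rewrite !mulmxA mulmxV // mul1mx. Qed.

Lemma eigenvector_matrix_eigenvalue i : eigenvalue A (lambda i).
Proof.
(* [eigenvalue] refers to row vectors, so the eigenvectors are rows of the inverse of [T]. *)
case: eT => u E; apply/eigenvalueP; exists (row i (invmx T)).
  rewrite -row_mul (_ : invmx T *m A = diag_mx (\row_i lambda i) *m invmx T).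
    by rewrite row_mul row_diag_mx -scalemxAl -rowE mxE.
  by rewrite -E mulmxK.
apply/eqP => h; have := congr1 (fun X => X *m T) h.
rewrite -row_mul mulVmx // mul0mx => /rowP/(_ i); rewrite !mxE eqxx /= => /eqP.
by rewrite oner_eq0.
Qed.

Lemma resolvent_spectral z : (forall i, z != lambda i) ->
  resolvent A z = T *m diag_mx (\row_i (z - lambda i)^-1) *m invmx T.
Proof.
case: (eT) => u _ zl; rewrite /resolvent.
have E : (z%:M - A) *m (T *m diag_mx (\row_i (z - lambda i)^-1) *m invmx T) = 1%:M.
  rewrite !mulmxA mulmxBl eigenvector_matrixE mul_scalar_mx -mul_mx_scalar.
  rewrite -mulmxBr -(mulmxA T) (_ : _ *m diag_mx _ = 1%:M) ?mulmx1 ?mulmxV //.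
  apply/matrixP => i j; rewrite mulmxBl mul_scalar_mx mulmx_diag.
  rewrite !mxE; case: eqP => [->|_]; last by rewrite !mulr0n mulr0 subrr.
  by rewrite !mulr1n -mulrBl mulfV // subr_eq0.
have [uz _] := mulmx1_unit E.
by rewrite -[LHS]mulmx1 -E mulKmx.
Qed.

Lemma resolvent_snorm z : (forall i, z != lambda i) ->
  snorm (resolvent A z) <= snorm T * snorm (invmx T) * \sum_i (normc (z - lambda i))^-1.
Proof.
move=> zl; rewrite resolvent_spectral //.
apply: (le_trans (snormM _ _)); rewrite mulrAC ler_wpM2r ?snorm_ge0 //.
apply: (le_trans (snormM _ _)); rewrite ler_wpM2l ?snorm_ge0 //.
apply: ler_sum => i _; rewrite (bigD1 i) //= !mxE eqxx mulr1n normcV big1 ?addr0 //.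
move=> j ji; rewrite !mxE eq_sym (negbTE ji) mulr0n.
by rewrite ComplexField.Normc.normc0.
Qed.

End Spectral.
End Resolvent.

(** * Openness of positive definiteness *)

Section PositiveDefinite.
Variables (R : realType) (r : nat).

Lemma pdmx_unit (P : 'M[R]_r) : pdmx P -> P \in unitmx.
Proof.
move=> pd; rewrite -row_free_unit -kermx_eq0; apply/eqP/row_matrixP => i.
rewrite row0; set v := row i _; apply/eqP; apply: contraT => v0.
have /pd : v^T != 0 by rewrite -trmx_eq0 trmxK.
by rewrite trmxK -row_mul mulmx_ker row0 mul0mx mxE ltxx.
Qed.

(* Cauchy-Schwarz for the inner product of [P], applied to [x] and [P^-1 e_i]. *)
Lemma pdmx_coord_bound (P : 'M[R]_r) : P = P^T -> pdmx P ->
  exists q : 'I_r -> R, forall (x : 'cV[R]_r) i,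
    x i 0 ^+ 2 <= q i * (x^T *m P *m x) 0 0.
Proof.
move=> sP pd; have uP := pdmx_unit pd.
pose y i : 'cV[R]_r := invmx P *m delta_mx i 0.
pose q i := ((y i)^T *m P *m y i) 0 0.
exists q => x i.
have Py : P *m y i = delta_mx i 0 by rewrite /y mulKVmx.
have yP : (y i)^T *m P = delta_mx 0 i by rewrite {1}sP -trmx_mul Py trmx_delta.
have qE : q i = y i i 0 by rewrite /q yP -rowE mxE.
have q0 : 0 < q i.
  apply: pd; apply/eqP => y0; have /colP/(_ i) := Py.
  by rewrite y0 mulmx0 !mxE !eqxx => /eqP; rewrite eq_sym oner_eq0.
have psd (v : 'cV[R]_r) : 0 <= (v^T *m P *m v) 0 0.
  have [->|/pd/ltW //] := eqVneq v 0; by rewrite mulmx0 mxE.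
pose t := x i 0 / q i.
have := psd (x - t *: y i).
have -> : ((x - t *: y i)^T *m P *m (x - t *: y i)) 0 0 =
    (x^T *m P *m x) 0 0 - x i 0 ^+ 2 / q i.
  have -> : (x - t *: y i)^T = x^T - t *: (y i)^T.
    by apply/matrixP => ? ?; rewrite !mxE.
  rewrite !mulmxBl !mulmxBr -!scalemxAl -!scalemxAr.
  rewrite yP -[x^T *m P *m y i]mulmxA Py -!rowE -colE.
  rewrite (_ : (_ - _ : 'M[R]_1) 0 0 = (x^T *m P *m x) 0 0 - t * x i 0
    - t * (x i 0 - t * q i)); last first.
    by rewrite qE; move: (x^T *m P *m x) (y i) => Z Y; rewrite !mxE; ring.
  rewrite /t; field.
  by rewrite gt_eqF.
by rewrite subr_ge0 ler_pdivrMr // mulrC.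
Qed.

(** It suffices that |x^T W x| <= C x^T P x. This follows from |x_i| |x_j| <= (x_i^2 + x_j^2) / 2
    and the bound of each square by the form in [pdmx_coord_bound]; the radius is then 1 / (C +
    1). *)
Lemma pdmx_perturb (P W : 'M[R]_r) : P = P^T -> pdmx P ->
  exists2 e0 : R, 0 < e0 & forall e : R, `|e| <= e0 -> psdmx (P - e *: W).
Proof.
move=> sP pd; have [q hq] := pdmx_coord_bound sP pd.
have psd (v : 'cV[R]_r) : 0 <= (v^T *m P *m v) 0 0.
  have [->|/pd/ltW //] := eqVneq v 0; by rewrite mulmx0 mxE.
pose C := \sum_i \sum_j `|W i j| * ((`|q i| + `|q j|) / 2).
have C0 : 0 <= C.
  by rewrite sumr_ge0 // => i _; rewrite sumr_ge0 // => j _; rewrite mulr_ge0 // divr_ge0 // addr_ge0.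
exists (C + 1)^-1; first by rewrite invr_gt0 ltr_wpDl.
move=> e he x; set Q := (x^T *m P *m x) 0 0; have Q0 : 0 <= Q by exact: psd.
have hW : `|(x^T *m W *m x) 0 0| <= C * Q.
  have -> : (x^T *m W *m x) 0 0 = \sum_i \sum_j x i 0 * W i j * x j 0.
    rewrite mxE exchange_big /=; apply: eq_bigr => j _; rewrite mxE mulr_suml.
    by apply: eq_bigr => i _; rewrite mxE.
  rewrite mulr_suml; apply: (le_trans (ler_norm_sum _ _ _)); apply: ler_sum => i _.
  rewrite mulr_suml; apply: (le_trans (ler_norm_sum _ _ _)); apply: ler_sum => j _.
  rewrite !normrM -mulrA mulrCA -mulrA ler_wpM2l //.
  have hi := hq x i; have hj := hq x j.
  have ci : `|x i 0| ^+ 2 <= `|q i| * Q.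
    rewrite real_normK ?num_real //; apply: (le_trans hi).
    by rewrite ler_wpM2r // ler_norm.
  have cj : `|x j 0| ^+ 2 <= `|q j| * Q.
    rewrite real_normK ?num_real //; apply: (le_trans hj).
    by rewrite ler_wpM2r // ler_norm.
  have := sqr_ge0 (`|x i 0| - `|x j 0|); rewrite sqrrB; lra.
rewrite mulmxBr mulmxBl -scalemxAr -scalemxAl.
rewrite (_ : (_ - _ : 'M[R]_1) 0 0 = Q - e * (x^T *m W *m x) 0 0); last first.
  by rewrite /Q; move: (x^T *m P *m x) (x^T *m W *m x) => Z Y; rewrite !mxE.
rewrite subr_ge0; apply: (le_trans (ler_norm _)); rewrite normrM.
have : `|e| * (C + 1) <= 1 by rewrite -ler_pdivlMr ?div1r // ltr_wpDl.
have := normr_ge0 e; have := normr_ge0 ((x^T *m W *m x) 0 0).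
set a := `|e|; set b := `|_ 0 0| in hW * => b0 a0 ac.
apply: (@le_trans _ _ (a * (C * Q))); first by rewrite ler_wpM2l.
rewrite mulrA ler_piMl //; lra.
Qed.
End PositiveDefinite.

(** * First-order optimality *)

Section FirstOrder.
Variable R : realType.
Notation mu := (@lebesgue_measure R).

Lemma integrable_bigsum (I : eqType) (s : seq I) (F : I -> R -> R) :
  (forall i, mu.-integrable setT (EFin \o F i)) ->
  mu.-integrable setT (EFin \o (fun w => \sum_(i <- s) F i w)) /\
  \int[mu]_w (\sum_(i <- s) F i w) = \sum_(i <- s) \int[mu]_w F i w.
Proof.
move=> hF; elim: s => [|i s [ih1 ih2]].
  split; last by rewrite big_nil; under eq_Rintegral do rewrite big_nil;
    rewrite /Rintegral integral0.
  rewrite (_ : _ \o _ = cst 0%E); first exact: integrable0.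
  by apply/funext => w /=; rewrite big_nil.
have E w : \sum_(j <- i :: s) F j w = 1 * F i w + 1 * \sum_(j <- s) F j w.
  by rewrite big_cons !mul1r.
split.
  have := integrable_lin 1 1 measurableT (hF i) ih1.
  by apply: eq_integrable => // w _ /=; rewrite E.
rewrite big_cons -ih2 (@eq_Rintegral _ _ _ mu _ _ _ (fun w _ => E w)).
by rewrite Rintegral_lin // !mul1r.
Qed.

(** With u = e - a d, one has |e - rho| <= |u| + a^2 k. Expanding |u|^2 exactly produces the linear
    term; the rest carries a factor a^2. The coefficients 3, 2, 2 come from 2 |u| k <= |u|^2 + k^2,
    |u|^2 <= 2 |e|^2 + 2 |d|^2 and |a| <= 1. *)
Lemma normc_perturb (e d rho : R[i]) (a k : R) : `|a| <= 1 -> 0 <= k ->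
  normc (rho - (a +i 0) * d) <= a ^+ 2 * k ->
  normc (e - rho) ^+ 2 <= normc e ^+ 2 - 2 * a * Re (e * d^*)
    + a ^+ 2 * (3 * normc d ^+ 2 + 2 * normc e ^+ 2 + 2 * k ^+ 2).
Proof.
move=> a1 k0 hr; set u := e - (a +i 0) * d.
have a20 : 0 <= a ^+ 2 by exact: sqr_ge0.
have a21 : a ^+ 2 <= 1 by rewrite -real_normK ?num_real // expr_le1.
have uE : normc u ^+ 2 = normc e ^+ 2 - 2 * a * Re (e * d^*) + a ^+ 2 * normc d ^+ 2.
  by rewrite /u !normc_sqr; case: e d {hr u} => [e1 e2] [d1 d2] /=; ring.
have u2 : normc u ^+ 2 <= 2 * normc e ^+ 2 + 2 * normc d ^+ 2.
  have U : normc u <= normc e + `|a| * normc d.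
    by apply: (le_trans (normcB_le _ _)); rewrite normcM normcR.
  have U' : normc u <= normc e + normc d.
    by apply: (le_trans U); rewrite lerD2l ler_piMl ?normc_ge0.
  have : normc u ^+ 2 <= (normc e + normc d) ^+ 2.
    by rewrite ler_pXn2r ?nnegrE ?addr_ge0 ?normc_ge0.
  have := sqr_ge0 (normc e - normc d); rewrite !expr2; lra.
have n1 : normc (e - rho) <= normc u + a ^+ 2 * k.
  rewrite (_ : e - rho = u - (rho - (a +i 0) * d)); last by rewrite /u; ring.
  by apply: (le_trans (normcB_le _ _)); rewrite lerD2l.
have : normc (e - rho) ^+ 2 <= (normc u + a ^+ 2 * k) ^+ 2.
  have w0 : 0 <= a ^+ 2 * k by rewrite mulr_ge0.
  by rewrite ler_pXn2r // nnegrE ?addr_ge0 ?normc_ge0.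
move=> /le_trans; apply.
have -> : (normc u + a ^+ 2 * k) ^+ 2 =
  normc u ^+ 2 + a ^+ 2 * (2 * normc u * k) + a ^+ 2 * (a ^+ 2 * k ^+ 2) by ring.
have uk : 2 * normc u * k <= normc u ^+ 2 + k ^+ 2.
  by have := sqr_ge0 (normc u - k); rewrite sqrrB; lra.
have ak : a ^+ 2 * k ^+ 2 <= k ^+ 2 by rewrite ler_piMl // sqr_ge0.
have k1 : a ^+ 2 * (2 * normc u * k) <=
    a ^+ 2 * (2 * normc e ^+ 2 + 2 * normc d ^+ 2 + k ^+ 2).
  by rewrite ler_wpM2l // (le_trans uk) // lerD2r.
have k2 : a ^+ 2 * (a ^+ 2 * k ^+ 2) <= a ^+ 2 * k ^+ 2 by rewrite ler_wpM2l.
rewrite uE; move: k1 k2; rewrite !mulrDr; lra.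
Qed.

Lemma ge0_ae_integral_eq (f g : R -> R) :
  (forall w, 0 <= f w) -> (forall w, 0 <= g w) -> {ae mu, forall w, f w = g w} ->
  (\int[mu]_w (f w)%:E = \int[mu]_w (g w)%:E)%E.
Proof.
move=> f0 g0 fg; apply/eqP; rewrite eq_le; apply/andP; split.
- apply: ge0_ae_le_integral => //.
  by apply: (@filterS _ _ (ae_filter_ringOfSetsType mu)) fg => w ->.
- apply: ge0_ae_le_integral => //.
  by apply: (@filterS _ _ (ae_filter_ringOfSetsType mu)) fg => w ->.
Qed.

Lemma poweR_half_le_cancel (c : R) (x y : \bar R) : 0 < c ->
  (0 <= x -> 0 <= y ->
  (c%:E * x) `^ (2^-1 : R) <= (c%:E * y) `^ (2^-1 : R) -> x <= y)%E.
Proof.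
move=> c0 x0 y0 le1.
have sq z : (0 <= z)%E -> ((z `^ (2^-1 : R)) `^ 2 = z)%E.
  by move=> z0; rewrite -poweRrM mulVf // poweRe1.
have cz z : (0 <= z -> 0 <= c%:E * z)%E.
  by move=> z0; apply: mule_ge0 => //; rewrite lee_fin; exact: ltW.
have : (((c%:E * x) `^ (2^-1 : R)) `^ 2 <= ((c%:E * y) `^ (2^-1 : R)) `^ 2)%E.
  by apply: gt0_ler_poweR => //; rewrite in_itv /= poweR_ge0 leey.
by rewrite !sq ?cz // lee_pmul2l // lte_fin.
Qed.

Variables (n r : nat) (H : R[i] -> 'M[R[i]]_n) (M : @pH_model R n r).
Hypothesis hH : hardyH2 H.
Hypothesis optM : H2_optimal H (@Sigma_pH R n r) M.
Variable b : 'I_n -> 'I_n -> R -> R[i].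
Hypothesis b_bv : {ae mu, forall w, has_boundary_value H w /\
     forall i j, boundary_value H w i j = b i j w}.

Lemma transfer_continuous (M' : @pH_model R n r) w i j : Sigma_pH M' ->
  ccontinuous_at (fun z => transfer M' z i j) (0 +i w).
Proof.
move=> sM'; apply: holo_at_continuous; eexists; apply: transfer_cderiv.
exact: stable_unit.
Qed.

(** Replaces a limit that exists only almost everywhere by an explicit formula; the transfer
    function of a stable model is continuous up to the axis. *)
Lemma boundary_error (M' : @pH_model R n r) : Sigma_pH M' ->
  (\int[mu]_w (frobenius (boundary_value (fun z => H z - transfer M' z) w) ^+ 2)%:E =
   \int[mu]_w (\sum_i \sum_j normc (b i j w - transfer M' (0 +i w) i j) ^+ 2)%:E)%E.
Proof.
move=> sM'.
have g0 w : 0 <= \sum_i \sum_j normc (b i j w - transfer M' (0 +i w) i j) ^+ 2.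
  by rewrite sumr_ge0 // => i _; rewrite sumr_ge0 // => j _; rewrite sqr_ge0.
have E : {ae mu, forall w, frobenius (boundary_value (fun z => H z - transfer M' z) w) ^+ 2
    = \sum_i \sum_j normc (b i j w - transfer M' (0 +i w) i j) ^+ 2}.
  move: b_bv; apply: (@filterS _ _ (ae_filter_ringOfSetsType mu)) => w [hw bw].
  rewrite boundary_value_sub //; last by move=> i j; exact: transfer_continuous.
  rewrite frobenius_sqr; apply: eq_bigr => i _; apply: eq_bigr => j _.
  by rewrite !mxE bw.
by apply: (ge0_ae_integral_eq _ g0 E) => w; rewrite sqr_ge0.
Qed.

Lemma H2norm_error (M' : @pH_model R n r) : Sigma_pH M' ->
  H2norm (fun z => H z - transfer M' z) = ((((2 * pi)^-1)%:E *
    \int[mu]_w (\sum_i \sum_j normc (b i j w - transfer M' (0 +i w) i j) ^+ 2)%:E)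
    `^ (2^-1 : R))%E.
Proof. by move=> sM'; rewrite /H2norm -(boundary_error sM'). Qed.

Lemma optimal_error (M' : @pH_model R n r) : Sigma_pH M' ->
  (\int[mu]_w (\sum_i \sum_j normc (b i j w - transfer M (0 +i w) i j) ^+ 2)%:E <=
   \int[mu]_w (\sum_i \sum_j normc (b i j w - transfer M' (0 +i w) i j) ^+ 2)%:E)%E.
Proof.
case: (optM) => sM opt sM'.
have le0 (x y x' y' : \bar R) : x = x' -> y = y' -> (x <= y)%E -> (x' <= y')%E.
  by move=> -> ->.
have := le0 _ _ _ _ (H2norm_error sM) (H2norm_error sM') (opt _ sM').
have i0 (M1 : @pH_model R n r) : (0 <= \int[mu]_w
    (\sum_i \sum_j normc (b i j w - transfer M1 (0 +i w) i j) ^+ 2)%:E)%E.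
  apply: integral_ge0 => w _; rewrite lee_fin.
  by rewrite sumr_ge0 // => i _; rewrite sumr_ge0 // => j _; rewrite sqr_ge0.
have c0 : 0 < (2 * pi)^-1 :> R by rewrite invr_gt0 mulr_gt0 // pi_gt0.
exact: (poweR_half_le_cancel c0 (i0 M) (i0 M')).
Qed.

(** Integrating [normc_perturb] and comparing with the optimum gives 2 a P <= a^2 Q for small [a] of
    either sign, hence P = 0. The majorant [k] is square integrable and independent of [a], so Q is
    finite and fixed. *)
Lemma first_order (d : 'I_n -> 'I_n -> R -> R[i]) (k : R -> R) (C e0 : R) :
  (forall i j, L2_bounded (fun w => b i j w - transfer M (0 +i w) i j) C) ->
  (forall i j, L2_bounded (d i j) C) ->
  (forall w, 0 <= k w) ->
  mu.-integrable setT (EFin \o (fun w => k w ^+ 2)) ->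
  0 < e0 ->
  (forall a : R, `|a| <= e0 -> exists2 M' : @pH_model R n r, Sigma_pH M' &
     forall w i j, normc (transfer M' (0 +i w) i j - transfer M (0 +i w) i j
       - (a +i 0) * d i j w) <= a ^+ 2 * k w) ->
  \sum_i \sum_j Re (cint setT (fun w =>
    (b i j w - transfer M (0 +i w) i j) * (d i j w)^*)) = 0.
Proof.
move=> he hd k0 ik e00 hM'.
pose e (p : 'I_n * 'I_n) w := b p.1 p.2 w - transfer M (0 +i w) p.1 p.2.
pose dd (p : 'I_n * 'I_n) w := d p.1 p.2 w.
rewrite pair_big /=; set P := \sum_p _.
have ie p : mu.-integrable setT (EFin \o (fun w => normc (e p w) ^+ 2)).
  exact: L2_bounded_integrable (he p.1 p.2).
have id p : mu.-integrable setT (EFin \o (fun w => normc (dd p w) ^+ 2)).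
  exact: L2_bounded_integrable (hd p.1 p.2).
have hdc p : L2_bounded (fun w => (dd p w)^*) C.
  have [md dC] := hd p.1 p.2; split; first exact: cmeas_conj.
  by under eq_integral do rewrite normc_conj.
have iP p : mu.-integrable setT (EFin \o (fun w => Re (e p w * (dd p w)^*))).
  by have [] := L2_prod_integrable (he p.1 p.2) (hdc p).
pose q p w := 3 * normc (dd p w) ^+ 2 + 2 * normc (e p w) ^+ 2 + 2 * k w ^+ 2.
have iq p : mu.-integrable setT (EFin \o q p).
  have i1 := integrable_lin 3 2 measurableT (id p) (ie p).
  have := integrable_lin 1 2 measurableT i1 ik.
  by apply: eq_integrable => // w _ /=; rewrite mul1r.
pose Q := \sum_p \int[mu]_w q p w.
pose A := \sum_p \int[mu]_w (normc (e p w) ^+ 2).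
have Q0 : 0 <= Q.
  rewrite sumr_ge0 // => p _; apply: Rintegral_ge0 => w _.
  by rewrite /q !addr_ge0 // mulr_ge0 // sqr_ge0.
have key a : `|a| <= e0 -> `|a| <= 1 -> 2 * a * P <= a ^+ 2 * Q.
  move=> a0 a1; have [M' sM' hM'a] := hM' a a0.
  pose g p w := normc (e p w) ^+ 2 - 2 * a * Re (e p w * (dd p w)^*) + a ^+ 2 * q p w.
  have i2 p := integrable_lin 1 (- (2 * a)) measurableT (ie p) (iP p).
  have gE p w : g p w = 1 * (1 * normc (e p w) ^+ 2
      + - (2 * a) * Re (e p w * (dd p w)^*)) + a ^+ 2 * q p w.
    by rewrite /g !mul1r mulNr.
  have ig p : mu.-integrable setT (EFin \o g p).
    have := integrable_lin 1 (a ^+ 2) measurableT (i2 p) (iq p).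
    by apply: eq_integrable => // w _ /=; rewrite gE.
  have intg p : \int[mu]_w g p w = \int[mu]_w (normc (e p w) ^+ 2)
      - 2 * a * \int[mu]_w Re (e p w * (dd p w)^*) + a ^+ 2 * \int[mu]_w q p w.
    rewrite (@eq_Rintegral _ _ _ mu _ _ _ (fun w _ => gE p w)).
    by rewrite Rintegral_lin // Rintegral_lin // !mul1r mulNr.
  have gbig p w : normc (b p.1 p.2 w - transfer M' (0 +i w) p.1 p.2) ^+ 2 <= g p w.
    have := @normc_perturb (e p w) (dd p w)
      (transfer M' (0 +i w) p.1 p.2 - transfer M (0 +i w) p.1 p.2) a (k w) a1 (k0 w)
      (hM'a w p.1 p.2).
    by rewrite {1}/e (_ : b p.1 p.2 w - _ - _ = b p.1 p.2 w - transfer M' (0 +i w) p.1 p.2) //; ring.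
  have := optimal_error sM'.
  under eq_integral => w _ do rewrite pair_big /=.
  under [X in (_ <= X)%E]eq_integral => w _ do rewrite pair_big /=.
  have [iA EA] := integrable_bigsum (index_enum _) ie.
  have [iG EG] := integrable_bigsum (index_enum _) ig.
  rewrite (EFin_Rintegral iA) EA => le1.
  have le2 : (\int[mu]_w (\sum_p normc (b p.1 p.2 w - transfer M' (0 +i w) p.1 p.2) ^+ 2)%:E
      <= \int[mu]_w (\sum_p g p w)%:E)%E.
    apply: ge0_ae_le_integral => [w|w|].
    - by rewrite sumr_ge0 // => p _; rewrite sqr_ge0.
    - by rewrite sumr_ge0 // => p _; apply: le_trans (gbig p w); rewrite sqr_ge0.
    - by apply: aeW => w; apply: ler_sum => p _; exact: gbig.
  have := le_trans le1 le2; rewrite (EFin_Rintegral iG) EG lee_fin.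
  under [X in _ <= X]eq_bigr do rewrite intg.
  rewrite !big_split /= sumrN -!mulr_sumr -/A -/Q.
  have -> : \sum_p \int[mu]_w Re (e p w * (dd p w)^*) = P by [].
  lra.
(* Taking the sign of P into account, 2 |P| <= a Q would hold, whereas a (Q + 1) <= |P|. *)
pose a := Num.min e0 (Num.min 1 (`|P| / (Q + 1))).
apply/eqP/negP => /negP P0; have nP : 0 < `|P| by rewrite normr_gt0.
have D0 : 0 < Q + 1 by rewrite ltr_wpDl.
have a0 : 0 < a by rewrite !lt_min e00 ltr01 divr_gt0.
have ae : a <= e0 by rewrite ge_min lexx.
have a1 : a <= 1 by rewrite !ge_min lexx orbT.
have aP : a * (Q + 1) <= `|P| by rewrite -ler_pdivlMr // !ge_min lexx !orbT.
have : 2 * a * `|P| <= a ^+ 2 * Q.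
  have [P1|P1] := ger0P P.
    by apply: key; rewrite gtr0_norm.
  have := key (- a); rewrite normrN (gtr0_norm a0) sqrrN => /(_ ae a1).
  by rewrite mulrN mulNr mulrN.
rewrite expr2 -mulrA mulrCA -mulrA ler_pM2l // => h.
have : a * (Q + 1) = a * Q + a by ring.
lra.
Qed.
End FirstOrder.

(** * Admissible perturbations of a stable model *)

Section Perturbation.
Variables (R : realType) (n r : nat).
Notation mu := (@lebesgue_measure R).
Variables (J Rh : 'M[R]_r) (B : 'M[R]_(r, n)).
Variables (T : 'M[R[i]]_r) (lambda : 'I_r -> R[i]).
Let M := PHModel J Rh B.
Let A : 'M[R[i]]_r := complexify (J - Rh).
Hypothesis sM : Sigma_pH M.
Hypothesis eT : eigenvector_matrix A T lambda.
Let S w := resolvent A (0 +i w).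
Let CB : 'M[R[i]]_(r, n) := complexify B.

Lemma eigenvalue_stable i : Re (lambda i) < 0.
Proof. by case: sM => _ _ _; apply; exact: eigenvector_matrix_eigenvalue eT i. Qed.

Lemma eigenvalue_neq z i : 0 <= Re z -> z != lambda i.
Proof. by move=> z0; apply/eqP => E; have := eigenvalue_stable i; rewrite -E ltNge z0. Qed.

(** Up to a constant depending on [T], this dominates the resolvent on the axis and on every line to
    its right. It is the square integrable majorant of all remainders. *)
Definition modal_bound (w : R) : R := \sum_i (normc ((0 +i w) - lambda i))^-1.
Let k := modal_bound.
Let c1 := snorm T * snorm (invmx T).

Lemma modal_bound_ge0 w : 0 <= k w.
Proof. by rewrite sumr_ge0 // => i _; rewrite invr_ge0 normc_ge0. Qed.

Lemma modal_constant_ge0 : 0 <= c1.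
Proof. by rewrite mulr_ge0 // snorm_ge0. Qed.

Lemma sub_eigenvalue_normc z i : 0 <= Re z -> 0 < normc (z - lambda i).
Proof. by move=> z0; rewrite normc_gt0 subr_eq0 eigenvalue_neq. Qed.

(** The eigenvalues lie to the left of the axis, so moving to the right only increases the distances
    to them. *)
Lemma resolvent_line_bound x w : 0 <= x -> snorm (resolvent A (x +i w)) <= c1 * k w.
Proof.
move=> x0; apply: le_trans (resolvent_snorm eT _) _.
  by move=> i; exact: eigenvalue_neq.
rewrite ler_wpM2l ?modal_constant_ge0 //; apply: ler_sum => i _.
have h1 := @sub_eigenvalue_normc (x +i w) i x0.
have h2 := @sub_eigenvalue_normc (0 +i w) i (lexx 0).
rewrite lef_pV2 ?posrE //.
rewrite -(ler_pXn2r (ltn0Sn 1)) ?nnegrE ?normc_ge0 // !normc_sqr.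
have ReE u : Re ((u +i w) - lambda i) = u - Re (lambda i) by case: (lambda i).
have ImE u : Im ((u +i w) - lambda i) = w - Im (lambda i) by case: (lambda i).
rewrite !ReE !ImE lerD2r; have := eigenvalue_stable i; nra.
Qed.

Let m := c1 * \sum_i `|Re (lambda i)|^-1.

Lemma resolvent_bound z : 0 <= Re z -> snorm (resolvent A z) <= m.
Proof.
move=> z0; apply: le_trans (resolvent_snorm eT _) _.
  by move=> i; exact: eigenvalue_neq.
rewrite ler_wpM2l ?modal_constant_ge0 //; apply: ler_sum => i _.
have l0 := eigenvalue_stable i.
rewrite lef_pV2 ?posrE ?normr_gt0 ?lt_eqF //; last exact: sub_eigenvalue_normc.
apply: le_trans (Re_le_normc _).
rewrite (_ : Re (z - lambda i) = Re z - Re (lambda i)); last by case: (z) (lambda i) => ? ? [].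
by rewrite ltr0_norm // ger0_norm ?subr_ge0 ?(le_trans (ltW l0)) // lerDr.
Qed.

Lemma resolvent_bound_ge0 : 0 <= m.
Proof.
by apply: le_trans (snorm_ge0 (resolvent A 0)) _; exact: resolvent_bound.
Qed.

Lemma sum_L2 (I : eqType) (s : seq I) (F : I -> R -> R[i]) :
  (forall i, exists C, L2_bounded (F i) C) ->
  exists C, L2_bounded (fun w => \sum_(i <- s) F i w) C.
Proof.
move=> hF; elim: s => [|i s [C hC]].
  exists 0; split.
    rewrite (_ : (fun w => _) = fun=> 0); first exact: cmeas_cst.
    by apply/funext => w; rewrite big_nil.
  under eq_integral => w _ do rewrite big_nil ComplexField.Normc.normc0 expr0n.
  by rewrite integral0.
have [D hD] := hF i; exists (2 * D + 2 * C).
rewrite (_ : (fun w => _) = (fun w => F i w + \sum_(i <- s) F i w)).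
  exact: L2_boundedD.
by apply/funext => w; rewrite big_cons.
Qed.

Lemma modal_kernel_L2 i : L2_bounded (fun w => ((0 +i w) - lambda i)^-1)
  (pi / `|- Re (lambda i)|).
Proof.
have h : - Re (lambda i) != 0 by rewrite oppr_eq0 lt_eqF // eigenvalue_stable.
have := kernel_L2 (Im (lambda i)) h; congr L2_bounded; apply/funext => w.
by rewrite kernel_shift sub0r.
Qed.

Lemma modal_bound_L2 : exists C, L2_bounded (fun w => (k w) +i 0) C.
Proof.
have -> : (fun w => (k w) +i 0) =
    (fun w => \sum_i ((normc ((0 +i w) - lambda i)^-1) +i 0)).
  apply/funext => w; rewrite /k /modal_bound -[_ +i 0]/(_%:C)%C rmorph_sum /=.
  by apply: eq_bigr => i _; rewrite normcV.
apply: sum_L2 => i; exists (pi / `|- Re (lambda i)|).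
have [mk hk] := modal_kernel_L2 i; split.
  by split; [exact: cmeas_normc|exact: measurable_cst].
under eq_integral => w _ do rewrite normcR (ger0_norm (normc_ge0 _)).
exact: hk.
Qed.

Lemma modal_bound_sqr_integrable :
  mu.-integrable setT (EFin \o (fun w => k w ^+ 2)).
Proof.
have [C hC] := modal_bound_L2; have := L2_bounded_integrable hC.
by apply: eq_integrable => // w _ /=; rewrite expr0n addr0 sqr_sqrtr ?sqr_ge0.
Qed.

Lemma L2_of_modal_bound (f : R -> R[i]) D : cmeas f -> 0 <= D ->
  (forall w, normc (f w) <= D * k w) -> exists C, L2_bounded f C.
Proof.
move=> mf D0 hf; have [C hC] := modal_bound_L2; exists (D ^+ 2 * C).
apply: (L2_bounded_le hC) => // w; apply: le_trans (hf w) _.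
by rewrite normcR ler_wpM2l // ler_norm.
Qed.

Lemma complexifyD p q (X Y : 'M[R]_(p, q)) : complexify (X + Y) = complexify X + complexify Y.
Proof. exact: map_mxD. Qed.

Lemma complexifyZ p q (a : R) (X : 'M[R]_(p, q)) :
  complexify (a *: X) = (a +i 0) *: complexify X.
Proof. exact: map_mxZ. Qed.

Lemma resolvent_unit z : 0 <= Re z -> z%:M - A \in unitmx.
Proof. exact: (stable_unit sM). Qed.

(** First-order change of the transfer function on the axis when A moves in the direction [D]. *)
Definition system_direction (D : 'M[R[i]]_r) w : 'M[R[i]]_n :=
  CB^T *m (S w *m D *m S w) *m CB.

(** The first-order change caused by [W] is the sum of the left and right directions. They are kept
    apart because they lead to the two different sums of the last condition: [W] meets the vectors
    t_i in one and s_i in the other. *)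
Definition port_direction_l (W : 'M[R[i]]_(r, n)) w : 'M[R[i]]_n := W^T *m S w *m CB.
Definition port_direction_r (W : 'M[R[i]]_(r, n)) w : 'M[R[i]]_n := CB^T *m S w *m W.

Lemma snorm_congruence p q (X Z : 'M[R[i]]_(p, q)) (Y : 'M[R[i]]_p) :
  snorm (X^T *m Y *m Z) <= snorm X * snorm Y * snorm Z.
Proof.
apply: (le_trans (snormM _ _)); rewrite ler_wpM2r ?snorm_ge0 //.
by apply: (le_trans (snormM _ _)); rewrite snorm_tr.
Qed.

(** The skew part of [D] is added to J and the symmetric part subtracted from R. Semidefiniteness
    survives by [pdmx_perturb], and stability because z - A stays invertible on the closed right
    half-plane, where its inverse is uniformly bounded. In the remainder a^2 S D S D S' one
    resolvent is bounded by [modal_bound], the others by the constant [m]. *)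
Lemma system_perturbation (D : 'M[R]_r) : pdmx Rh ->
  exists C e0 : R, [/\ 0 <= C, 0 < e0 & forall a : R, `|a| <= e0 ->
    exists2 M' : @pH_model R n r, Sigma_pH M' & forall w i j,
      normc (transfer M' (0 +i w) i j - transfer M (0 +i w) i j
        - (a +i 0) * system_direction (complexify D) w i j) <= a ^+ 2 * (C * k w)].
Proof.
move=> pd; case: (sM) => /= sJ sR _ _.
pose W := 2^-1 *: (D + D^T); pose V := 2^-1 *: (D - D^T).
have VW : V + W = D.
  by apply/matrixP => i j; rewrite !mxE; field.
have [e1 e10 psd] := pdmx_perturb W sR pd.
pose dn := snorm (complexify D); have dn0 : 0 <= dn by exact: snorm_ge0.
have m0 := resolvent_bound_ge0.
have E0 : 0 < 2 * (m * dn + 1) by rewrite mulr_gt0 // ltr_wpDl // mulr_ge0.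
pose bn := snorm CB; have bn0 : 0 <= bn by exact: snorm_ge0.
exists (bn * (m * dn * m * dn * (2 * c1)) * bn).
(* The second bound gives m |a| dn <= 1 / 2, the smallness required by [perturbed_inverse]. *)
exists (Num.min e1 (2 * (m * dn + 1))^-1); split.
- have c10 : 0 <= c1 by exact: modal_constant_ge0.
  by repeat first [assumption | done | apply: mulr_ge0].
- by rewrite lt_min e10 invr_gt0.
move=> a; rewrite le_min => /andP[a1 a2].
pose M' := PHModel (J + a *: V) (Rh - a *: W) B.
have AE : pH_A M' = A + (a +i 0) *: complexify D.
  rewrite /pH_A /= -complexifyZ -complexifyD -VW; congr complexify.
  have gen (X Y P Q : 'M[R]_r) : P + a *: X - (Q - a *: Y) = P - Q + a *: (X + Y).
    by apply/matrixP => p q; rewrite !mxE; ring.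
  exact: gen.
have QE z : z%:M - pH_A M' = (z%:M - A) + (- ((a +i 0) *: complexify D)).
  by rewrite AE opprD addrA.
have small z : 0 <= Re z ->
    snorm (invmx (z%:M - A)) * snorm (- ((a +i 0) *: complexify D)) <= 1 / 2.
  move=> z0; rewrite snormN snormZ normcR -/dn.
  have h := resolvent_bound z0; rewrite /resolvent in h.
  have : `|a| * (2 * (m * dn + 1)) <= 1 by rewrite -ler_pdivlMr // div1r.
  have : snorm (invmx (z%:M - A)) * (`|a| * dn) <= m * (`|a| * dn).
    by rewrite ler_wpM2r // mulr_ge0.
  have := normr_ge0 a; lra.
exists M'.
  split => /=.
  - have eJ i j : J j i = - J i j by move/matrixP : sJ => /(_ i j); rewrite !mxE.
    by apply/matrixP => i j; rewrite !mxE eJ; ring.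
  - have eR i j : Rh i j = Rh j i by move/matrixP : sR => /(_ i j); rewrite !mxE.
    by apply/matrixP => i j; rewrite !mxE eR; ring.
  - exact: psd.
  - move=> z ez; rewrite ltNge; apply/negP => z0.
    have [u _ _] := perturbed_inverse (resolvent_unit z0) (small z z0).
    by move: u; rewrite -QE => /resolvent_not_eigenvalue; rewrite ez.
move=> w i j; have z0 : 0 <= Re (0 +i w : R[i]) by [].
have [u bnd id] := perturbed_inverse (resolvent_unit z0) (small _ z0).
rewrite -QE -!/(resolvent _ _) -/(S w) in u bnd id.
set S' := resolvent (pH_A M') (0 +i w) in bnd id.
set dD := complexify D in id *.
have id1 : S' = S w + (a +i 0) *: (S w *m dD *m S').
  by rewrite {1}id mulmxN mulNmx opprK -scalemxAr -scalemxAl.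
have id2 : S' - S w - (a +i 0) *: (S w *m dD *m S w) =
    ((a +i 0) * (a +i 0)) *: (S w *m dD *m (S w *m dD *m S')).
  have d1 : S' - S w = (a +i 0) *: (S w *m dD *m S').
    by rewrite {1}id1 addrAC subrr add0r.
  by rewrite d1 -scalerBr -mulmxBr d1 -scalemxAr scalerA.
have -> : transfer M' (0 +i w) i j - transfer M (0 +i w) i j
        - (a +i 0) * system_direction dD w i j =
   (((a +i 0) * (a +i 0)) *:
     (CB^T *m (S w *m dD *m (S w *m dD *m S')) *m CB)) i j.
  rewrite !transferE -/S' /= -/CB -/A -/(S w) scalemxAl scalemxAr -id2.
  rewrite !mulmxBr !mulmxBl -scalemxAr -scalemxAl /system_direction !mxE.
  by [].
apply: (le_trans (snorm_entry _ _ _)); rewrite snormZ normcM !normcR.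
rewrite -expr2 real_normK ?num_real // ler_wpM2l ?sqr_ge0 //.
have hS : snorm (S w) <= m by exact: resolvent_bound.
have hS' : snorm S' <= 2 * (c1 * k w).
  by apply: (le_trans bnd); rewrite ler_pM2l //; exact: resolvent_line_bound.
have p1 : snorm (S w *m dD) <= m * dn.
  by apply: (le_trans (snormM _ _)); rewrite ler_wpM2r.
have p2 : snorm (S w *m dD *m S') <= m * dn * (2 * (c1 * k w)).
  by apply: (le_trans (snormM _ _)); apply: ler_pM; rewrite ?snorm_ge0.
have p3 : snorm (S w *m dD *m (S w *m dD *m S')) <=
    m * dn * (m * dn * (2 * (c1 * k w))).
  by apply: (le_trans (snormM _ _)); apply: ler_pM; rewrite ?snorm_ge0.
have -> : bn * (m * dn * m * dn * (2 * c1)) * bn * k w =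
  bn * (m * dn * (m * dn * (2 * (c1 * k w)))) * bn by ring.
exact: (le_trans (snorm_congruence _ _ _)) (ler_wpM2r bn0 (ler_wpM2l bn0 p3)).
Qed.

(** [B] is unconstrained and enters quadratically: the expansion is exact, with remainder a^2 W^T S
    W, for every real [a]. *)
Lemma port_perturbation (W : 'M[R]_(r, n)) :
  exists C : R, 0 <= C /\ forall a : R, exists2 M' : @pH_model R n r, Sigma_pH M' &
    forall w i j, normc (transfer M' (0 +i w) i j - transfer M (0 +i w) i j
        - (a +i 0) * (port_direction_l (complexify W) w i j
           + port_direction_r (complexify W) w i j)) <= a ^+ 2 * (C * k w).
Proof.
pose wn := snorm (complexify W); have wn0 : 0 <= wn by exact: snorm_ge0.
exists (wn * c1 * wn); split; first by rewrite mulr_ge0 // mulr_ge0 // modal_constant_ge0.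
move=> a; exists (PHModel J Rh (B + a *: W)); first by case: sM => ? ? ? ?; split.
move=> w i j; set X := complexify W.
have -> : transfer (PHModel J Rh (B + a *: W)) (0 +i w) i j - transfer M (0 +i w) i j
        - (a +i 0) * (port_direction_l X w i j + port_direction_r X w i j) =
   (((a +i 0) * (a +i 0)) *: (X^T *m S w *m X)) i j.
  rewrite !transferE /= -/A -/(S w) complexifyD complexifyZ -/CB -/X.
  rewrite /port_direction_l /port_direction_r.
  have -> : (CB + (a +i 0) *: X)^T = CB^T + (a +i 0) *: X^T.
    by apply/matrixP => ? ?; rewrite !mxE.
  rewrite !mulmxDl !mulmxDr -!scalemxAl -!scalemxAr scalerA.
  move: (CB^T *m S w *m CB) (X^T *m S w *m CB) (CB^T *m S w *m X) (X^T *m S w *m X).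
  by move=> U1 U2 U3 U4; rewrite !mxE; ring.
apply: (le_trans (snorm_entry _ _ _)); rewrite snormZ normcM !normcR.
rewrite -expr2 real_normK ?num_real // ler_wpM2l ?sqr_ge0 //.
have -> : wn * c1 * wn * k w = wn * (c1 * k w) * wn by ring.
apply: (le_trans (snorm_congruence _ _ _)); rewrite ler_wpM2r // ler_wpM2l //.
exact: resolvent_line_bound.
Qed.

End Perturbation.

(** * Interpolation conditions *)

Section CauchyDouble.
Variable R : realType.
Notation mu := (@lebesgue_measure R).
Variables (f : R[i] -> R[i]) (K : R) (b : R -> R[i]).
Hypothesis holo_f : forall z, 0 < Re z -> holo_at f z.
Hypothesis line_f : forall x, 0 < x ->
  (\int[mu]_w (normc (f (x +i w)) ^+ 2)%:E <= K%:E)%E.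
Hypothesis hb : boundary_data f b.
Implicit Types p q : R[i].

Let ker p (w : R) : R[i] := (p - (0 +i w))^-1.

Lemma axis_kernel_neq0 p w : 0 < Re p -> p - (0 +i w) != 0.
Proof. by move=> p0; rewrite subr_eq0; apply/eqP => E; rewrite E ltxx in p0. Qed.

Lemma axis_kernel_L2 p : 0 < Re p -> exists C, L2_bounded (ker p) C.
Proof. by move=> p0; exists (pi / (Re p - 0)); exact: line_kernel_L2. Qed.

Lemma boundary_kernel_integrable p : 0 < Re p ->
  cintegrable setT (fun w => b w * ker p w).
Proof.
move=> /axis_kernel_L2[C hC]; apply: L2_prod_integrable hC.
exact: (boundary_L2 holo_f line_f hb).
Qed.

(** Partial fractions turn the product of kernels into a difference, to which [boundary_cauchy]
    applies twice. *)
Lemma cauchy_double p q : 0 < Re p -> 0 < Re q -> p != q ->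
  cint setT (fun w => b w * (ker p w * ker q w)) =
  ((2 * pi) +i 0) * ((f q - f p) / (p - q)).
Proof.
move=> p0 q0 pq; have pq0 : p - q != 0 by rewrite subr_eq0.
rewrite (@eq_cint _ _ _ (fun w => (p - q)^-1 * (b w * ker q w - b w * ker p w))); last first.
  move=> w _; rewrite /ker; field.
  by rewrite pq0 !axis_kernel_neq0.
have i1 := boundary_kernel_integrable p0; have i2 := boundary_kernel_integrable q0.
rewrite cintZ //; last exact: cintegrableB.
rewrite cintB // !(boundary_cauchy holo_f line_f hb) //; ring.
Qed.

Lemma axis_kernel_bound p q w : 0 < Re p -> Re p <= Re q -> normc (ker q w) <= (Re p)^-1.
Proof.
move=> p0 pq; have q0 : 0 < Re q by exact: lt_le_trans pq.
rewrite /ker normcV lef_pV2 ?posrE ?normc_gt0 ?axis_kernel_neq0 //.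
apply: le_trans (Re_le_normc _); rewrite (_ : Re (q - _) = Re q); last first.
  by case: (q) => ? ?; rewrite /GRing.opp /GRing.add /= subr0.
by rewrite (le_trans pq) // ler_norm.
Qed.

(** Limit of [cauchy_double] as the second node approaches [p] horizontally from the right. On that
    side its kernel is bounded by 1 / Re p, which gives the uniform L^2 bound for weak convergence.
    The sign comes from the denominator p - q. *)
Lemma cauchy_derivative p l : 0 < Re p -> cderiv f p l ->
  cint setT (fun w => b w * (ker p w * ker p w)) = ((2 * pi) +i 0) * - l.
Proof.
move=> p0 hl; pose h m : R := m.+1%:R^-1; have h0 m : 0 < h m by rewrite invr_gt0.
pose q m := p + ((h m) +i 0).
have Rq m : Re (q m) = Re p + h m by rewrite /q; case: (p).
have q0 m : 0 < Re (q m) by rewrite Rq addr_gt0.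
have pq m : Re p <= Re (q m) by rewrite Rq lerDl ltW.
have hn m : (h m) +i 0 != 0 :> R[i] by rewrite -normc_gt0 normcR gtr0_norm.
have pnq m : p != q m by rewrite /q -subr_eq0 opprD addNKr oppr_eq0.
have bL := boundary_L2 holo_f line_f hb.
have [C kL] := axis_kernel_L2 p0.
have ip : 0 <= (Re p)^-1 by rewrite invr_ge0 ltW.
have hF m : L2_bounded (fun w => b w * ker (q m) w) ((Re p)^-1 ^+ 2 * K).
  have [D [mk _]] := axis_kernel_L2 (q0 m).
  apply: (L2_bounded_le bL) => //; first by apply: cmeasM; [case: bL|].
  by move=> w; rewrite normcM mulrC ler_wpM2r ?normc_ge0 // axis_kernel_bound.
have mG : cmeas (fun w => b w * ker p w) by apply: cmeasM; [case: bL|case: kL].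
have hsmall (e : R) : 0 < e -> exists N, forall m, (N <= m)%N -> h m < e.
  move=> e0; exists (Num.truncn e^-1) => m Nm.
  rewrite /h -[ltRHS]invrK ltf_pV2 ?posrE ?invr_gt0 //.
  by apply: lt_le_trans (truncnS_gt _) _; rewrite ler_nat ltnS.
have cF : {ae mu, forall w, normc (b w * ker (q m) w - b w * ker p w) @[m --> \oo] --> 0}.
  apply: aeW => w; apply/cvgrPdist_lt => e e0.
  pose B := normc (b w) * ((Re p)^-1 * (Re p)^-1) + 1.
  have B0 : 0 < B by rewrite ltr_wpDl // mulr_ge0 ?mulr_ge0 // normc_ge0.
  have [N hN] := hsmall (e / B) (divr_gt0 e0 B0).
  exists N => // m /= /hN; rewrite ltr_pdivlMr // => hm.
  rewrite sub0r normrN (ger0_norm (normc_ge0 _)).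
  have -> : b w * ker (q m) w - b w * ker p w =
      - (((h m) +i 0) * (b w * (ker (q m) w * ker p w))).
    have := @axis_kernel_neq0 _ w (q0 m); rewrite /ker /q => n1.
    by field; rewrite n1 axis_kernel_neq0.
  rewrite normcN !normcM normcR gtr0_norm //; apply: le_lt_trans hm.
  rewrite ler_pM2l // /B; apply: (@le_trans _ _ (normc (b w) * ((Re p)^-1 * (Re p)^-1))).
    rewrite ler_wpM2l ?normc_ge0 //; apply: ler_pM; rewrite ?normc_ge0 //;
    by rewrite axis_kernel_bound.
  by rewrite lerDl.
apply/eqP; rewrite -subr_eq0 -normc_eq0 eq_le normc_ge0 andbT.
apply/ler_addgt0Pr => e e0; rewrite add0r; have e20 : 0 < e / 2 by rewrite divr_gt0.
have [N1 hN1] := cint_weak_cvg hF mG cF kL e20.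
have pi0 : 0 < 2 * pi :> R by rewrite mulr_gt0 // pi_gt0.
have e'0 : 0 < e / 2 / (2 * pi) by rewrite divr_gt0.
have [d d0 hd] := hl _ e'0; have [N2 hN2] := hsmall d d0.
pose m := maxn N1 N2; have := hN1 m (leq_maxl _ _); have hm := hN2 m (leq_maxr _ _).
rewrite (@eq_cint _ _ (fun w => b w * ker (q m) w * ker p w)
  (fun w => b w * (ker p w * ker (q m) w))); last by move=> w _; ring.
rewrite (@eq_cint _ _ (fun w => b w * ker p w * ker p w)
  (fun w => b w * (ker p w * ker p w))); last by move=> w _; ring.
rewrite cauchy_double //; set I := cint _ _ => k1.
have k2 : normc (((2 * pi) +i 0) * ((f (q m) - f p) / (p - q m))
    - ((2 * pi) +i 0) * - l) <= e / 2.
  have -> : ((2 * pi) +i 0) * ((f (q m) - f p) / (p - q m))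
    - ((2 * pi) +i 0) * - l =
    - (((2 * pi) +i 0) * ((f (q m) - f p - l * ((h m) +i 0)) / ((h m) +i 0))).
    rewrite (_ : p - q m = - ((h m) +i 0)); last by rewrite /q opprD addNKr.
    by field.
  rewrite normcN !normcM normcV !normcR (gtr0_norm pi0) (gtr0_norm (h0 m)).
  rewrite mulrA ler_pdivrMr // mulrC -ler_pdivlMr //.
  rewrite (_ : e / 2 * h m / (2 * pi) = e / 2 / (2 * pi) * h m); last by rewrite mulrAC.
  have := hd ((h m) +i 0); rewrite normcR (gtr0_norm (h0 m)); exact.
rewrite normc_distrC in k1.
have -> : I - ((2 * pi) +i 0) * - l = (I - ((2 * pi) +i 0) * ((f (q m) - f p) / (p - q m)))
  + (((2 * pi) +i 0) * ((f (q m) - f p) / (p - q m)) - ((2 * pi) +i 0) * - l) by ring.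
apply: (le_trans (normcD _ _)); lra.
Qed.

End CauchyDouble.

(** * Conjugation and functions of a real matrix *)

Section ConjugateSymmetry.
Variable R : realType.

Lemma Re_conj (z : R[i]) : Re z^* = Re z.
Proof. by case: z. Qed.

Lemma conj_realC (x : R) : (x +i 0)^* = x +i 0 :> R[i].
Proof. exact: conjc_real. Qed.

Lemma conjM (x y : R[i]) : (x * y)^* = x^* * y^*.
Proof. exact: rmorphM. Qed.

Lemma conjN (x : R[i]) : (- x)^* = - x^*.
Proof. exact: rmorphN. Qed.

Lemma conjB (x y : R[i]) : (x - y)^* = x^* - y^*.
Proof. exact: rmorphB. Qed.

Lemma conjV (x : R[i]) : (x^-1)^* = (x^*)^-1.
Proof. exact: fmorphV. Qed.

Lemma conj_sum (K : finType) (u : K -> R[i]) : (\sum_a u a)^* = \sum_a (u a)^*.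
Proof. exact: rmorph_sum. Qed.

(** [u] and [v] will be the pairings with the real and imaginary parts of a direction, [x] and [x']
    those with the direction and its conjugate. As [u] and [v] are imaginary, x' is minus the
    conjugate of x; being also the conjugate, it vanishes. *)
Lemma imaginary_combination_eq0 (u v x x' : R[i]) : Re u = 0 -> Re v = 0 ->
  x = u + (0 +i 1)^* * v -> x' = u + (0 +i (-1))^* * v -> x' = x^* -> x = 0.
Proof.
case: u v => [a1 a2] [b1 b2] /= -> -> -> ->.
rewrite /GRing.mul /GRing.add /= => -[h1 h2]; apply/eqP; rewrite eq_complex /=.
by apply/andP; split; apply/eqP; lra.
Qed.

Lemma cderiv_unique (f : R[i] -> R[i]) z l k : cderiv f z l -> cderiv f z k -> l = k.
Proof.
move=> hl hk; apply/eqP; rewrite -subr_eq0 -normc_eq0 eq_le normc_ge0 andbT.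
apply/ler_addgt0Pr => e e0; rewrite add0r; have e20 : 0 < e / 2 by rewrite divr_gt0.
have [d1 d10 h1] := hl _ e20; have [d2 d20 h2] := hk _ e20.
pose r := Num.min d1 d2 / 2; have r0 : 0 < r by rewrite divr_gt0 // lt_min d10.
have rd : r < Num.min d1 d2 by rewrite ltr_pdivrMr // ltr_pMr ?lt_min ?d10 // ltr1n.
move: rd; rewrite lt_min => /andP[rd1 rd2].
have := h1 (r +i 0); have := h2 (r +i 0); rewrite normcR gtr0_norm //.
move=> /(_ rd2) k2 /(_ rd1) k1.
rewrite -(ler_pM2r r0) -{1}(gtr0_norm r0) -normcR -normcM.
rewrite (_ : (l - k) * _ = (f (z + (r +i 0)) - f z - k * (r +i 0))
  - (f (z + (r +i 0)) - f z - l * (r +i 0))); last by ring.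
apply: (le_trans (normcB_le _ _)); lra.
Qed.

Lemma cderiv_conj (f : R[i] -> R[i]) z l : 0 < Re z ->
  (forall z, 0 < Re z -> f z^* = (f z)^*) -> cderiv f z l -> cderiv f z^* l^*.
Proof.
move=> z0 sf hl e e0; have [d d0 hd] := hl _ e0.
exists (Num.min d (Re z)) => [|h]; first by rewrite lt_min d0.
rewrite lt_min => /andP[h1 h2].
have zh : 0 < Re (z + h^*).
  rewrite (_ : Re (z + h^*) = Re z + Re h); last by case: (z) h {h1 h2} => ? ? [].
  by have := Re_le_normc h; rewrite ler_norml => /andP[? _]; lra.
rewrite sf // (_ : z^* + h = (z + h^*)^*); last by rewrite rmorphD /= conjCK.
rewrite sf // -[h in _ * h]conjCK -rmorphB -rmorphM -rmorphB normc_conj.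
by rewrite -[normc h]normc_conj; apply: hd; rewrite normc_conj.
Qed.

Lemma complexify_conj m n (X : 'M[R]_(m, n)) : (complexify X) ^ Num.conj = complexify X.
Proof. by apply/matrixP => i j; rewrite !mxE; exact: conjc_real. Qed.

Lemma transfer_conj n r (M : @pH_model R n r) z :
  transfer M z^* = (transfer M z) ^ Num.conj.
Proof.
rewrite !transferE /resolvent !map_mxM map_invmx map_mxB map_scalar_mx map_trmx.
by rewrite !complexify_conj.
Qed.

(* Both [T] and its entrywise conjugate diagonalise the real matrix [A]; the
   change of basis between them only links equal eigenvalues. *)
Lemma functional_calculus_real r (A T : 'M[R[i]]_r) (lambda : 'I_r -> R[i])
    (f : R[i] -> R[i]) : A ^ Num.conj = A -> eigenvector_matrix A T lambda ->
  (forall i, f (lambda i)^* = (f (lambda i))^*) ->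
  let F := T *m diag_mx (\row_i f (lambda i)) *m invmx T in F ^ Num.conj = F.
Proof.
move=> rA eT hf F; have [uT _] := eT; have AT := eigenvector_matrixE eT.
pose U := T ^ Num.conj; have uU : U \in unitmx by rewrite map_unitmx.
pose P := invmx T *m U.
have AU : A *m U = U *m diag_mx (\row_i (lambda i)^*).
  rewrite -{1}rA -map_mxM AT map_mxM; congr (_ *m _).
  by apply/matrixP => i j; rewrite !mxE; case: eqP => _; rewrite ?mulr0n ?rmorph0.
have DP : diag_mx (\row_i lambda i) *m P = P *m diag_mx (\row_i (lambda i)^*).
  rewrite /P -mulmxA -AU !mulmxA; congr (_ *m _).
  have -> : diag_mx (\row_i lambda i) = invmx T *m (A *m T) by rewrite AT mulKmx.
  by rewrite mulmxA mulmxK.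
have fP : diag_mx (\row_i f (lambda i)) *m P = P *m diag_mx (\row_i (f (lambda i))^*).
  move: (P) DP => Q DQ; apply/matrixP => i j; have /matrixP/(_ i j) := DQ.
  rewrite !mul_diag_mx !mul_mx_diag !mxE => E.
  have [Q0|Q0] := eqVneq (Q i j) 0; first by rewrite Q0 mulr0 mul0r.
  have -> : lambda i = (lambda j)^* by apply: (mulIf Q0); rewrite E mulrC.
  by rewrite hf mulrC.
have DE : map_mx Num.conj (diag_mx (\row_i f (lambda i))) = diag_mx (\row_i (f (lambda i))^*).
  by apply/matrixP => i j; rewrite !mxE; case: eqP => _; rewrite ?mulr0n ?rmorph0.
have TP : T *m P = U by rewrite /P mulKVmx.
rewrite /F; move: (diag_mx (\row_i f (lambda i))) (diag_mx (\row_i (f (lambda i))^*)) fP DE.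
move=> D D' fP DE; rewrite 2!map_mxM DE map_invmx -/U.
have E : U *m D' = T *m D *m invmx T *m U.
  by rewrite -[RHS]mulmxA -[RHS]mulmxA -/P fP mulmxA TP.
by rewrite E; exact: mulmxK.
Qed.

End ConjugateSymmetry.

Section MatrixFunctions.
Variable R : realType.

Definition mxmeas m n (F : R -> 'M[R[i]]_(m, n)) : Prop :=
  forall i j, cmeas (fun w => F w i j).

Lemma cmeas_sum (I : eqType) (s : seq I) (F : I -> R -> R[i]) :
  (forall i, cmeas (F i)) -> cmeas (fun w => \sum_(i <- s) F i w).
Proof.
move=> hF; elim: s => [|i s ih].
  rewrite (_ : (fun w => _) = fun=> 0); first exact: cmeas_cst.
  by apply/funext => w; rewrite big_nil.
rewrite (_ : (fun w => _) = (fun w => F i w + \sum_(i <- s) F i w)).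
  exact: cmeasD.
by apply/funext => w; rewrite big_cons.
Qed.

Lemma mxmeasM m n p (F : R -> 'M[R[i]]_(m, n)) (G : R -> 'M[R[i]]_(n, p)) :
  mxmeas F -> mxmeas G -> mxmeas (fun w => F w *m G w).
Proof.
move=> hF hG i j; rewrite (_ : (fun w => _) = (fun w => \sum_k F w i k * G w k j)).
  by apply: cmeas_sum => k; exact: cmeasM.
by apply/funext => w; rewrite mxE.
Qed.

Lemma mxmeas_cst m n (X : 'M[R[i]]_(m, n)) : mxmeas (fun=> X).
Proof. by move=> i j; exact: cmeas_cst. Qed.

Lemma cderivN (f : R[i] -> R[i]) z l : cderiv f z l -> cderiv (fun w => - f w) z (- l).
Proof.
move=> h; have := cderivM (cderiv_cst (-1) z) h.
rewrite mul0r add0r mulN1r; congr cderiv; apply/funext => w; exact: mulN1r.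
Qed.

Lemma col_mulmx p q m (X : 'M[R[i]]_(p, q)) (Y : 'M[R[i]]_(q, m)) i :
  col i (X *m Y) = X *m col i Y.
Proof. by rewrite !colE mulmxA. Qed.

Lemma mx_entry_bilinear n (x y : 'cV[R[i]]_n) (X : 'M[R[i]]_n) :
  (x ^t* *m X *m y) 0 0 = \sum_i \sum_j (x i 0)^* * X i j * y j 0.
Proof.
rewrite mxE exchange_big /=; apply: eq_bigr => j _; rewrite mxE mulr_suml.
by apply: eq_bigr => i _; rewrite !mxE.
Qed.

Lemma Re_sum (I : Type) (s : seq I) (F : I -> R[i]) :
  Re (\sum_(i <- s) F i) = \sum_(i <- s) Re (F i).
Proof. by elim/big_rec2 : _ => // i x y _ <-; case: (F i) y => ? ? []. Qed.

Lemma cV_entry0 (x y : 'M[R[i]]_1) : x 0 0 = y 0 0 -> x = y.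
Proof. by move=> h; apply/matrixP => i j; rewrite !ord1. Qed.

End MatrixFunctions.

(** * Pairing of the error with the directions, and its consequences *)

Section ErrorPairing.
Variables (R : realType) (n r : nat) (H : R[i] -> 'M[R[i]]_n).
Notation mu := (@lebesgue_measure R).
Variables (J Rh : 'M[R]_r) (B : 'M[R]_(r, n)).
Variables (T : 'M[R[i]]_r) (lambda : 'I_r -> R[i]).
Let M := PHModel J Rh B.
Let A : 'M[R[i]]_r := complexify (J - Rh).
Let CB : 'M[R[i]]_(r, n) := complexify B.
Hypothesis hH : hardyH2 H.
Hypothesis symH : conj_symmetric H.
Hypothesis opt : H2_optimal H (@Sigma_pH R n r) M.
Hypothesis pd : pdmx Rh.
Hypothesis eT : eigenvector_matrix A T lambda.
Variable bv : 'I_n -> 'I_n -> R -> R[i].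
Hypothesis hbd : forall i j, boundary_data (fun z => H z i j) (bv i j).
Hypothesis b_bv : {ae mu, forall w, has_boundary_value H w /\
     forall i j, boundary_value H w i j = bv i j w}.

Let sM : Sigma_pH M := proj1 opt.

Let E z : 'M[R[i]]_n := H z - transfer M z.
Let e i j w : R[i] := bv i j w - transfer M (0 +i w) i j.
Let k := modal_bound lambda.

Lemma error_entry i j : (fun z => E z i j) = (fun z => H z i j + - transfer M z i j).
Proof. by apply/funext => z; rewrite !mxE. Qed.

Lemma error_cderiv z i j : 0 < Re z ->
  cderiv (fun w => E w i j) z ((derive1 H z - derive1 (transfer M) z) i j).
Proof.
move=> z0; rewrite error_entry.
have u : z%:M - pH_A M \in unitmx by apply: stable_unit => //; exact: ltW.
have hT := transfer_cderiv u; rewrite (cderiv_derive1 hT).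
have [dH _ _ _] := hH; have hd := derivable_cderiv (dH z z0) i j.
by rewrite [X in cderiv _ _ X]mxE [X in _ + X]mxE; exact: cderivD hd (cderivN (hT i j)).
Qed.

Lemma error_holo i j z : 0 < Re z -> holo_at (fun w => E w i j) z.
Proof. by move=> z0; eexists; exact: error_cderiv. Qed.

Lemma transfer_line_L2 : exists C, forall i j x, 0 <= x ->
  L2_bounded (fun w => transfer M (x +i w) i j) C.
Proof.
have [C hC] := modal_bound_L2 sM eT; pose bn := snorm CB.
pose D := bn * (snorm T * snorm (invmx T)) * bn.
have D0 : 0 <= D by rewrite !mulr_ge0 // snorm_ge0.
exists (D ^+ 2 * C) => i j x x0; apply: (L2_bounded_le hC) => //.
  apply: cmeas_ccont => w; apply: (ccont_vertical (f := fun z => transfer M z i j)).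
  apply: holo_at_continuous; eexists; apply: transfer_cderiv; exact: stable_unit.
move=> w; rewrite normcR (ger0_norm (modal_bound_ge0 lambda w)).
apply: (le_trans (snorm_entry _ _ _)); rewrite transferE.
apply: (le_trans (snorm_congruence _ _ _)).
have := resolvent_line_bound sM eT w x0 => h.
have bn0 : 0 <= bn by exact: snorm_ge0.
rewrite (_ : D * _ = bn * (snorm T * snorm (invmx T) * modal_bound lambda w) * bn).
  by rewrite ler_wpM2r // ler_wpM2l.
by rewrite /D; ring.
Qed.

Lemma error_line : exists K : R, forall i j x, 0 < x ->
  (\int[mu]_w (normc (E (x +i w) i j) ^+ 2)%:E <= K%:E)%E.
Proof.
have [K1 hK1] := hardy_line hH; have [C hC] := transfer_line_L2.
exists (2 * K1 + 2 * C) => i j x x0.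
have h1 := line_L2 (f := fun z => H z i j) (fun z => @hardy_holo _ _ _ hH i j z)
  (hK1 i j) x0.
have h2 : L2_bounded (fun w => - transfer M (x +i w) i j) C.
  have [m2 b2] := hC i j x (ltW x0); split; first exact: cmeasN.
  by under eq_integral => w _ do rewrite normcN.
have [_] := L2_boundedD h1 h2; congr (_ <= _)%E.
by apply: eq_integral => w _; rewrite !mxE.
Qed.

Lemma error_boundary i j : boundary_data (fun z => E z i j) (e i j).
Proof.
have ct w : ccontinuous_at (fun z => transfer M z i j) (0 +i w).
  apply: holo_at_continuous; eexists; apply: transfer_cderiv; exact: stable_unit.
have [mb cv] := hbd i j; split.
  apply: cmeasB => //; apply: cmeas_ccont => w.
  exact: (ccont_vertical (f := fun z => transfer M z i j)).
move: cv; apply: (@filterS _ _ (ae_filter_ringOfSetsType mu)) => w hw.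
apply/cvgrPdist_lt => d d0; have d20 : 0 < d / 2 by rewrite divr_gt0.
move/cvgrPdist_lt : hw => /(_ _ d20) [N1 _ hN1].
have [r0 r00 hr] := ct w _ d20.
exists (maxn N1 (Num.truncn r0^-1)) => // m /=; rewrite geq_max => /andP[m1 m2].
have := hN1 m m1; rewrite /= !sub0r !normrN !(ger0_norm (normc_ge0 _)) => k1.
have k2 : normc (transfer M (m.+1%:R^-1 +i w) i j - transfer M (0 +i w) i j) < d / 2.
  have := hr (m.+1%:R^-1 +i 0); rewrite normcR gtr0_norm ?invr_gt0 //.
  rewrite (_ : (0 +i w) + _ = m.+1%:R^-1 +i w); last by rewrite /GRing.add /= add0r addr0.
  apply; rewrite -[ltRHS]invrK ltf_pV2 ?posrE ?invr_gt0 //.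
  by apply: lt_le_trans (truncnS_gt _) _; rewrite ler_nat ltnS.
have -> : E (m.+1%:R^-1 +i w) i j - e i j w = (H (m.+1%:R^-1 +i w) i j - bv i j w)
   - (transfer M (m.+1%:R^-1 +i w) i j - transfer M (0 +i w) i j).
  by rewrite /E /e !mxE; ring.
by apply: (le_lt_trans (normcB_le _ _)); lra.
Qed.

Lemma error_conj z i j : 0 < Re z -> E z^* i j = (E z i j)^*.
Proof. by move=> z0; rewrite /E symH // transfer_conj !mxE rmorphB. Qed.

Lemma error_L2 : exists C, forall i j, L2_bounded (e i j) C.
Proof.
have [K hK] := error_line; exists K => i j.
exact: (boundary_L2 (fun z => @error_holo i j z) (hK i j) (error_boundary i j)).
Qed.

Definition L2_direction (D : R -> 'M[R[i]]_n) : Prop :=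
  forall i j, exists C, L2_bounded (fun w => D w i j) C.

(** 2 pi times the H_2 inner product of the error with [D], conjugate linear in [D]. *)
Definition pairing (D : R -> 'M[R[i]]_n) : R[i] :=
  \sum_i \sum_j cint setT (fun w => e i j w * (D w i j)^*).

Lemma pairing_integrable D i j : L2_direction D ->
  cintegrable setT (fun w => e i j w * (D w i j)^*).
Proof.
move=> /(_ i j)[C [mD hC]]; have [C' hC'] := error_L2.
apply: (L2_prod_integrable (D := C) (hC' i j)); split; first exact: cmeas_conj.
by under eq_integral => w _ do rewrite normc_conj.
Qed.

Lemma pairingD D D' : L2_direction D -> L2_direction D' ->
  pairing (fun w => D w + D' w) = pairing D + pairing D'.
Proof.
move=> hD hD'; rewrite /pairing -big_split; apply: eq_bigr => i _ /=.
rewrite -big_split; apply: eq_bigr => j _ /=.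
rewrite -cintD //; try exact: pairing_integrable.
by apply: eq_cint => w _; rewrite mxE rmorphD mulrDr.
Qed.

Lemma pairingZ a D : L2_direction D -> pairing (fun w => a *: D w) = a^* * pairing D.
Proof.
move=> hD; rewrite /pairing mulr_sumr; apply: eq_bigr => i _.
rewrite mulr_sumr; apply: eq_bigr => j _.
rewrite -cintZ //; last exact: pairing_integrable.
by apply: eq_cint => w _; rewrite mxE rmorphM mulrCA.
Qed.

Lemma resolvent_axis_meas : mxmeas (fun w => resolvent A (0 +i w)).
Proof.
rewrite (_ : (fun w => _) = (fun w => T *m
  diag_mx (\row_i ((0 +i w) - lambda i)^-1) *m invmx T)); last first.
  apply/funext => w; apply: resolvent_spectral => // i.
  exact: (eigenvalue_neq sM eT).
apply: mxmeasM; last exact: mxmeas_cst.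
apply: mxmeasM; first exact: mxmeas_cst.
move=> i j; have [mk _] := modal_kernel_L2 sM eT j.
have [->|ij] := eqVneq i j.
  by congr cmeas : mk; apply/funext => w; rewrite !mxE eqxx mulr1n.
have := cmeas_cst (0 : R[i]); congr cmeas; apply/funext => w.
by rewrite !mxE (negbTE ij) mulr0n.
Qed.

Lemma congruence_L2 (X Z : 'M[R[i]]_(r, n)) (Y : R -> 'M[R[i]]_r) D :
  mxmeas Y -> 0 <= D -> (forall w, snorm (Y w) <= D * k w) ->
  L2_direction (fun w => X^T *m Y w *m Z).
Proof.
move=> mY D0 hY i j.
apply: (L2_of_modal_bound sM eT (D := snorm X * D * snorm Z)).
- by apply: mxmeasM; [apply: mxmeasM => //; exact: mxmeas_cst|exact: mxmeas_cst].
- by rewrite !mulr_ge0 // snorm_ge0.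
- move=> w; apply: (le_trans (snorm_entry _ _ _)).
  apply: (le_trans (snorm_congruence _ _ _)).
  rewrite (_ : snorm X * D * snorm Z * _ = snorm X * (D * k w) * snorm Z).
    by rewrite ler_wpM2r ?snorm_ge0 // ler_wpM2l ?snorm_ge0.
  by rewrite /k; ring.
Qed.

Let c1 := snorm T * snorm (invmx T).
Let c10 : 0 <= c1 := modal_constant_ge0 T.

Lemma resolvent_axis_bound w : snorm (resolvent A (0 +i w)) <= c1 * k w.
Proof. exact: (resolvent_line_bound sM eT). Qed.

Lemma system_direction_L2 X : L2_direction (system_direction J Rh B X).
Proof.
have mS := resolvent_axis_meas.
have [m0 m00 hm] : exists2 m0, 0 <= m0 & forall w, snorm (resolvent A (0 +i w)) <= m0.
  exists (c1 * \sum_i `|Re (lambda i)|^-1); first exact: (resolvent_bound_ge0 sM eT).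
  by move=> w; apply: (resolvent_bound sM eT).
rewrite /system_direction.
apply: (@congruence_L2 CB CB (fun w => resolvent A (0 +i w) *m X *m resolvent A (0 +i w))
  (m0 * snorm X * c1)).
- by apply: mxmeasM => //; apply: mxmeasM => //; exact: mxmeas_cst.
- by rewrite !mulr_ge0 // snorm_ge0.
- move=> w; apply: (le_trans (snormM _ _)); rewrite -mulrA.
  apply: ler_pM; rewrite ?snorm_ge0 //; last exact: resolvent_axis_bound.
  by apply: (le_trans (snormM _ _)); rewrite ler_wpM2r ?snorm_ge0.
Qed.

Lemma port_direction_l_L2 W : L2_direction (port_direction_l J Rh B W).
Proof.
exact: (congruence_L2 W CB resolvent_axis_meas c10 resolvent_axis_bound).
Qed.

Lemma port_direction_r_L2 W : L2_direction (port_direction_r J Rh B W).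
Proof.
exact: (congruence_L2 CB W resolvent_axis_meas c10 resolvent_axis_bound).
Qed.

Lemma L2_direction_uniform D C : L2_direction D -> exists C', C <= C' /\
  forall i j, L2_bounded (fun w => D w i j) C'.
Proof.
move=> hD; pose c i j := sval (cid (hD i j)).
have hc i j : L2_bounded (fun w => D w i j) (c i j) by rewrite /c; case: cid.
exists (`|C| + \sum_i \sum_j `|c i j|); split.
  rewrite (le_trans (ler_norm C)) // lerDl sumr_ge0 // => i _.
  by rewrite sumr_ge0.
move=> i j; have [mD bD] := hc i j; split => //; apply: (le_trans bD).
rewrite lee_fin (le_trans (ler_norm _)) // -[leLHS]add0r lerD //.
rewrite (bigD1 i) //= (bigD1 j) //= -addrA lerDl addr_ge0 // sumr_ge0 // => l _.
by rewrite sumr_ge0.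
Qed.

Lemma pairing_stationary D C e0 : L2_direction D -> 0 <= C -> 0 < e0 ->
  (forall a : R, `|a| <= e0 -> exists2 M' : @pH_model R n r, Sigma_pH M' &
    forall w i j, normc (transfer M' (0 +i w) i j - transfer M (0 +i w) i j
        - (a +i 0) * D w i j) <= a ^+ 2 * (C * k w)) ->
  Re (pairing D) = 0.
Proof.
move=> hD C0 e00 hM'; have [Ce hCe] := error_L2.
have [C' [CC hC']] := L2_direction_uniform Ce hD.
have he i j : L2_bounded (e i j) C'.
  by have [me be] := hCe i j; split => //; apply: (le_trans be); rewrite lee_fin.
have k0 w : 0 <= C * k w by rewrite mulr_ge0 // modal_bound_ge0.
have ik : mu.-integrable setT (EFin \o (fun w => (C * k w) ^+ 2)).
  have := integrable_scale (C ^+ 2) measurableT (modal_bound_sqr_integrable sM eT).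
  by apply: eq_integrable => // w _ /=; rewrite exprMn.
have := first_order opt b_bv he hC' k0 ik e00 hM' => S0.
by rewrite /pairing Re_sum -[RHS]S0; apply: eq_bigr => i _; rewrite Re_sum.
Qed.

Lemma pairing_system_real (X : 'M[R]_r) :
  Re (pairing (system_direction J Rh B (complexify X))) = 0.
Proof.
have [C [e0 [C0 e00 h]]] := system_perturbation sM eT X pd.
exact: (pairing_stationary (@system_direction_L2 _) C0 e00 h).
Qed.

Lemma pairing_port_real (W : 'M[R]_(r, n)) :
  Re (pairing (port_direction_l J Rh B (complexify W))
      + pairing (port_direction_r J Rh B (complexify W))) = 0.
Proof.
have [C [C0 h]] := port_perturbation sM eT W.
rewrite -pairingD; [|exact: port_direction_l_L2|exact: port_direction_r_L2].
apply: (pairing_stationary _ C0 ltr01).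
  move=> i j; have [c1' h1] := @port_direction_l_L2 (complexify W) i j.
  have [c2' h2] := @port_direction_r_L2 (complexify W) i j.
  exists (2 * c1' + 2 * c2'); have := L2_boundedD h1 h2.
  by congr L2_bounded; apply/funext => w; rewrite [RHS]mxE.
move=> a _; have [M' sM' hM'] := h a; exists M' => // w i j.
by rewrite [X in (a +i 0) * X]mxE; exact: hM'.
Qed.

(** One name for two evaluations: a divided difference of the error at distinct nodes, its
    derivative at equal ones. *)
Definition double_kernel_integral i j p q : R[i] :=
  cint setT (fun w => e i j w * ((p - (0 +i w))^-1 * (q - (0 +i w))^-1)).
Let I := double_kernel_integral.

Lemma double_kernel_integrable i j p q : 0 < Re p -> 0 < Re q ->
  cintegrable setT (fun w => e i j w * ((p - (0 +i w))^-1 * (q - (0 +i w))^-1)).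
Proof.
move=> p0 q0; have [C hC] := error_L2.
have [D hD] := axis_kernel_L2 p0; have [D' hD'] := axis_kernel_L2 q0.
have iq : 0 <= (Re q)^-1 by rewrite invr_ge0 ltW.
apply: (L2_prod_integrable (D := (Re q)^-1 ^+ 2 * D) (hC i j)).
apply: (L2_bounded_le hD) => //; first by apply: cmeasM; [case: hD|case: hD'].
move=> w; rewrite normcM mulrC ler_wpM2r ?normc_ge0 //.
exact: (axis_kernel_bound w q0 (lexx _)).
Qed.

Lemma double_kernel_integral_neq i j p q : 0 < Re p -> 0 < Re q -> p != q ->
  I i j p q = ((2 * pi) +i 0) * ((E q i j - E p i j) / (p - q)).
Proof.
have [K hK] := error_line.
exact: (cauchy_double (fun z => @error_holo i j z) (hK i j) (error_boundary i j)).
Qed.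

Lemma double_kernel_integral_eq i j p : 0 < Re p ->
  I i j p p = ((2 * pi) +i 0) * - ((derive1 H p - derive1 (transfer M) p) i j).
Proof.
have [K hK] := error_line => p0.
exact: (cauchy_derivative (fun z => @error_holo i j z) (hK i j) (error_boundary i j)
  p0 (error_cderiv i j p0)).
Qed.

(** The symmetry is inherited from the error; for equal nodes, uniqueness of the derivative
    transfers it to the derivative of the error. *)
Lemma double_kernel_integral_conj i j p q : 0 < Re p -> 0 < Re q ->
  I i j p^* q^* = (I i j p q)^*.
Proof.
move=> p0 q0; have p0' : 0 < Re p^* by rewrite Re_conj.
have q0' : 0 < Re q^* by rewrite Re_conj.
have [<-|pq] := eqVneq p q.
  rewrite !double_kernel_integral_eq // conjM conj_realC conjN; congr (_ * - _).
  apply: (cderiv_unique (error_cderiv i j p0')).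
  by apply: (cderiv_conj p0 _ (error_cderiv i j p0)) => z; exact: error_conj.
rewrite !double_kernel_integral_neq //; last first.
  by apply: contra pq => /eqP/(can_inj conjCK)/eqP.
have quot (a : R) (u v u' v' : R[i]) : u' = u^* -> v' = v^* ->
    (a +i 0) * ((v' - u') / (p^* - q^*)) = ((a +i 0) * ((v - u) / (p - q)))^*.
  by move=> -> ->; rewrite conjM conj_realC [((v - u) / _)^*]conjM conjV !conjB.
exact: quot (error_conj i j p0) (error_conj i j q0).
Qed.

Lemma resolvent_right_eigenvector w (x : 'cV[R[i]]_r) l : A *m x = l *: x -> Re l < 0 ->
  resolvent A (0 +i w) *m x = ((0 +i w) - l)^-1 *: x.
Proof.
move=> Ax l0; have u := resolvent_unit sM (z := 0 +i w) (lexx 0).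
have zl : (0 +i w) - l != 0.
  by rewrite subr_eq0; apply/eqP => El; move: l0; rewrite -El ltxx.
have := mulKmx u x; rewrite mulmxBl Ax mul_scalar_mx -scalerBl -scalemxAr => h.
by rewrite -[in RHS]h scalerA mulVf // scale1r.
Qed.

Lemma resolvent_left_eigenvector w (y : 'rV[R[i]]_r) l : y *m A = l *: y -> Re l < 0 ->
  y *m resolvent A (0 +i w) = ((0 +i w) - l)^-1 *: y.
Proof.
move=> Ay l0; have u := resolvent_unit sM (z := 0 +i w) (lexx 0).
have zl : (0 +i w) - l != 0.
  by rewrite subr_eq0; apply/eqP => El; move: l0; rewrite -El ltxx.
have := mulmxK u y; rewrite mulmxBr Ay mul_mx_scalar -scalerBl -scalemxAl => h.
by rewrite -[in RHS]h scalerA mulVf // scale1r.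
Qed.

(** On the axis the conjugate of a modal kernel is the Cauchy kernel at the mirror image of [l], a
    point of the right half-plane when [l] is stable. This is why [H] is evaluated at mirror images
    of the poles. *)
Lemma conj_kernel w (l : R[i]) : (((0 +i w) - l)^-1)^* = (- l^* - (0 +i w))^-1.
Proof.
rewrite conjV; congr (_^-1); rewrite conjB addrC; congr (_ + _).
by rewrite /GRing.opp /= oppr0.
Qed.

Lemma adjoint_real (W : 'M[R]_(r, n)) (y : 'cV[R[i]]_r) :
  y ^t* *m complexify W = ((complexify W)^T *m y) ^t*.
Proof. by rewrite trmx_mul trmxK map_mxM complexify_conj. Qed.

(** On eigenvectors both resolvents act as scalars, so the direction is a constant rank-one matrix
    times two modal kernels. *)
Lemma pairing_rank1 (x y : 'cV[R[i]]_r) l v : A *m x = l *: x ->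
  y ^t* *m A = v *: y ^t* -> Re l < 0 -> Re v < 0 ->
  pairing (system_direction J Rh B (x *m y ^t*)) =
  \sum_i \sum_j ((CB^T *m x) i 0)^* * I i j (- l^*) (- v^*) * (CB^T *m y) j 0.
Proof.
move=> Ax yA l0 v0; apply: eq_bigr => i _; apply: eq_bigr => j _.
have Rl (z : R[i]) : Re z < 0 -> 0 < Re (- z^*).
  by case: z => a c /= a0; rewrite oppr_gt0.
have ii := double_kernel_integrable i j (Rl _ l0) (Rl _ v0).
rewrite mulrAC -cintZ //; apply: eq_cint => w _.
have -> : system_direction J Rh B (x *m y ^t*) w =
    (((0 +i w) - l)^-1 * ((0 +i w) - v)^-1) *: ((CB^T *m x) *m (CB^T *m y) ^t*).
  transitivity (CB^T *m (resolvent A (0 +i w) *m x) *m (y ^t* *m resolvent A (0 +i w)) *m CB).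
    by rewrite /system_direction !mulmxA.
  rewrite (resolvent_right_eigenvector w Ax l0) (resolvent_left_eigenvector w yA v0).
  rewrite -!scalemxAr -!scalemxAl scalerA -(mulmxA _ _ CB) (adjoint_real B y).
  by rewrite mulrC.
rewrite mxE !conjM !conj_kernel mxE big_ord1 !mxE conjM conjCK; ring.
Qed.

(** Since A is real, the conjugates of [x] and [y] are eigenvectors for the conjugate eigenvalues.
    The conjugate direction is thus of the same kind, and [double_kernel_integral_conj] compares the
    two values. *)
Lemma pairing_rank1_conj (x y : 'cV[R[i]]_r) l v : A *m x = l *: x ->
  y ^t* *m A = v *: y ^t* -> Re l < 0 -> Re v < 0 ->
  pairing (system_direction J Rh B (map_mx Num.conj (x *m y ^t*))) =
  (pairing (system_direction J Rh B (x *m y ^t*)))^*.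
Proof.
move=> Ax yA l0 v0; have rA : map_mx Num.conj A = A by exact: complexify_conj.
have rB : map_mx Num.conj CB^T = CB^T by rewrite map_trmx complexify_conj.
have Ax' : A *m map_mx Num.conj x = l^* *: map_mx Num.conj x.
  by rewrite -{1}rA -map_mxM Ax map_mxZ.
have yA' : (map_mx Num.conj y) ^t* *m A = v^* *: (map_mx Num.conj y) ^t*.
  by rewrite map_trmx -{1}rA -map_mxM yA map_mxZ.
have -> : map_mx Num.conj (x *m y ^t*) =
    map_mx Num.conj x *m (map_mx Num.conj y) ^t*.
  by rewrite map_mxM map_trmx.
have l0' : Re l^* < 0 by rewrite Re_conj.
have v0' : Re v^* < 0 by rewrite Re_conj.
apply: (etrans (pairing_rank1 Ax' yA' l0' v0')).
apply: (etrans _ (congr1 Num.conj (esym (pairing_rank1 Ax yA l0 v0)))).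
have Rl (z : R[i]) : Re z < 0 -> 0 < Re (- z^*).
  by case: z => a c /= a0; rewrite oppr_gt0.
rewrite conj_sum; apply: eq_bigr => i _; rewrite conj_sum; apply: eq_bigr => j _.
have cx (u : 'cV[R[i]]_r) m : (CB^T *m map_mx Num.conj u) m 0 = ((CB^T *m u) m 0)^*.
  by rewrite -{1}rB -map_mxM mxE.
rewrite !cx !conjM; congr (_ * _ * _).
by rewrite -double_kernel_integral_conj ?Rl // !conjN.
Qed.

Lemma system_directionD X Y w : system_direction J Rh B (X + Y) w =
  system_direction J Rh B X w + system_direction J Rh B Y w.
Proof. by rewrite /system_direction mulmxDr mulmxDl mulmxDr mulmxDl. Qed.

Lemma system_directionZ a X w : system_direction J Rh B (a *: X) w =
  a *: system_direction J Rh B X w.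
Proof. by rewrite /system_direction -!(scalemxAr, scalemxAl). Qed.

(* The pairing is conjugate linear and purely imaginary on real directions, so it
   maps a conjugate direction to minus the conjugate value; by [pairing_rank1_conj]
   it also maps it to the conjugate value. *)
Lemma pairing_rank1_eq0 (x y : 'cV[R[i]]_r) l v : A *m x = l *: x ->
  y ^t* *m A = v *: y ^t* -> Re l < 0 -> Re v < 0 ->
  \sum_i \sum_j ((CB^T *m x) i 0)^* * I i j (- l^*) (- v^*) * (CB^T *m y) j 0 = 0.
Proof.
move=> Ax yA l0 v0; rewrite -(pairing_rank1 Ax yA l0 v0).
have := pairing_rank1_conj Ax yA l0 v0.
move: (x *m y ^t*) => X.
pose X1 : 'M[R]_r := map_mx (@complex.Re R) X.
pose X2 : 'M[R]_r := map_mx (@complex.Im R) X.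
have EX : X = complexify X1 + (0 +i 1) *: complexify X2.
  apply/matrixP => a c; rewrite !mxE; case: (X a c) => p q.
  by apply/eqP; rewrite eq_complex /=; apply/andP; split; apply/eqP; ring.
have EXc : map_mx Num.conj X = complexify X1 + (0 +i (-1)) *: complexify X2.
  apply/matrixP => a c; rewrite !mxE; case: (X a c) => p q.
  by apply/eqP; rewrite eq_complex /=; apply/andP; split; apply/eqP; ring.
have lin a : pairing (system_direction J Rh B (complexify X1 + a *: complexify X2)) =
    pairing (system_direction J Rh B (complexify X1)) +
    a^* * pairing (system_direction J Rh B (complexify X2)).
  rewrite -pairingZ; last exact: system_direction_L2.
  rewrite -pairingD; last 2 first.
  - exact: system_direction_L2.
  - move=> i j; have [C [mD hD]] := @system_direction_L2 (a *: complexify X2) i j.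
    exists C; split.
      by congr cmeas : mD; apply/funext => w; rewrite system_directionZ.
    congr (_ <= _)%E : hD; apply: eq_integral => w _; by rewrite system_directionZ.
  congr pairing; apply/funext => w.
  by rewrite system_directionD system_directionZ.
move=> h.
have PX := etrans (congr1 (fun Y => pairing (system_direction J Rh B Y)) EX) (lin _).
have PXc := etrans (congr1 (fun Y => pairing (system_direction J Rh B Y)) EXc) (lin _).
exact: (imaginary_combination_eq0 (pairing_system_real X1) (pairing_system_real X2) PX PXc h).
Qed.

Let ev i : Re (lambda i) < 0 := eigenvalue_stable sM eT i.
Let t i : 'cV[R[i]]_r := col i T.
Let s i : 'cV[R[i]]_r := col i ((invmx T) ^t*).
Let c i : 'cV[R[i]]_n := CB^T *m t i.
Let b i : 'cV[R[i]]_n := CB^T *m s i.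

Lemma right_eigenvector i : A *m t i = lambda i *: t i.
Proof.
rewrite /t -col_mulmx (eigenvector_matrixE eT).
by apply/matrixP => a d; rewrite mul_mx_diag !mxE mulrC.
Qed.

Lemma left_eigenvector_adjoint i : (s i) ^t* = row i (invmx T).
Proof. by apply/matrixP => a d; rewrite !mxE conjCK. Qed.

Lemma left_eigenvector i : (s i) ^t* *m A = lambda i *: (s i) ^t*.
Proof.
rewrite left_eigenvector_adjoint -row_mul.
have [uT ET] := eT.
have -> : invmx T *m A = diag_mx (\row_i lambda i) *m invmx T by rewrite -ET mulmxK.
by apply/matrixP => a d; rewrite mul_diag_mx !mxE.
Qed.

Lemma mirror_gt0 i : 0 < Re (- (lambda i)^*).
Proof. by have := ev i; case: (lambda i) => a d /= a0; rewrite oppr_gt0. Qed.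

Lemma two_pi_neq0 : (2 * pi) +i 0 != 0 :> R[i].
Proof. by rewrite -normc_gt0 normcR normr_gt0 gt_eqF // mulr_gt0 // pi_gt0. Qed.

Lemma tangential_interpolation i j :
  (c i) ^t* *m (E (- (lambda i)^*) - E (- (lambda j)^*)) *m b j = 0.
Proof.
set p := - (lambda i)^*; set q := - (lambda j)^*.
(* Coinciding nodes make the difference zero; otherwise the denominator p - q can be cleared. *)
have [-> |pq] := eqVneq p q; first by rewrite subrr mulmx0 mul0mx.
apply: cV_entry0; rewrite mx_entry_bilinear mxE.
have := pairing_rank1_eq0 (right_eigenvector i) (left_eigenvector j) (ev i) (ev j).
rewrite -/(c i) -/(b j) -/p -/q => h.
have pq0 : p - q != 0 by rewrite subr_eq0.
have alg (x y u v w d : R[i]) : d * (w * (x * (u - v) * y)) = - (x * (w * ((v - u) * d)) * y).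
  by ring.
apply: (mulfI two_pi_neq0); apply: (mulfI (invr_neq0 pq0)).
rewrite !mulr0 -[RHS]oppr0 -[in RHS]h -sumrN !mulr_sumr; apply: eq_bigr => a _.
rewrite -sumrN !mulr_sumr; apply: eq_bigr => d _.
have -> : (E p - E q) a d = E p a d - E q a d by rewrite [LHS]mxE [X in _ + X]mxE.
have -> : I a d p q = _ := double_kernel_integral_neq a d (mirror_gt0 i) (mirror_gt0 j) pq.
exact: alg.
Qed.

Lemma tangential_derivative i :
  (c i) ^t* *m (derive1 H (- (lambda i)^*) - derive1 (transfer M) (- (lambda i)^*)) *m b i = 0.
Proof.
set p := - (lambda i)^*.
apply: cV_entry0; rewrite mx_entry_bilinear mxE.
have := pairing_rank1_eq0 (right_eigenvector i) (left_eigenvector i) (ev i) (ev i).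
rewrite -/(c i) -/(b i) -/p => h.
have alg (x y u w : R[i]) : w * (x * u * y) = - (x * (w * - u) * y) by ring.
apply: (mulfI two_pi_neq0).
rewrite mulr0 -[RHS]oppr0 -[in RHS]h -sumrN !mulr_sumr; apply: eq_bigr => a _.
rewrite -sumrN !mulr_sumr; apply: eq_bigr => d _.
have -> : I a d p p = _ := double_kernel_integral_eq a d (mirror_gt0 i).
exact: alg.
Qed.

(** Each mode carries a single kernel, so [boundary_cauchy] replaces its integral by the value of
    the error at the mirror point of that mode. *)
Lemma pairing_modal (D : R -> 'M[R[i]]_n) (u v : 'I_r -> 'I_n -> R[i]) :
  (forall w p q, D w p q = \sum_i ((0 +i w) - lambda i)^-1 * u i p * (v i q)^*) ->
  pairing D = ((2 * pi) +i 0) *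
    \sum_i \sum_p \sum_q (u i p)^* * E (- (lambda i)^*) p q * v i q.
Proof.
move=> hD; have [K hK] := error_line.
have ce p q i : cint setT (fun w => e p q w * (- (lambda i)^* - (0 +i w))^-1) =
    ((2 * pi) +i 0) * E (- (lambda i)^*) p q.
  exact: (boundary_cauchy (fun z => @error_holo p q z) (hK p q) (error_boundary p q)
    (mirror_gt0 i)).
have ie p q i : cintegrable setT (fun w => e p q w * (- (lambda i)^* - (0 +i w))^-1).
  exact: (boundary_kernel_integrable (fun z => @error_holo p q z) (hK p q)
    (error_boundary p q) (mirror_gt0 i)).
rewrite exchange_big /= mulr_sumr; apply: eq_bigr => p _.
rewrite exchange_big /= mulr_sumr; apply: eq_bigr => q _.
rewrite (@eq_cint _ _ _ (fun w => \sum_i ((u i p)^* * v i q) *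
  (e p q w * (- (lambda i)^* - (0 +i w))^-1))); last first.
  move=> w _; rewrite hD conj_sum mulr_sumr; apply: eq_bigr => i _.
  rewrite !conjM conj_kernel conjCK; ring.
rewrite cint_sum // => [|i _]; last exact: cintegrableZ.
rewrite mulr_sumr; apply: eq_bigr => i _; rewrite cintZ // ce; ring.
Qed.

(** The resolvent is the sum of the matrices t_i s_i^* / (z - lambda_i); as [Y] is real, the row
    s_i^* Y is the adjoint of Y^T s_i. *)
Lemma modal_expansion (X : 'M[R[i]]_(r, n)) (Y : 'M[R]_(r, n)) w p q :
  (X^T *m resolvent A (0 +i w) *m complexify Y) p q =
  \sum_i ((0 +i w) - lambda i)^-1 * (X^T *m t i) p 0 * (((complexify Y)^T *m s i) q 0)^*.
Proof.
rewrite (resolvent_spectral eT); last by move=> i; exact: (eigenvalue_neq sM eT).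
rewrite !mulmxA -mulmxA mxE; apply: eq_bigr => i _.
rewrite mul_mx_diag [X in X * _]mxE [X in _ * X * _]mxE.
have -> : (((complexify Y)^T *m s i) q 0)^* = (invmx T *m complexify Y) i q.
  have := adjoint_real Y (s i); rewrite left_eigenvector_adjoint -row_mul.
  by move/matrixP/(_ 0 q); rewrite !mxE.
have -> : (X^T *m t i) p 0 = (X^T *m T) p i by rewrite /t -col_mulmx mxE.
ring.
Qed.

Let Z1 := \sum_i (E (- (lambda i)^*) *m b i *m (t i) ^t*).
Let Z2 := \sum_i ((E (- (lambda i)^*)) ^t* *m c i *m (s i) ^t*).

(** An elementary matrix as direction isolates one entry. The left direction gives [Z1 l m] and the
    right one the conjugate of [Z2 l m], a conjugation that the real part does not see. *)
Lemma port_stationary l m : Re (Z1 l m + Z2 l m) = 0.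
Proof.
pose W : 'M[R]_(r, n) := delta_mx m l.
have Wx (x : 'cV[R[i]]_r) p : ((complexify W)^T *m x) p 0 = (p == l)%:R * x m 0.
  rewrite mxE (bigD1 m) //= big1 ?addr0 => [|a am].
    by rewrite !mxE eqxx /=; case: eqP => _; rewrite ?rmorph1 ?rmorph0.
  by rewrite !mxE (negbTE am) rmorph0 mul0r.
have := pairing_port_real W.
rewrite (@pairing_modal _ (fun i p => ((complexify W)^T *m t i) p 0) (fun i q => b i q 0));
  last by move=> w p q; exact: modal_expansion.
rewrite (@pairing_modal _ (fun i p => c i p 0) (fun i q => ((complexify W)^T *m s i) q 0));
  last by move=> w p q; exact: modal_expansion.
have -> : \sum_i \sum_p \sum_q (((complexify W)^T *m t i) p 0)^* *
    E (- (lambda i)^*) p q * b i q 0 = Z1 l m.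
  rewrite /Z1 summxE; apply: eq_bigr => i _.
  rewrite (bigD1 l) //= [X in _ + X]big1 ?addr0 => [|p pl]; last first.
    by rewrite big1 // => q _; rewrite Wx (negbTE pl) mul0r rmorph0 !mul0r.
  rewrite [RHS]mxE big_ord1 [X in X * _]mxE mulr_suml; apply: eq_bigr => q _.
  rewrite Wx eqxx mul1r !mxE; ring.
have -> : \sum_i \sum_p \sum_q (c i p 0)^* * E (- (lambda i)^*) p q *
    ((complexify W)^T *m s i) q 0 = (Z2 l m)^*.
  rewrite /Z2 summxE conj_sum; apply: eq_bigr => i _.
  rewrite [in RHS]mxE big_ord1 [X in (X * _)^*]mxE conjM conj_sum mulr_suml.
  apply: eq_bigr => p _; rewrite (bigD1 l) //= [X in _ + X]big1 ?addr0 => [|q ql].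
    by rewrite Wx eqxx mul1r !mxE conjM !conjCK; ring.
  by rewrite Wx (negbTE ql) mul0r mulr0.
rewrite -mulrDr; case: (Z1 l m) (Z2 l m) => a1 a2 [b1 b2] /= /eqP.
by rewrite mul0r subr0 mulf_eq0 gt_eqF ?mulr_gt0 ?pi_gt0 //= => /eqP.
Qed.

(** By conjugate symmetry of the error this is the entry of E(- z) at each eigenvalue z, and [F l m]
    is f(A) in the functional calculus of the real matrix A. *)
Let f l m z : R[i] := (E (- z^*) l m)^*.
Let F l m : 'M[R[i]]_r := T *m diag_mx (\row_i f l m (lambda i)) *m invmx T.

Lemma modal_function_real l m a d : (F l m a d)^* = F l m a d.
Proof.
have rA : map_mx Num.conj A = A by exact: complexify_conj.
have := @functional_calculus_real _ _ A T lambda (f l m) rA eT.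
rewrite /= -/(F l m) => h.
have {}h : map_mx Num.conj (F l m) = F l m.
  apply: h => i; rewrite /f conjCK.
  have -> : - lambda i = (- (lambda i)^*)^* by rewrite conjN conjCK.
  exact: (congr1 Num.conj (error_conj l m (mirror_gt0 i))).
by have := congr1 (fun Z : 'M[R[i]]_r => Z a d) h; rewrite mxE.
Qed.

Lemma modal_function_entry l m a d :
  F l m a d = \sum_i (E (- (lambda i)^*) l m)^* * T a i * invmx T i d.
Proof.
rewrite mxE; apply: eq_bigr => i _; rewrite mul_mx_diag; congr (_ * _).
by rewrite [LHS]mxE [X in _ * X]mxE mulrC.
Qed.

(** An entry of [Z1] is a combination of entries of the real matrices [F], with coefficients from
    the real matrix B. *)
Lemma Z1_real l m : (Z1 l m)^* = Z1 l m.
Proof.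
have -> : Z1 l m = \sum_q \sum_a CB a q * F l q m a.
  rewrite /Z1 summxE.
  have -> : \sum_q \sum_a CB a q * F l q m a = \sum_q \sum_a \sum_i
      CB a q * (E (- (lambda i)^*) l q * (T m i)^* * (invmx T i a)^*).
    (* [Z1] involves the conjugates of [T] and of its inverse, so each entry of [F] is first
       replaced by its conjugate. *)
    apply: eq_bigr => q _; apply: eq_bigr => a _; rewrite -modal_function_real.
    rewrite modal_function_entry conj_sum mulr_sumr; apply: eq_bigr => i _.
    by rewrite !conjM conjCK.
  rewrite (eq_bigr (fun q => \sum_i \sum_a
    CB a q * (E (- (lambda i)^*) l q * (T m i)^* * (invmx T i a)^*))); last first.
    by move=> q _; rewrite exchange_big.
  rewrite exchange_big; apply: eq_bigr => i _ /=.
  rewrite mxE big_ord1 mxE mulr_suml; apply: eq_bigr => q _.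
  rewrite [b i q 0]mxE mulr_sumr mulr_suml; apply: eq_bigr => a _.
  rewrite !mxE; ring.
rewrite conj_sum; apply: eq_bigr => q _; rewrite conj_sum; apply: eq_bigr => a _.
by rewrite conjM modal_function_real [CB a q]mxE; congr (_ * _); exact: conj_realC.
Qed.

Lemma Z2_real l m : (Z2 l m)^* = Z2 l m.
Proof.
have -> : Z2 l m = \sum_q \sum_a CB a q * F q l a m.
  rewrite /Z2 summxE.
  have -> : \sum_q \sum_a CB a q * F q l a m = \sum_q \sum_a \sum_i
      CB a q * ((E (- (lambda i)^*) q l)^* * T a i * invmx T i m).
    apply: eq_bigr => q _; apply: eq_bigr => a _.
    by rewrite modal_function_entry mulr_sumr.
  rewrite (eq_bigr (fun q => \sum_i \sum_a
    CB a q * ((E (- (lambda i)^*) q l)^* * T a i * invmx T i m))); last first.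
    by move=> q _; rewrite exchange_big.
  rewrite exchange_big; apply: eq_bigr => i _ /=.
  rewrite mxE big_ord1 mxE mulr_suml; apply: eq_bigr => q _.
  rewrite [c i q 0]mxE mulr_sumr mulr_suml; apply: eq_bigr => a _.
  rewrite left_eigenvector_adjoint !mxE; ring.
rewrite conj_sum; apply: eq_bigr => q _; rewrite conj_sum; apply: eq_bigr => a _.
by rewrite conjM modal_function_real [CB a q]mxE; congr (_ * _); exact: conj_realC.
Qed.

(* Stationarity only kills the real part of [Z1 + Z2]; both terms are real because
   they are built from functions of the real matrix J - R. *)
Lemma port_condition : Z1 + Z2 = 0.
Proof.
apply/matrixP => l m; rewrite mxE [RHS]mxE.
have := port_stationary l m; have := Z1_real l m; have := Z2_real l m.
case: (Z1 l m) (Z2 l m) => a1 a2 [b1 b2] /= [h1] [h2] h3.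
apply/eqP; rewrite eq_complex /= h3 eqxx /=; apply/eqP; lra.
Qed.

End ErrorPairing.

Theorem theorem5p2 (R : realType) (n r : nat) (H : R[i] -> 'M[R[i]]_n)
    (J Rh : 'M[R]_r) (B : 'M[R]_(r, n))
    (T : 'M[R[i]]_r) (lambda : 'I_r -> R[i])
    (t s : 'I_r -> 'cV[R[i]]_r) (b c : 'I_r -> 'cV[R[i]]_n) :
  (0 < n)%N -> (0 < r)%N ->
  hardyH2 H ->
  conj_symmetric H ->
  H2_optimal H (@Sigma_pH R n r) (PHModel J Rh B) ->
  pdmx Rh ->
  let Hh := transfer (PHModel J Rh B) in
  ([set z | pole Hh z] #= `I_r)%card ->
  (forall z : R[i], (forall i, z != lambda i) ->
     Hh z = \sum_(i < r) (z - lambda i)^-1 *: (c i *m (b i) ^t*)) ->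
  eigenvector_matrix (complexify (J - Rh)) T lambda ->
  (forall i, t i = col i T) ->
  (forall i, s i = col i ((invmx T) ^t*)) ->
  (forall i, c i = (complexify B)^T *m t i) ->
  (forall i, b i = (complexify B)^T *m s i) ->
  [/\ forall i j,
        (c i) ^t* *m (H (- (lambda i)^*) - H (- (lambda j)^*)) *m b j =
        (c i) ^t* *m (Hh (- (lambda i)^*) - Hh (- (lambda j)^*)) *m b j,
      forall i,
        (c i) ^t* *m derive1 H (- (lambda i)^*) *m b i =
        (c i) ^t* *m derive1 Hh (- (lambda i)^*) *m b i &
      \sum_(i < r) (H (- (lambda i)^*) *m b i *m (t i) ^t*
                    + (H (- (lambda i)^*)) ^t* *m c i *m (s i) ^t*) =
      \sum_(i < r) (Hh (- (lambda i)^*) *m b i *m (t i) ^t*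
                    + (Hh (- (lambda i)^*)) ^t* *m c i *m (s i) ^t*)].

Proof.
move=> _ _ hH symH opt pd Hh _ _ eT /funext -> /funext -> /funext cE /funext bE.
rewrite cE bE => {c b cE bE}.
have [bv [hbd b_bv]] := hardy_boundary hH.
split=> [i j|i|].
- have := tangential_interpolation hH symH opt pd eT hbd b_bv i j.
  rewrite /= -/Hh.
  move: (H (- (lambda i)^*)) (H (- (lambda j)^*)) => a1 a2.
  move: (Hh (- (lambda i)^*)) (Hh (- (lambda j)^*)) => a3 a4.
  have -> : a1 - a3 - (a2 - a4) = (a1 - a2) - (a3 - a4) by rewrite opprD addrACA -opprD.
  by rewrite mulmxBr mulmxBl => /eqP; rewrite subr_eq0 => /eqP.
- have := tangential_derivative hH symH opt pd eT hbd b_bv i.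
  by rewrite mulmxBr mulmxBl => /eqP; rewrite subr_eq0 => /eqP.
- have := port_condition hH symH opt eT hbd b_bv.
  rewrite /= -/Hh -big_split /= => h; apply/eqP; rewrite -subr_eq0 -sumrB; apply/eqP.
  rewrite -[RHS]h; apply: eq_bigr => i _.
  move: (H _) (Hh _) => a1 a3.
  by rewrite opprD addrACA -!mulmxBl linearB /= map_mxB.
Qed.
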